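(* Let $Z$ be a twistor space on $n\mathbf{CP}^2$ as in the context (with $n\ge 4$), and let $B\subset\mathbf P(\mathcal O(n-2)^{\oplus 2}\oplus\mathcal O)$ be the branch divisor of $\tilde f$, defined by the equation $$\left\{\eta_1\eta_2-\hat g(\lambda)\right\}^2=\lambda(\lambda-\lambda_3)(\lambda-\lambda_4)\cdots(\lambda-\lambda_{n+1})$$ described in the context. Then we have the following. (i) $B$ is irreducible and birational to a ruled surface of genus $[(n-1)/2]$, where $[k]$ denotes the biggest integer not greater than $k$. (ii) A fiber of the natural projection $B\to\mathbf{CP}^1$ (induced from the projection $\mathbf P(\mathcal O(n-2)^{\oplus 2}\oplus\mathcal O)\to\mathbf{CP}^1$) is non-reduced if and only if $\lambda=\lambda_i$ for some $2\le i\le n+1$ (where $\lambda_2=0$) or $\lambda=\infty$. Moreover, the surface $B$ has rational double points of type $A_{3n-9}$ along the fiber over $\lambda=\infty$, which is a sum of two lines in $\mathbf{CP}^2$.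
   Context: Fix $n\ge 4$. $n\mathbf{CP}^2$ is the connected sum of $n$ copies of $\mathbf{CP}^2$. A twistor space $Z$ on $n\mathbf{CP}^2$ is the twistor space of a self-dual metric on it: a compact complex threefold with a fibration $Z\to n\mathbf{CP}^2$ whose fibers (twistor lines) are smooth rational curves with normal bundle $\mathcal O(1)^{\oplus 2}$, equipped with a real structure $\sigma$ (anti-holomorphic involution) preserving each twistor line and without fixed points. Overlines denote $\sigma$-conjugates. $F$ is the canonical square root of $K_Z^{-1}$ (a real line bundle). The degree of a divisor on $Z$ is its intersection number with twistor lines. The surface $S$. Give $\mathbf{CP}^1\times\mathbf{CP}^1$ the real structure (complex conjugation)$\times$(antipodal). Choose a non-real curve $C_1\in|\mathcal O(1,0)|$ and a point $P_1\in C_1$. Blow up $P_1,\overline P_1$; then blow up the intersection points of (the strict transforms of) $C_1\cup\overline C_1$ with the exceptional curves of the last blow-ups; repeat until $n-1$ conjugate pairs of points have been blown up, giving a toric surface $S'$ on which $C_1^2=\overline C_1^2=1-n$. Finally blow up a conjugate pair of points lying on the exceptional curves of the last blow-ups, which are not fixed points of the torus and do not belong to the same $\mathbf C^*$-orbit closure (for the remaining $\mathbf C^*$-action). The result is $S$, with a non-trivial $\mathbf C^*$-action, a real structure and $c_1^2=8-2n$. The exceptional curves of $S\to S'$ are $B_1,\overline B_1$, and $B_2,\overline B_2$ is the unique pair of $(-1)$-curves intersecting $\overline B_1$ and $B_1$ transversally, respectively. $S$ has a unique anticanonical curve, the cycle $C=\sum_{i=1}^{n+1}C_i+\sum_{i=1}^{n+1}\overline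 C_i$ of $2n+2$ smooth rational curves in the cyclic order $C_1,\dots,C_{n+1},\overline C_1,\dots,\overline C_{n+1}$, with $C_1^2=1-n$, $C_2^2=\dots=C_n^2=-2$, $C_{n+1}^2=-1$; $B_1$ meets $C_2$, and $C_2,\overline C_2$ are the only components pointwise fixed by $\mathbf C^*$. Setting. $Z$ is a twistor space on $n\mathbf{CP}^2$ with a $\mathbf C^*$-action compatible with the real structure, such that $S$ is equivariantly contained in $Z$ as a real $\mathbf C^*$-invariant member of $|F|$. Then $|F|=|F|^{\mathbf C^*}$ is a pencil with base locus $C$ having precisely $n+1$ reducible members $S_i^++S_i^-$ ($1\le i\le n+1$), where $S_i^\pm$ are mutually conjugate $\mathbf C^*$-invariant divisors of degree one, and $L_i=S_i^+\cap S_i^-$ is a $\mathbf C^*$-invariant twistor line. The indexing is such that $L_i$ passes through $C_{i-1}\cap C_i$ ($C_0:=\overline C_{n+1}$) and $S_i^+\supset C_{n+1}$. There is a unique twistor line $L_0$ over an isolated fixed point of the induced $U(1)$-action on $n\mathbf{CP}^2$ that is pointwise $\mathbf C^*$-fixed. Linear systems and sections. $V_m\subset H^0(mF)$ is the subspace spanned by products of $m$ elements of $H^0(F)$; the image of the associated map $Z\to\mathbf P^\vee V_m=\mathbf{CP}^m$ is a rational normal curve $\Lambda_m$. $\Phi_m:Z\to\mathbf P^\vee H^0(mF)$ and $\Phi_m^{\mathbf C^*}:Z\to\mathbf P^\vee H^0(mF)^{\mathbf C^*}$ are the maps associated to $|mF|$ and to $\mathbf C^*$-invariant sections; $\pi_m:\mathbf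 P^\vee H^0(mF)\to\mathbf P^\vee V_m$ is the projection. Let $e_i$ be a section of $[S_i^+]$ defining $S_i^+$ and $y_i=e_i\overline e_i\in H^0(F)$. Then $y_1,y_2$ is a basis of $H^0(F)$ and $y_i=y_2-\lambda_iy_1$ for distinct nonzero real numbers $\lambda_3,\dots,\lambda_{n+1}$; put $\lambda_2=0$. Put $z_k=y_1^{n-k}y_2^{k-1}$ ($1\le k\le n$), $z_{n+1}=e_1^{n-2}e_2\cdots e_{n+1}$, $z_{n+2}=\overline z_{n+1}$. The inverse image under $\Phi_{n-1}^{\mathbf C^*}$ of the curve $\Phi_{n-1}^{\mathbf C^*}(L_0)$ is $Y+\overline Y$ with $Y,\overline Y$ irreducible and conjugate, $Y|_S=(n-2)C_1+\sum_{i=2}^n(n+1-i)C_i+B_1+B_2$. The divisors $Y+(n-3)S_1^-$, $\overline Y+(n-3)S_1^+$ belong to $|(n-2)F|$; $x_1,x_2$ are (suitably scaled) mutually conjugate sections of $(n-2)F$ defining them. Put $z_{n+3}=x_1y_1$, $z_{n+4}=x_2y_1$, $z_{n+5}=x_1y_2$, $z_{n+6}=x_2y_2$; $z_1,\dots,z_{n+6}$ is a basis of $H^0((n-1)F)$ and $\Phi_{n-1}$ is bimeromorphic onto its image $X\subset\mathbf{CP}^{n+5}$. The double covering. Let $f:\mathbf{CP}^{n+5}\to\mathbf{CP}^n=\mathbf P^\vee H^0((n-2)F)$ be the projection $(z_1,\dots,z_{n+6})\mapsto(z_1,\dots,z_{n-1},z_{n+3},z_{n+4})$. Blowing up $\mathbf{CP}^{n+5}$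 along $\{z_1=\dots=z_n=0\}$ (the center of $\pi_{n-1}$) and restricting over $\Lambda_{n-1}$ gives $\mathbf P(\mathcal O(n-1)^{\oplus6}\oplus\mathcal O)\to\Lambda_{n-1}$, containing the strict transform $\hat X$ of $X$; blowing up $\mathbf{CP}^n$ along the center of $\pi_{n-2}$ and restricting over $\Lambda_{n-2}$ gives the $\mathbf{CP}^2$-bundle $\mathbf P(\mathcal O(n-2)^{\oplus2}\oplus\mathcal O)\to\Lambda_{n-2}\simeq\mathbf{CP}^1$. $f$ induces a meromorphic map $\hat f$ between these bundles (covering the isomorphism $\Lambda_{n-1}\simeq\Lambda_{n-2}$) whose indeterminacy locus is a $\mathbf{CP}^3$-subbundle; blowing it up and letting $\tilde X$ be the strict transform of $\hat X$ gives a surjective, generically 2 to 1 morphism $\tilde f:\tilde X\to\mathbf P(\mathcal O(n-2)^{\oplus2}\oplus\mathcal O)$. With $\lambda=z_2/z_1$ as coordinate on $\mathbf{CP}^1$ and non-homogeneous fiber coordinates $\eta_1=z_{n+3}/z_1$, $\eta_2=z_{n+4}/z_1$, the branch divisor $B$ of $\tilde f$ is defined by the equation displayed in the claim, where $\hat g$ is a polynomial with real coefficients of degree at most $n-1$.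
   Formalization: ''Rational double points of type A_{3n-9} along the fiber'' is taken transversally (B is locally {x²=y^{3n-8}} times a disk), at all points of the two lines over λ=∞ except their intersection and their two points at infinity (fiber coordinate w=0), where it fails. *)

(* Defs.v *)
From HB Require Import structures.
From mathcomp Require Import all_boot all_order all_algebra.
From mathcomp Require Import complex mpoly.
From mathcomp Require Import boolp classical_sets reals.
From mathcomp Require Import topology normedtype derive.
From mathcomp Require Import zify ring.
Import numFieldNormedType.Exports.
Import Order.TTheory GRing.Theory Num.Theory.

Set Implicit Arguments.
Unset Strict Implicit.
Unset Printing Implicit Defensive.

Local Open Scope ring_scope.
Local Open Scope complex_scope.

(* An ambient variety is a tower of projective bundles
   P(O(d_0) + ... + O(d_k)), given by multihomogeneous (Cox) coordinates.
   The coordinates are grouped in blocks, one per storey of the tower; the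
   torus (K^* )^nblk acts on the i-th coordinate with the weights wt i, and
   the points are the orbits of the vectors having a nonzero coordinate in
   every block.  The two conditions on wt say that a block consists of
   homogeneous fibre coordinates of its storey, twisted by line bundles
   coming from the lower storeys. *)
Record ambient := Ambient {
  ncoor : nat;
  nblk : nat;
  blk : 'I_ncoor -> 'I_nblk;
  wt : 'I_ncoor -> 'I_nblk -> nat;
  wt_diag : forall i, wt i (blk i) = 1%N;
  wt_trig : forall i (j : 'I_nblk), (blk i < j)%N -> wt i j = 0%N
}.

Lemma proj_trig N (i : 'I_N.+1) (j : 'I_1) :
  ((ord0 : 'I_1) < j)%N -> 1%N = 0%N.
Proof. by case: j => [[|?] ?]. Qed.

Definition proj (N : nat) : ambient :=
  @Ambient N.+1 1 (fun=> ord0) (fun _ _ => 1%N)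
           (fun=> erefl) (@proj_trig N).

Section ProdAmbient.
Variables T1 T2 : ambient.

Definition prod_blk (i : 'I_(ncoor T1 + ncoor T2)) : 'I_(nblk T1 + nblk T2) :=
  match split i with
  | inl i1 => lshift _ (blk i1)
  | inr i2 => rshift _ (blk i2)
  end.

Definition prod_wt (i : 'I_(ncoor T1 + ncoor T2))
    (j : 'I_(nblk T1 + nblk T2)) : nat :=
  match split i, split j with
  | inl i1, inl j1 => wt i1 j1
  | inr i2, inr j2 => wt i2 j2
  | _, _ => 0%N
  end.

Lemma prod_diag i : prod_wt i (prod_blk i) = 1%N.
Proof.
rewrite /prod_wt /prod_blk; case: (split i) => k.
  by rewrite (unsplitK (inl _ (blk k))) wt_diag.
by rewrite (unsplitK (inr _ (blk k))) wt_diag.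
Qed.

Lemma prod_trig i (j : 'I_(nblk T1 + nblk T2)) :
  (prod_blk i < j)%N -> prod_wt i j = 0%N.
Proof.
rewrite /prod_wt /prod_blk -{1}(splitK j).
case: (split i) => k; case: (split j) => l //= kl; apply: wt_trig => //.
by move: kl; rewrite ltn_add2l.
Qed.

Definition prod_ambient : ambient := Ambient prod_diag prod_trig.

End ProdAmbient.

(* Classical (naive) algebraic geometry over an algebraically closed field K,
   with points represented by coordinate vectors. *)
Section AlgebraicGeometry.
Variable K : fieldType.

Definition pt (T : ambient) := 'I_(ncoor T) -> K.

Definition stable T (v : pt T) : Prop :=
  forall j : 'I_(nblk T), exists i, blk i = j /\ v i != 0.

Definition same_pt T (v v' : pt T) : Prop :=
  exists t : 'I_(nblk T) -> K, (forall j, t j != 0) /\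
    forall i, v' i = (\prod_j t j ^+ wt i j) * v i.

Definition fst_pt T1 T2 (v : pt (prod_ambient T1 T2)) : pt T1 :=
  fun i => v (lshift (ncoor T2) i).
Definition snd_pt T1 T2 (v : pt (prod_ambient T1 T2)) : pt T2 :=
  fun i => v (rshift (ncoor T1) i).

Definition mhomog T (d : 'I_(nblk T) -> nat) (f : {mpoly K[ncoor T]}) : Prop :=
  forall m, m \in msupp f ->
  forall j, (\sum_i m i * wt i j)%N = d j.

Definition locus T (f : {mpoly K[ncoor T]}) (v : pt T) : Prop :=
  stable v /\ f.@[v] = 0.

Definition zclosed T (Z : pt T -> Prop) : Prop :=
  exists S : {mpoly K[ncoor T]} -> Prop,
    (forall f, S f -> exists d, mhomog d f) /\
    (forall v, Z v <-> stable v /\ forall f, S f -> f.@[v] = 0).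

Definition zopen_in T (X U : pt T -> Prop) : Prop :=
  exists2 Z, zclosed Z & forall v, U v <-> X v /\ ~ Z v.

Definition zirreducible T (X : pt T -> Prop) : Prop :=
  (exists v, X v) /\
  forall Z1 Z2, zclosed Z1 -> zclosed Z2 ->
    (forall v, X v -> Z1 v \/ Z2 v) ->
    (forall v, X v -> Z1 v) \/ (forall v, X v -> Z2 v).

(* The effective divisor f = 0 has irreducible support and multiplicity one:
   f generates the ideal of its zero locus. *)
Definition irreducible_divisor T (f : {mpoly K[ncoor T]}) : Prop :=
  zirreducible (locus f) /\
  forall d h, @mhomog T d h -> (forall v, locus f v -> h.@[v] = 0) ->
    exists c, h = c * f.

(* A morphism is given, near every point, by multihomogeneous polynomials
   transforming the torus action of T into that of T'. *)
Definition morphism T T' (U : pt T -> Prop) (V : pt T' -> Prop)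
    (phi : pt T -> pt T') : Prop :=
  (forall v, U v -> V (phi v)) /\
  forall v, U v ->
    exists (d : 'I_(nblk T') -> 'I_(nblk T) -> nat)
           (G : 'I_(ncoor T') -> {mpoly K[ncoor T]}),
      (forall i, @mhomog T (fun j => \sum_k wt i k * d k j)%N (G i)) /\
      @stable T' (fun i => (G i).@[v]) /\
      (forall v', U v' -> @stable T' (fun i => (G i).@[v']) ->
         same_pt (phi v') (fun i => (G i).@[v'])).

Definition isomorphism T T' (U : pt T -> Prop) (V : pt T' -> Prop)
    (phi : pt T -> pt T') (psi : pt T' -> pt T) : Prop :=
  [/\ morphism U V phi, morphism V U psi,
      forall v, U v -> same_pt (psi (phi v)) v &
      forall w, V w -> same_pt (phi (psi w)) w].

(* For irreducible X and Y. *)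
Definition birational T T' (X : pt T -> Prop) (Y : pt T' -> Prop) : Prop :=
  exists U V, [/\ zopen_in X U, zopen_in Y V, exists v, U v &
    exists phi psi, isomorphism U V phi psi].

(* P is a linear space of functions on D; it has dimension d, two functions
   being identified when they agree on D. *)
Definition has_dim (I : Type) (D : I -> Prop) (P : (I -> K) -> Prop) (d : nat)
    : Prop :=
  exists e : 'I_d -> I -> K,
    [/\ forall k, P (e k),
        forall c : 'I_d -> K,
          (forall x, D x -> \sum_k c k * e k x = 0) -> forall k, c k = 0 &
        forall f, P f -> exists c : 'I_d -> K,
          forall x, D x -> f x = \sum_k c k * e k x].

Definition mdiff m (f : {mpoly K[m]}) (v h : 'I_m -> K) : K :=
  \sum_i (f^`M(i)).@[v] * h i.

(* Tangent space at v to the cone over X, i.e. the preimage of X in the space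
   of stable vectors.  The tangent space of X at the point represented by v is
   its quotient by the nblk T independent directions of the torus orbit. *)
Definition tangent T (X : pt T -> Prop) (v h : pt T) : Prop :=
  forall d f, @mhomog T d f -> (forall v', X v' -> f.@[v'] = 0) ->
    mdiff f v h = 0.

(* The ambient varieties are projective, so X is.  In characteristic zero, an
   irreducible X whose tangent spaces all have dimension 1 is a smooth curve. *)
Definition smooth_proj_curve T (X : pt T -> Prop) : Prop :=
  [/\ zclosed X, zirreducible X &
      forall v, X v -> has_dim (fun=> True) (tangent X v) (1 + nblk T)].

(* Rational functions p / q, with p and q multihomogeneous of the same
   multidegree, and their differentials. *)
Definition ratfun T (p : {mpoly K[ncoor T]} * {mpoly K[ncoor T]}) : Prop :=
  exists d, @mhomog T d p.1 /\ @mhomog T d p.2.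
Definition rval m (p : {mpoly K[m]} * {mpoly K[m]}) (v : 'I_m -> K) : K :=
  p.1.@[v] / p.2.@[v].
Definition rdiff m (p : {mpoly K[m]} * {mpoly K[m]}) (v h : 'I_m -> K) : K :=
  (mdiff p.1 v h * p.2.@[v] - p.1.@[v] * mdiff p.2 v h) / p.2.@[v] ^+ 2.

Definition tangent_pairs T (X : pt T -> Prop) (x : pt T * pt T) : Prop :=
  X x.1 /\ tangent X x.1 x.2.

(* Regular differential 1-forms on X: families of linear forms on the tangent
   spaces which are locally of the form \sum_k a_k db_k, with a_k and b_k
   regular functions. *)
Definition regular_form T (X : pt T -> Prop) (w : pt T * pt T -> K) : Prop :=
  forall v, X v ->
    exists (N : nat)
           (a b : 'I_N -> {mpoly K[ncoor T]} * {mpoly K[ncoor T]}),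
      (forall k, [/\ ratfun (a k), ratfun (b k),
                     (a k).2.@[v] != 0 & (b k).2.@[v] != 0]) /\
      (forall v' h, tangent_pairs X (v', h) ->
         (forall k, (a k).2.@[v'] != 0 /\ (b k).2.@[v'] != 0) ->
         w (v', h) = \sum_k rval (a k) v' * rdiff (b k) v' h).

Definition genus T (X : pt T -> Prop) (g : nat) : Prop :=
  has_dim (tangent_pairs X) (regular_form X) g.

Definition times_P1 T (U : pt T -> Prop) (v : pt (prod_ambient T (proj 1)))
    : Prop := U (fst_pt v) /\ stable (snd_pt v).

Definition P1_bundle T T' (W : pt T -> Prop) (X : pt T' -> Prop)
    (pi : pt T -> pt T') : Prop :=
  morphism W X pi /\
  forall x, X x -> exists U, [/\ zopen_in X U, U x &
    exists phi psi,
      isomorphism (fun w => W w /\ U (pi w)) (times_P1 U) phi psi /\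
      forall w, W w -> U (pi w) -> same_pt (fst_pt (phi w)) (pi w)].

Definition ruled_surface_of_genus T (W : pt T -> Prop) (g : nat) : Prop :=
  zclosed W /\
  exists (T' : ambient) (X : pt T' -> Prop) (pi : pt T -> pt T'),
    [/\ smooth_proj_curve X, genus X g & P1_bundle W X pi].

(* The plane curve f = 0 (f a form in three variables) is a reduced scheme:
   the coordinate rings K[X_0, X_1, X_2] / (f, X_i - 1) of its intersections
   with the standard affine charts have no nonzero nilpotent element. *)
Definition reduced_plane_curve (f : {mpoly K[3]}) : Prop :=
  forall (i : 'I_3) (h : {mpoly K[3]}) (k : nat),
    (exists a b, h ^+ k = a * f + b * ('X_i - 1)) ->
    exists a b, h = a * f + b * ('X_i - 1).

End AlgebraicGeometry.

(* C is a numFieldType, e.g. the complex numbers, so that differentiable means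
   holomorphic in that case.  The germ at p of the surface f = 0 in affine
   3-space is, up to biholomorphism, the product of a smooth curve and of the
   A_k curve singularity x^2 = y^(k+1). *)
Definition transversal_A (C : numFieldType) (k : nat)
    (f : {mpoly C[3]}) (p : 'rV[C]_3) : Prop :=
  exists (psi phi : 'rV[C]_3 -> 'rV[C]_3) (u : 'rV[C]_3 -> C^o),
    [/\ [/\ psi p = 0, phi 0 = p & u p != 0],
        (\forall x \near p, differentiable psi x /\ differentiable u x) /\
        (\forall y \near (0 : 'rV[C]_3), differentiable phi y),
        (\forall x \near p, phi (psi x) = x) /\
        (\forall y \near (0 : 'rV[C]_3), psi (phi y) = y) &
        \forall x \near p,
          f.@[fun i => (x : 'rV[C]_3) 0 i] =
          u x * (psi x 0 (inord 0) ^+ 2 - psi x 0 (inord 1) ^+ k.+1)].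

(* The bundle P(O(n-2)^2 + O) over CP^1, with coordinates a, b on the base and
   x1, x2, w on the fibres; x1 and x2 are twisted by O(n-2). *)
Section Bundle.
Variable n : nat.

Definition bundle_blk (i : 'I_5) : 'I_2 := inord (2 <= i)%N.
Definition bundle_wt (i : 'I_5) (j : 'I_2) : nat :=
  nth 0%N (nth [::] [:: [:: 1; 0]; [:: 1; 0];
                        [:: n - 2; 1]; [:: n - 2; 1]; [:: 0; 1]] i)%N j.

Lemma bundle_blkE i : bundle_blk i = (2 <= i)%N :> nat.
Proof. by rewrite inordK //; case: (1 < i)%N. Qed.

Lemma bundle_diag i : bundle_wt i (bundle_blk i) = 1%N.
Proof.
by rewrite /bundle_wt bundle_blkE; case: i => [[|[|[|[|[|i]]]]]].
Qed.

Lemma bundle_trig i (j : 'I_2) :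
  (bundle_blk i < j)%N -> bundle_wt i j = 0%N.
Proof.
rewrite /bundle_wt bundle_blkE.
by case: i j => [[|[|[|[|[|i]]]]] i5] [[|[|j]] j2].
Qed.

Definition bundle : ambient := Ambient bundle_diag bundle_trig.

End Bundle.

Section Branch.
Variables (R : realType) (n : nat) (lam : nat -> R) (g : {poly R}).

Local Notation a := ('X_(inord 0) : {mpoly R[i][5]}).
Local Notation b := ('X_(inord 1) : {mpoly R[i][5]}).
Local Notation x1 := ('X_(inord 2) : {mpoly R[i][5]}).
Local Notation x2 := ('X_(inord 3) : {mpoly R[i][5]}).
Local Notation w := ('X_(inord 4) : {mpoly R[i][5]}).

(* a^(n-1) g(b/a) *)
Definition ghom : {mpoly R[i][5]} :=
  \sum_(k < n) ((g`_k)%:C)%:MP * a ^+ (n.-1 - k) * b ^+ k.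

(* Multihomogeneous equation of the branch divisor B: the equation
   (eta1 eta2 - g(lambda))^2 = lambda \prod_i (lambda - lambda_i) multiplied
   by w^4 a^(4n-8), with lambda = b/a and eta_i = x_i / (a^(n-2) w); see
   branch_affine.  It has no factor a or w, since its restriction to a = 0 or
   to w = 0 is (x1 x2)^2, so B is the closure of the affine surface. *)
Definition branch : {mpoly R[i][ncoor (bundle n)]} :=
  (x1 * x2 - w ^+ 2 * a ^+ (n - 3) * ghom) ^+ 2
  - w ^+ 4 * a ^+ (3 * n - 8) *
      (b * \prod_(3 <= i < n.+2) (b - ((lam i)%:C)%:MP * a)).

(* Fibre of B over [a0 : b0], as a curve in the plane with coordinates
   x1, x2, w. *)
Definition fibre (a0 b0 : R[i]) : {mpoly R[i][3]} :=
  comp_mpoly [tuple a0%:MP; b0%:MP; 'X_(inord 0); 'X_(inord 1);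
                          'X_(inord 2)] branch.

(* B in the chart b = w = 1, with coordinates a = 1/lambda, x1, x2.  Of the
   fibre x1 x2 = 0 over lambda = oo it misses only the two points with w = 0,
   where B also contains the curves w = x1 = 0 and w = x2 = 0 in its singular
   locus. *)
Definition branch_at_infty : {mpoly R[i][3]} :=
  comp_mpoly [tuple 'X_(inord 0); 1; 'X_(inord 1); 'X_(inord 2); 1]
                   branch.

End Branch.

Lemma branch_affine (R : realType) (n : nat) (lam : nat -> R) (g : {poly R})
    (v : 'I_5 -> R[i]) (l eta1 eta2 : R[i]) :
  (4 <= n)%N -> (size g <= n)%N ->
  v (inord 0) != 0 -> v (inord 4) != 0 ->
  l = v (inord 1) / v (inord 0) ->
  eta1 = v (inord 2) / (v (inord 0) ^+ (n - 2) * v (inord 4)) ->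
  eta2 = v (inord 3) / (v (inord 0) ^+ (n - 2) * v (inord 4)) ->
  (branch n lam g).@[v] = 0 <->
  (eta1 * eta2 - (map_poly (real_complex R) g).[l]) ^+ 2 =
    l * \prod_(3 <= i < n.+2) (l - (lam i)%:C).
Proof.
move=> n4 sg a0 w0 lE e1E e2E.
set a := v (inord 0) in a0 lE e1E e2E *; set w := v (inord 4) in w0 e1E e2E *.
set G := (map_poly _ g).[l]; set P := \prod_(3 <= i < n.+2) (l - _).
have bE : v (inord 1) = l * a by rewrite lE mulfVK.
have aw0 : a ^+ (n - 2) * w != 0 by rewrite mulf_neq0 ?expf_neq0.
have x1E : v (inord 2) = eta1 * (a ^+ (n - 2) * w) by rewrite e1E mulfVK.
have x2E : v (inord 3) = eta2 * (a ^+ (n - 2) * w) by rewrite e2E mulfVK.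
have gE : (ghom n g).@[v] = a ^+ n.-1 * G.
  rewrite /ghom raddf_sum /= /G (@horner_coef_wide _ n); last first.
    by rewrite (leq_trans (size_poly _ _)).
  rewrite big_distrr; apply: eq_bigr => k _ /=.
  rewrite !mevalM mevalC !rmorphXn /= !mevalXU bE -/a exprMn coef_map /=.
  have kn : (k <= n.-1)%N by case: k => k /= kn; lia.
  by rewrite -[in RHS](subnK kn) exprD; ring.
have PE : (\prod_(3 <= i < n.+2)
    ('X_(inord 1) - ((lam i)%:C)%:MP * 'X_(inord 0) : {mpoly R[i][5]})).@[v]
    = a ^+ n.-1 * P.
  rewrite rmorph_prod /P /=.
  have -> : n.-1 = (n.+2 - 3)%N by lia.
  rewrite -prodr_const_nat -big_split /=; apply: eq_bigr => i _.
  by rewrite mevalB mevalM mevalC !mevalXU bE -/a; ring.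
have E : (branch n lam g).@[v] =
    (w ^+ 4 * a ^+ (4 * n - 8)) * ((eta1 * eta2 - G) ^+ 2 - l * P).
  rewrite /branch mevalB rmorphXn /= mevalB !mevalM PE gE !rmorphXn.
  rewrite /= !mevalXU -/a -/w x1E x2E bE.
  have [k ->] : exists k, n = (k + 4)%N by exists (n - 4)%N; lia.
  have -> : (k + 4 - 2 = k + 2)%N by lia.
  have -> : (k + 4 - 3 = k + 1)%N by lia.
  have -> : (k + 4).-1 = (k + 3)%N by lia.
  have -> : (3 * (k + 4) - 8 = k + k + k + 4)%N by lia.
  have -> : (4 * (k + 4) - 8 = k + k + k + k + 8)%N by lia.
  by rewrite !exprD; ring.
rewrite E; split=> [/eqP|->]; last by rewrite subrr mulr0.
rewrite !mulf_eq0 !expf_eq0 (negPf a0) (negPf w0) !andbF /= subr_eq0.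
by move/eqP.
Qed.

(* Main.v *)
(* With y = eta1 eta2 - g(lambda), the equation of B becomes
   y^2 = lambda (lambda - lambda_3) ... (lambda - lambda_(n+1)), so B is birational
   to C x P^1, where C is a hyperelliptic curve, embedded as a smooth curve in
   P(O(m) + O) over P^1 with 2m = n or n + 1.  A regular 1-form on C is
   f dlambda / y; regularity on the affine part makes f a polynomial r + s y, and
   the comparison with the chart at infinity gives s = 0 and deg r <= m - 2, whence
   the genus m - 1 = [(n-1)/2].

   The equation of B is quadratic in x1, with discriminant b times a polynomial
   prime to b; this is not a square, and irreducibility follows by
   pseudo-division.  The fibres are pairs of conics x1 x2 = (g + d) w^2 and
   x1 x2 = (g - d) w^2, where d^2 is the right-hand side of the equation, and they
   are reduced when d <> 0.  Over lambda = oo the equation is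
   X^2 = a^(3n-8) Q(a) with X a coordinate and Q(0) = 1, and Q has a holomorphic
   square root near 0. *)
Require Import Defs.
From HB Require Import structures.
From mathcomp Require Import all_boot all_order all_algebra.
From mathcomp Require Import complex mpoly.
From mathcomp Require Import boolp classical_sets functions reals.
From mathcomp Require Import topology normedtype derive.
From mathcomp Require Import zify ring.
Import numFieldNormedType.Exports.
Import Order.TTheory GRing.Theory Num.Theory.

Set Implicit Arguments.
Unset Strict Implicit.
Unset Printing Implicit Defensive.

Local Open Scope ring_scope.

(** The definitions speak of points, so polynomial identities are drawn from values: in
    characteristic zero a polynomial with zero values is zero, and a variable is absent when the
    values ignore it. Two obstacles shape the irreducibility proof. The leading coefficient x2^2 is
    no unit, so pseudo-division gives only x2^(2k) h as a multiple of the equation; the power is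
    cancelled because x2 does not divide the equation. And only stable vectors count, so vanishing
    is exploited just where a w <> 0. A remainder r x1 + s is killed through its norm to the ring
    without x1: a zero norm makes the discriminant a square. For the genus, a regular form is known
    only through local quotients. The clearing of denominators starts at a branch point, where y = 0
    and the norm of a nonzero denominator is visibly nonzero; each chart must therefore contain one.
    The gluing x |-> 1/x multiplies the normalized form by x^(m-2), and reversing polynomials
    reduces the comparison to a count of degrees. The exponent 3n - 8 is (4n - 8) - n: a^(4n-8)
    clears the denominators of (eta1 eta2)^2, and the right-hand side has degree n in lambda. *)

Section Substitution.
Variables (K : numClosedFieldType) (m : nat).
Implicit Types (p q r s h : {mpoly K[m]}) (v : 'I_m -> K) (i j : 'I_m).

(** * Substitution for one variable in a polynomial ring *)

Lemma mpoly_ring_ind (P : {mpoly K[m]} -> Prop) :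
  (forall c, P c%:MP) -> (forall p q, P p -> P q -> P (p + q)) ->
  (forall i p, P p -> P ('X_i * p)) -> forall p, P p.
Proof.
move=> PC PD PX p.
have P0 : P 0 by rewrite -mpolyC0.
have PM (e : 'X_{1..m}) c : P (c *: 'X_[e]).
  have PXn i k q : P q -> P ('X_i ^+ k * q).
    by move=> Pq; elim: k => [|k IH]; rewrite ?mul1r // exprS -mulrA; apply: PX.
  rewrite mpolyXE_id -mul_mpolyC mulrC.
  elim: (index_enum _) => [|i l IH]; first by rewrite big_nil mul1r.
  by rewrite big_cons -mulrA; apply: PXn.
by elim/mpolyind: p => // c e p _ _ IH; apply: PD.
Qed.

Lemma mpolyXU_neq0 i : 'X_i != 0 :> {mpoly K[m]}.
Proof. by rewrite -msize_poly_eq0 msizeX mdeg1. Qed.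

Lemma mevalXn k v : {morph meval v : p / p ^+ k >-> p ^+ k}.
Proof. by move=> p; rewrite rmorphXn. Qed.

Lemma meval_nat k v : (k%:R : {mpoly K[m]}).@[v] = k%:R.
Proof. by rewrite mevalMn meval1. Qed.

Definition mevalS :=
  (mevalXn, mevalN, mevalM, mevalC, mevalXU, meval_nat, meval0, meval1, mevalD).

Definition upd v i x : 'I_m -> K := fun j => if j == i then x else v j.

Lemma upd_same v i x : upd v i x i = x. Proof. by rewrite /upd eqxx. Qed.

Lemma upd_other v i x j : j != i -> upd v i x j = v j.
Proof. by rewrite /upd => /negPf ->. Qed.

Definition subst i q : {mpoly K[m]} -> {mpoly K[m]} :=
  comp_mpoly [tuple (if j == i then q else 'X_j) | j < m].

Lemma substE i q p v : (subst i q p).@[v] = p.@[upd v i q.@[v]].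
Proof.
rewrite /subst comp_mpoly_meval; apply: meval_eq => j.
by rewrite tnth_mktuple /upd; case: eqP => // _; rewrite mevalXU.
Qed.

Lemma substD i q p p' : subst i q (p + p') = subst i q p + subst i q p'.
Proof. exact: comp_mpolyD. Qed.
Lemma substB i q p p' : subst i q (p - p') = subst i q p - subst i q p'.
Proof. exact: comp_mpolyB. Qed.
Lemma substN i q p : subst i q (- p) = - subst i q p.
Proof. exact: comp_mpolyN. Qed.
Lemma substM i q p p' : subst i q (p * p') = subst i q p * subst i q p'.
Proof. exact: rmorphM. Qed.
Lemma subst_exp i q p k : subst i q (p ^+ k) = subst i q p ^+ k.
Proof. exact: rmorphXn. Qed.
Lemma substC i q c : subst i q c%:MP = c%:MP.
Proof. exact: comp_mpolyC. Qed.
Lemma substX i q : subst i q 'X_i = q.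
Proof. by rewrite /subst comp_mpolyXU -tnth_nth tnth_mktuple eqxx. Qed.
Lemma substXU i j q : j != i -> subst i q 'X_j = 'X_j.
Proof.
by rewrite /subst comp_mpolyXU -tnth_nth tnth_mktuple => /negPf ->.
Qed.

Lemma subst_dvd i q h : exists c, h = c * ('X_i - q) + subst i q h.
Proof.
elim/mpoly_ring_ind: h => [c|p p' [c {1}->] [c' {1}->]|j p [c {1}->]].
- by exists 0; rewrite substC mul0r add0r.
- by exists (c + c'); rewrite substD; ring.
case: (eqVneq j i) => [->|ji].
  by exists ('X_i * c + subst i q p); rewrite substM substX; ring.
by exists ('X_j * c); rewrite substM substXU //; ring.
Qed.

End Substitution.

(** * Polynomials determined by their values, and differentials *)

Section Values.
Variable K : numClosedFieldType.

(** Otherwise the nonzero polynomial [p * q] would have as roots the first [size (p * q)] natural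
    numbers, which are distinct in characteristic zero. *)
Lemma poly_vanish (p : {poly K}) (q : {poly K}) : q != 0 ->
  (forall x, q.[x] != 0 -> p.[x] = 0) -> p = 0.
Proof.
move=> q0 pq; apply/eqP; apply: contraT => p0.
have pq0 : p * q != 0 by rewrite mulf_neq0.
pose s := [seq (k%:R : K) | k <- iota 0 (size (p * q))].
have := @max_poly_roots _ (p * q) s pq0.
rewrite size_map size_iota ltnn => -> //; last first.
  by rewrite map_inj_uniq ?iota_uniq // => x y /eqP; rewrite eqr_nat => /eqP.
apply/allP => x _; rewrite /root hornerM mulf_eq0.
by case: (eqVneq q.[x] 0) => [|/pq ->]; rewrite ?orbT // eqxx.
Qed.

Section Differential.
Variable m : nat.
Implicit Types (p q : {mpoly K[m]}) (v h : 'I_m -> K) (i j : 'I_m).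

Lemma mdiffC c v h : mdiff c%:MP v h = 0.
Proof. by rewrite /mdiff big1 // => i _; rewrite mderivC meval0 mul0r. Qed.

Lemma mdiffD p q v h : mdiff (p + q) v h = mdiff p v h + mdiff q v h.
Proof.
rewrite /mdiff -big_split /=; apply: eq_bigr => i _.
by rewrite mderivD mevalD mulrDl.
Qed.

Lemma mdiffN p v h : mdiff (- p) v h = - mdiff p v h.
Proof.
by rewrite /mdiff -sumrN; apply: eq_bigr => i _; rewrite mderivN mevalN mulNr.
Qed.

Lemma mdiffB p q v h : mdiff (p - q) v h = mdiff p v h - mdiff q v h.
Proof. by rewrite mdiffD mdiffN. Qed.

Lemma mdiffM p q v h :
  mdiff (p * q) v h = mdiff p v h * q.@[v] + p.@[v] * mdiff q v h.
Proof.
rewrite /mdiff mulr_suml mulr_sumr -big_split /=; apply: eq_bigr => i _.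
by rewrite mderivM mevalD !mevalM; ring.
Qed.

Lemma mdiffX i v h : mdiff 'X_i v h = h i.
Proof.
rewrite /mdiff (bigD1 i) //= big1 => [|j ji].
  rewrite mderivX mnm1E eqxx scale1r.
  have -> : (U_(i) - U_(i) = 0 :> 'X_{1..m})%MM.
    by apply/mnmP => k; rewrite mnmBE subnn mnm0E.
  by rewrite mpolyX0 meval1 mul1r addr0.
by rewrite mderivX mnm1E eq_sym (negPf ji) scale0r meval0 mul0r.
Qed.

Lemma mdiffXn p k v h :
  mdiff (p ^+ k) v h = k%:R * p.@[v] ^+ k.-1 * mdiff p v h.
Proof.
elim: k => [|k IH]; first by rewrite expr0 -mpolyC1 mdiffC !mul0r.
rewrite exprS mdiffM IH mevalXn.
by case: k {IH} => [|k]; rewrite ?expr0 //= ?exprS -?natr1; ring.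
Qed.

Lemma mdiffDr p v h h' :
  mdiff p v (fun i => h i + h' i) = mdiff p v h + mdiff p v h'.
Proof.
by rewrite /mdiff -big_split /=; apply: eq_bigr => i _; rewrite mulrDr.
Qed.

Lemma mdiffZr p v c h : mdiff p v (fun i => c * h i) = c * mdiff p v h.
Proof. by rewrite /mdiff mulr_sumr; apply: eq_bigr => i _; ring. Qed.

(** Restriction to a line reduces differential calculus in several variables to derivatives of
    polynomials in one variable. *)
Lemma line_poly p v h :
  exists q : {poly K}, forall t, let v' := fun i => v i + t * h i in
    q.[t] = p.@[v'] /\ q^`().[t] = mdiff p v' h.
Proof.
elim/mpoly_ring_ind: p => [c|p p' [q Hq] [q' Hq']|j p [q Hq]].
- by exists c%:P => t v'; rewrite hornerC mevalC derivC horner0 mdiffC.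
- exists (q + q') => t v'; have [h1 h2] := Hq t; have [h3 h4] := Hq' t.
  by rewrite derivD !hornerD mevalD mdiffD h1 h2 h3 h4.
exists (((v j)%:P + 'X * (h j)%:P) * q) => t v'; have [h1 h2] := Hq t.
rewrite derivM !hornerD !hornerM derivD derivM !derivC derivX !hornerE h1 h2.
by rewrite mevalM mdiffM mevalXU mdiffX; split; rewrite // mulrC.
Qed.

(** If all values are zero, so are those of the partial derivatives, by restriction to coordinate
    lines. A coefficient is the value at 0 of an iterated derivative, up to a product of factorials,
    which is invertible in characteristic zero. *)
Lemma mpoly_ext p : (forall v, p.@[v] = 0) -> p = 0.
Proof.
move=> pv; apply/mpolyP => e; rewrite mcoeff0.
have Pd i q : (forall v, q.@[v] = 0) -> forall v, q^`M(i).@[v] = 0.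
  move=> qv v; have [r Hr] := line_poly q v (fun j => (j == i)%:R).
  have r0 : r = 0.
    by apply: (poly_vanish (oner_neq0 _)) => x _; have [-> _] := Hr x.
  have [_] := Hr 0; rewrite r0 derivC horner0 /mdiff (bigD1 i) //= big1.
    rewrite eqxx mulr1 addr0 => /esym <-; apply: meval_eq => j.
    by rewrite mul0r addr0.
  by move=> j /negPf ->; rewrite mulr0.
have : (p^`M[e]).@[fun=> 0] = 0.
  rewrite /mderivm; elim: (enum _) (fun=> 0) => //= i l IH v.
  by elim: (e i) v => //= k IHk; apply: Pd.
have ev0 q : q.@[fun=> 0] = q@_0%MM.
  elim/mpoly_ring_ind: q => [c|q q' IH IH'|i q _].
  - by rewrite mevalC mcoeffC eqxx mulr1.
  - by rewrite mevalD mcoeffD IH IH'.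
  by rewrite mevalM mevalXU mul0r rmorphM /= mcoeffX mnm1_eq0 mul0r.
rewrite ev0 mcoeff_mderivm addm0 => /eqP; rewrite mulrn_eq0 => /orP[|/eqP->//].
by rewrite eqn0Ngt prodn_gt0 // => i; rewrite ffactnn fact_gt0.
Qed.

Lemma mpoly_ext_eq p q : (forall v, p.@[v] = q.@[v]) -> p = q.
Proof.
move=> pq; apply/eqP; rewrite -subr_eq0; apply/eqP/mpoly_ext => v.
by rewrite mevalB pq subrr.
Qed.

Lemma mpoly_neq0P p : p != 0 -> exists v, p.@[v] != 0.
Proof.
move=> p0; apply: contrapT => H; case/eqP: p0; apply: mpoly_ext => v.
by apply/eqP; apply: contraT => pv; case: H; exists v.
Qed.

End Differential.
End Values.

(** * Vanishing on a hypersurface that is quadratic in one variable *)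

Section QuadraticForms.
Variables (K : numClosedFieldType) (m : nat).
Implicit Types (p q r s h : {mpoly K[m]}) (v : 'I_m -> K) (i j : 'I_m).

(** Absence of ['X_i] is expressed through values, so that its stability under the ring operations
    is plain rewriting. *)
Definition indep i r := forall v x, r.@[upd v i x] = r.@[v].

Lemma indepC i c : indep i c%:MP.
Proof. by move=> v x; rewrite !mevalC. Qed.
Lemma indepD i p q : indep i p -> indep i q -> indep i (p + q).
Proof. by move=> hp hq v x; rewrite !mevalD hp hq. Qed.
Lemma indepB i p q : indep i p -> indep i q -> indep i (p - q).
Proof. by move=> hp hq v x; rewrite !mevalB hp hq. Qed.
Lemma indepM i p q : indep i p -> indep i q -> indep i (p * q).
Proof. by move=> hp hq v x; rewrite !mevalM hp hq. Qed.
Lemma indepXn i p k : indep i p -> indep i (p ^+ k).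
Proof. by move=> hp v x; rewrite !rmorphXn /= hp. Qed.
Lemma indepXU i j : j != i -> indep i 'X_j.
Proof. by move=> ji v x; rewrite !mevalXU upd_other. Qed.
Lemma indepN i p : indep i p -> indep i (- p).
Proof. by move=> hp v x; rewrite !mevalN hp. Qed.
Lemma indepMn i p k : indep i p -> indep i (p *+ k).
Proof. by move=> hp v x; rewrite !mevalMn hp. Qed.
Lemma indep_sum i (I : Type) (l : seq I) (P : pred I) (F : I -> {mpoly K[m]}) :
  (forall k, indep i (F k)) -> indep i (\sum_(k <- l | P k) F k).
Proof. by move=> hF v x; rewrite !raddf_sum /=; apply: eq_bigr => k _; apply: hF. Qed.
Lemma indep_prod i (I : Type) (l : seq I) (P : pred I) (F : I -> {mpoly K[m]}) :
  (forall k, indep i (F k)) -> indep i (\prod_(k <- l | P k) F k).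
Proof. by move=> hF v x; rewrite !rmorph_prod /=; apply: eq_bigr => k _; apply: hF. Qed.

(** 'X_j is prime and does not divide [p]: setting it to zero in the equation shows that it divides
    [c], and one factor is removed at a time. *)
Lemma cancelX j k p h c : subst j 0 p != 0 -> 'X_j ^+ k * h = c * p ->
  exists c', h = c' * p.
Proof.
move=> pj; elim: k => [|k IH] in h c * => E; first by exists c; rewrite -E expr0 mul1r.
have Xj0 := mpolyXU_neq0 K j.
have [c1 c1E] := subst_dvd j 0 c.
have cj : subst j 0 c = 0.
  have := congr1 (subst j 0) E; rewrite !substM subst_exp substX exprS !mul0r.
  by move/esym/eqP; rewrite mulf_eq0 (negPf pj) orbF => /eqP.
apply: (IH h c1); apply: (mulfI Xj0).
by rewrite mulrA -exprS E c1E cj subr0 addr0; ring.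
Qed.

(* Infinite descent: X_j divides r, hence s. *)
Lemma square_descent j e r s : subst j 0 e != 0 ->
  r ^+ 2 = 'X_j * e * s ^+ 2 -> s = 0.
Proof.
move=> ej E; apply/eqP; apply: contraT => s0.
have Xj0 := mpolyXU_neq0 K j.
have dvd q : subst j 0 q = 0 -> exists q', q = 'X_j * q'.
  move=> qj; have [q' {1}->] := subst_dvd j 0 q.
  by exists q'; rewrite qj subr0 addr0 mulrC.
have [k] := ubnP (msize s); elim: k => // k IH in r s s0 E *; rewrite ltnS => sk.
have rj : subst j 0 r = 0.
  have := congr1 (subst j 0) E; rewrite subst_exp !substM substX !mul0r.
  by move/eqP; rewrite sqrf_eq0 => /eqP.
have [r' rE] := dvd _ rj.
have E' : 'X_j * r' ^+ 2 = e * s ^+ 2.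
  by apply: (mulfI Xj0); rewrite [RHS]mulrA -E rE; ring.
have sj : subst j 0 s = 0.
  have := congr1 (subst j 0) E'; rewrite !(subst_exp, substM, substX) !mul0r => /esym.
  by move/eqP; rewrite mulf_eq0 (negPf ej) sqrf_eq0 => /eqP.
have [s' sE] := dvd _ sj.
have s'0 : s' != 0 by apply: contraNneq s0 => s'0; rewrite sE s'0 mulr0.
apply: (IH r' s' s'0).
  by apply: (mulfI Xj0); rewrite E' sE; ring.
apply: leq_trans sk; rewrite sE msizeM // msizeX mdeg1.
exact: leqnn.
Qed.

Variables (i : 'I_m) (A B C N : {mpoly K[m]}).
Hypotheses (iA : indep i A) (iB : indep i B) (iC : indep i C) (iN : indep i N).
Let F := A * 'X_i ^+ 2 + B * 'X_i + C.
Let D := B ^+ 2 - 4%:R * A * C.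
Hypotheses (A0 : A != 0) (D0 : D != 0) (N0 : N != 0).

(** Pseudo-division by [F] in the variable ['X_i]: the powers of [A] replace a division by the
    leading coefficient. *)
Lemma quad_rem h : exists k c r s,
  [/\ A ^+ k * h = c * F + r * 'X_i + s, indep i r & indep i s].
Proof.
elim/mpoly_ring_ind: h => [c|p q [k [c [r [s [E ir is_]]]]]|j p [k [c [r [s [E ir is_]]]]]].
- exists 0%N, 0, 0, c%:MP; split; [ring | exact: (indepC i 0) | exact: indepC].
- move=> [k' [c' [r' [s' [E' ir' is']]]]].
  exists (k + k')%N, (A ^+ k' * c + A ^+ k * c'), (A ^+ k' * r + A ^+ k * r'),
    (A ^+ k' * s + A ^+ k * s'); split.
  + transitivity (A ^+ k' * (A ^+ k * p) + A ^+ k * (A ^+ k' * q)).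
      by rewrite exprD; ring.
    by rewrite E E'; ring.
  + by apply: indepD; apply: indepM => //; apply: indepXn.
  + by apply: indepD; apply: indepM => //; apply: indepXn.
case: (eqVneq j i) => [->|ji].
  exists k.+1, (A * c * 'X_i + r), (A * s - r * B), (- (r * C)); split.
  + transitivity (A * 'X_i * (A ^+ k * p)); first by rewrite exprS; ring.
    by rewrite E /F; ring.
  + by apply: indepB; apply: indepM.
  + by apply/indepN/indepM.
exists k, ('X_j * c), ('X_j * r), ('X_j * s); split.
- transitivity ('X_j * (A ^+ k * p)); first by ring.
  by rewrite E; ring.
- by apply: indepM => //; apply: indepXU.
- by apply: indepM => //; apply: indepXU.
Qed.

(** The two roots come with Vieta's formulas and with the discriminant as the squared difference;
    [D] nonzero at [v] thus means distinct roots. *)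
Lemma quad_roots v : A.@[v] != 0 -> exists x y,
  [/\ F.@[upd v i x] = 0, F.@[upd v i y] = 0,
      A.@[v] ^+ 2 * (x - y) ^+ 2 = D.@[v],
      A.@[v] * (x + y) = - B.@[v] & A.@[v] * (x * y) = C.@[v]].
Proof.
move=> Av; set a := A.@[v]; set b := B.@[v]; set c := C.@[v].
have DE : D.@[v] = b ^+ 2 - 4%:R * a * c.
  by rewrite /D !mevalS.
pose d := sqrtC D.@[v]; have d2 : d ^+ 2 = b ^+ 2 - 4%:R * a * c.
  by rewrite /d sqrtCK.
have FE x : F.@[upd v i x] = a * x ^+ 2 + b * x + c.
  rewrite /F !mevalS upd_same.
  by rewrite iA iB iC.
have two : 2%:R != 0 :> K by rewrite pnatr_eq0.
have four : 4%:R != 0 :> K by rewrite pnatr_eq0.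
have cE : c = (b ^+ 2 - d ^+ 2) / (4%:R * a).
  by rewrite d2; field; rewrite Av.
exists ((- b + d) / (2%:R * a)), ((- b - d) / (2%:R * a)).
rewrite !FE DE -d2; split; rewrite ?cE; field; rewrite ?Av //.
Qed.

(** The product of [p] with [A * D * N] has only zero values, hence is zero, and the polynomial ring
    is a domain. *)
Lemma generic_vanish p : (forall v, A.@[v] != 0 -> D.@[v] != 0 -> N.@[v] != 0 ->
  p.@[v] = 0) -> p = 0.
Proof.
move=> pv; have : p * (A * D * N) = 0.
  apply: mpoly_ext => v; rewrite !mevalM.
  case: (eqVneq A.@[v] 0) => [->|Av]; first by rewrite !(mul0r, mulr0).
  case: (eqVneq D.@[v] 0) => [->|Dv]; first by rewrite !(mul0r, mulr0).
  case: (eqVneq N.@[v] 0) => [->|Nv]; first by rewrite !(mul0r, mulr0).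
  by rewrite pv ?mul0r.
move/eqP; rewrite mulf_eq0 => /orP[/eqP //|].
by rewrite !mulf_eq0 (negPf A0) (negPf D0) (negPf N0).
Qed.

(** At a generic point the linear remainder r x + s vanishes at two distinct roots of [F], so r and
    s are zero. [N] describes an open set outside which nothing is assumed about [h]. *)
Lemma quad_vanish h :
  (forall v, F.@[v] = 0 -> N.@[v] != 0 -> h.@[v] = 0) ->
  exists k c, A ^+ k * h = c * F.
Proof.
move=> hv; have [k [c [r [s [E ir is_]]]]] := quad_rem h.
have root v x : N.@[v] != 0 -> F.@[upd v i x] = 0 -> r.@[v] * x + s.@[v] = 0.
  move=> Nv Fx; have := congr1 (meval (upd v i x)) E.
  rewrite !mevalD !mevalM Fx mevalXU upd_same ir is_ hv ?iN // !mulr0 add0r.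
  by move/esym.
have r0 : r = 0.
  apply: generic_vanish => v Av Dv Nv.
  have [x [y [Fx Fy xy _ _]]] := quad_roots Av.
  have : r.@[v] * (x - y) = 0.
    transitivity ((r.@[v] * x + s.@[v]) - (r.@[v] * y + s.@[v])); first by ring.
    by rewrite !root // subr0.
  move/eqP; rewrite mulf_eq0 => /orP[/eqP //|/eqP xy0].
  by move: Dv; rewrite -xy xy0 expr0n mulr0 eqxx.
have s0 : s = 0.
  apply: generic_vanish => v Av Dv Nv.
  have [x [y [Fx Fy xy _ _]]] := quad_roots Av.
  by have := root v x Nv Fx; rewrite r0 meval0 mul0r add0r.
by exists k, c; rewrite E r0 s0; ring.
Qed.

Hypothesis nsq : forall r s, r ^+ 2 = D * s ^+ 2 -> s = 0.

(** The norm of r x + s, that is [A] times the product of its values at the two roots of [F], is a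
    polynomial without 'X_i. The product of the norms of the two remainders vanishes generically, so
    one of them is zero, and then so is that remainder. *)
Lemma quad_prime h1 h2 :
  (forall v, F.@[v] = 0 -> N.@[v] != 0 -> h1.@[v] * h2.@[v] = 0) ->
  (exists k c, A ^+ k * h1 = c * F) \/ (exists k c, A ^+ k * h2 = c * F).
Proof.
move=> hv.
have [k1 [c1 [r1 [s1 [E1 ir1 is1]]]]] := quad_rem h1.
have [k2 [c2 [r2 [s2 [E2 ir2 is2]]]]] := quad_rem h2.
pose Nm r s := A * s ^+ 2 - B * r * s + C * r ^+ 2.
(* Completing the square: 4 A Nm = (2 A s - B r)^2 - D r^2, so a zero norm with r <> 0 would
   contradict [nsq]. *)
have Nm0 r s : Nm r s = 0 -> r = 0 /\ s = 0.
  move=> NE; have r0 : r = 0.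
    apply: (nsq (r := 2%:R * A * s - B * r)).
    transitivity (4%:R * A * Nm r s + D * r ^+ 2); last by rewrite NE; ring.
    by rewrite /Nm /D; ring.
  split=> //; move: NE; rewrite /Nm r0.
  rewrite mulr0 mul0r expr0n mulr0 subr0 addr0 => /eqP.
  by rewrite mulf_eq0 (negPf A0) sqrf_eq0 => /eqP.
have root k c r s h v x : A ^+ k * h = c * F + r * 'X_i + s -> indep i r ->
    indep i s -> F.@[upd v i x] = 0 ->
    r.@[v] * x + s.@[v] = (A ^+ k).@[v] * h.@[upd v i x].
  move=> E ir is_ Fx; have := congr1 (meval (upd v i x)) E.
  rewrite !mevalD !mevalM Fx mevalXU upd_same ir is_ mulr0 add0r => <-.
  by rewrite (indepXn k iA).
have : Nm r1 s1 * Nm r2 s2 = 0.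
  apply: generic_vanish => v Av Dv Nv.
  have [x [y [Fx Fy xy Sxy Pxy]]] := quad_roots Av.
  have NmE r s : (Nm r s).@[v] =
      A.@[v] * ((r.@[v] * x + s.@[v]) * (r.@[v] * y + s.@[v])).
    rewrite /Nm !mevalS -Pxy.
    by rewrite -[B.@[v]]opprK -Sxy; ring.
  rewrite mevalM !NmE.
  rewrite (root _ _ _ _ _ v x E1) // (root _ _ _ _ _ v x E2) //.
  (* One root is enough: the product of the norms contains the factor h1 h2 at x, whatever happens
     at y. *)
  have hx : h1.@[upd v i x] * h2.@[upd v i x] = 0 by apply: hv; rewrite ?iN.
  set a := A.@[v]; set b := (A ^+ k1).@[v]; set c := (A ^+ k2).@[v].
  set e1 := (_ + _); set e2 := (_ + _).
  transitivity (a ^+ 2 * b * c * e1 * e2 * (h1.@[upd v i x] * h2.@[upd v i x])).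
    by ring.
  by rewrite hx mulr0.
move/eqP; rewrite mulf_eq0 => /orP[] /eqP /Nm0 [r0 s0]; [left|right].
  by exists k1, c1; rewrite E1 r0 s0; ring.
by exists k2, c2; rewrite E2 r0 s0; ring.
Qed.

End QuadraticForms.

(** * From primality of an equation to irreducibility of its divisor *)

Section Prime.
Variable K : numClosedFieldType.

(** If neither closed set contains the locus, each has an equation that is nonzero somewhere on it;
    the product of the two vanishes on the locus, so one of them is a multiple of [f], a
    contradiction. The case h1 = h2 gives multiplicity one. *)
Lemma prime_irreducible_divisor (T : ambient) (f : {mpoly K[ncoor T]}) :
  (exists v, locus f v) ->
  (forall h1 h2, (forall v, locus f v -> h1.@[v] * h2.@[v] = 0) ->
    (exists c, h1 = c * f) \/ (exists c, h2 = c * f)) ->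
  irreducible_divisor f.
Proof.
move=> f0 fprime; split; last first.
  move=> d h _ hv; have [v fv|//|//] := fprime h h.
  by rewrite hv ?mul0r.
split=> // Z1 Z2 [S1 [_ Z1P]] [S2 [_ Z2P]] Zf.
apply: contrapT => /not_orP[/existsNP[v1 /not_implyP[fv1 Z1v1]]].
move=> /existsNP[v2 /not_implyP[fv2 Z2v2]].
have outside Z (S : {mpoly K[ncoor T]} -> Prop) v : locus f v ->
    (forall v, Z v <-> stable v /\ forall g, S g -> g.@[v] = 0) -> ~ Z v ->
    exists2 h, S h & h.@[v] != 0.
  move=> [sv _] ZP Zv; apply: contrapT => H; apply: Zv; apply/ZP; split=> // h Sh.
  by apply/eqP; apply: contraT => hv; case: H; exists h.
have [h1 Sh1 h1v1] := outside _ _ _ fv1 Z1P Z1v1.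
have [h2 Sh2 h2v2] := outside _ _ _ fv2 Z2P Z2v2.
case: (fprime h1 h2) => [v fv|[c hE]|[c hE]].
- case: (Zf v fv) => [/Z1P[_ hv]|/Z2P[_ hv]].
    by rewrite (hv _ Sh1) mul0r.
  by rewrite (hv _ Sh2) mulr0.
- by case: fv1 => _ fv1; move: h1v1; rewrite hE mevalM fv1 mulr0 eqxx.
by case: fv2 => _ fv2; move: h2v2; rewrite hE mevalM fv2 mulr0 eqxx.
Qed.

End Prime.

(** * Irreducibility of the branch divisor *)

Section BranchDivisor.
Variables (K : numClosedFieldType) (n : nat) (l c : nat -> K).
Hypotheses (n_ge4 : (4 <= n)%N)
  (l0 : forall i, (3 <= i < n.+2)%N -> l i != 0).

Local Notation a := ('X_(inord 0) : {mpoly K[5]}).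
Local Notation b := ('X_(inord 1) : {mpoly K[5]}).
Local Notation x1 := ('X_(inord 2) : {mpoly K[5]}).
Local Notation x2 := ('X_(inord 3) : {mpoly K[5]}).
Local Notation w := ('X_(inord 4) : {mpoly K[5]}).

(* [ghom] and [branch] over an arbitrary field, with the coefficients of g and
   the branch points as parameters. *)
Definition ghomK : {mpoly K[5]} := \sum_(k < n) (c k)%:MP * a ^+ (n.-1 - k) * b ^+ k.
Definition bprodK : {mpoly K[5]} := \prod_(3 <= i < n.+2) (b - (l i)%:MP * a).
Definition gtermK : {mpoly K[5]} := w ^+ 2 * a ^+ (n - 3) * ghomK.
Definition branchK : {mpoly K[ncoor (bundle n)]} :=
  (x1 * x2 - gtermK) ^+ 2 - w ^+ 4 * a ^+ (3 * n - 8) * (b * bprodK).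

Lemma inord_eq m (i j : nat) : (i <= m)%N -> (j <= m)%N ->
  (inord i == inord j :> 'I_m.+1) = (i == j).
Proof. by move=> im jm; rewrite -val_eqE /= !inordK. Qed.

Ltac indep_tac := repeat first [exact: indepC | apply: indepB | apply: indepN
  | apply: indepMn | apply: indepM | apply: indepXn
  | by apply: indepXU; rewrite inord_eq | apply: indep_sum => ? | apply: indep_prod => ?].

Lemma indep_gtermK (i : nat) : (2 <= i <= 3)%N -> indep (inord i) gtermK.
Proof.
by case: i => [|[|[|[|//]]]] // _; rewrite /gtermK /ghomK; indep_tac.
Qed.

Lemma indep_bprodK (i : nat) : (2 <= i <= 3)%N -> indep (inord i) bprodK.
Proof.
by case: i => [|[|[|[|//]]]] // _; rewrite /bprodK; indep_tac.
Qed.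

Lemma branchK_stable (v : 'I_5 -> K) : (a * w).@[v] != 0 -> @stable K (bundle n) v.
Proof.
rewrite mevalM !mevalXU mulf_eq0 negb_or => /andP[a0 w0] [j j2].
case: j j2 => [|[|//]] j2; [exists (inord 0)|exists (inord 4)]; split=> //.
  by apply/val_inj; rewrite /= bundle_blkE inordK.
by apply/val_inj; rewrite /= bundle_blkE inordK.
Qed.

(** This is the coprimality with b that makes b a factor of odd multiplicity of the discriminant: at
    b = 0, a = 1 the product is that of the nonzero numbers - l i. *)
Lemma bprodK_neq0 : subst (inord 1) 0 bprodK != 0.
Proof.
apply/negP => /eqP /(congr1 (meval (fun=> 1))); rewrite substE !mevalS /bprodK.
rewrite rmorph_prod big_seq_cond; apply/eqP.
rewrite prodf_seq_neq0; apply/allP => i; rewrite mem_index_iota => i3.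
apply/implyP => _ /=; rewrite !mevalS upd_same upd_other ?inord_eq //.
by rewrite sub0r oppr_eq0 mulr1 l0.
Qed.

(** Were x2 a factor, [gtermK ^+ 2] would be b times a polynomial prime to b; the descent with s = 1
    forbids this. It allows the powers of the leading coefficient x2^2 to be cancelled. *)
Lemma branchK_x2 : subst (inord 3) 0 branchK != 0.
Proof.
apply/negP => /eqP E.
have /eqP := oner_neq0 {mpoly K[5]}; apply.
apply: (@square_descent K 5 (inord 1) (w ^+ 4 * a ^+ (3 * n - 8) * bprodK) gtermK).
  rewrite !substM !subst_exp !substXU ?inord_eq //.
  by rewrite !mulf_neq0 ?expf_neq0 ?mpolyXU_neq0 ?bprodK_neq0.
apply: mpoly_ext_eq => v; rewrite expr1n mulr1.
have := congr1 (meval v) E; rewrite substE meval0 /branchK.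
rewrite mevalB mevalXn mevalB [(x1 * x2).@[_]]mevalM !mevalXU upd_same.
rewrite mulr0 sub0r sqrrN indep_gtermK // => /eqP; rewrite subr_eq0 => /eqP E'.
rewrite mevalXn E' !mevalS !upd_other ?inord_eq // indep_bprodK //; ring.
Qed.

Lemma branchK_quad : branchK =
  (x2 ^+ 2) * x1 ^+ 2 + (- (2%:R * x2 * gtermK)) * x1 +
    (gtermK ^+ 2 - w ^+ 4 * a ^+ (3 * n - 8) * (b * bprodK)).
Proof. by rewrite /branchK; ring. Qed.

Lemma branchK_prime h1 h2 :
  (forall v, locus branchK v -> h1.@[v] * h2.@[v] = 0) ->
  (exists c, h1 = c * branchK) \/ (exists c, h2 = c * branchK).
Proof.
move=> hv.
have cancel h k e : (x2 ^+ 2) ^+ k * h = e * branchK ->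
    exists e', h = e' * branchK.
  by rewrite -exprM; apply: cancelX; apply: branchK_x2.
suff : (exists k c, (x2 ^+ 2) ^+ k * h1 = c * branchK) \/
       (exists k c, (x2 ^+ 2) ^+ k * h2 = c * branchK).
  by case=> -[k [e /cancel]]; [left|right].
set B := - (2%:R * x2 * gtermK).
set C := gtermK ^+ 2 - w ^+ 4 * a ^+ (3 * n - 8) * (b * bprodK).
set Ap := w ^+ 4 * a ^+ (3 * n - 8) * bprodK.
pose e : {mpoly K[5]} := 4%:R * x2 ^+ 2 * Ap.
have DE : B ^+ 2 - 4%:R * x2 ^+ 2 * C = b * e.
  by rewrite /B /C /e /Ap; ring.
have e0 : subst (inord 1) 0 e != 0.
  rewrite !(substM, subst_exp) !substXU ?inord_eq //.
  rewrite !mulf_neq0 ?expf_neq0 ?mpolyXU_neq0 ?bprodK_neq0 //.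
  by rewrite -mpolyC_nat substC mpolyC_eq0 pnatr_eq0.
have en0 : e != 0 by apply: contraNneq e0 => ->; rewrite /subst rmorph0.
have H2 := @indep_gtermK 2 isT; have P2 := @indep_bprodK 2 isT.
(* The open condition is a w <> 0, since such vectors are automatically stable. *)
rewrite branchK_quad; apply: (@quad_prime K 5 (inord 2) (x2 ^+ 2) B C (a * w)).
- by indep_tac.
- by rewrite /B -mpolyC_nat; indep_tac.
- by rewrite /C; indep_tac.
- by indep_tac.
- by rewrite expf_neq0 ?mpolyXU_neq0.
- by rewrite DE mulf_neq0 ?mpolyXU_neq0.
- by rewrite mulf_neq0 ?mpolyXU_neq0.
- by move=> r s; rewrite DE; apply: square_descent.
by move=> v Fv Nv; apply: hv; split; [apply: branchK_stable | rewrite branchK_quad].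
Qed.

Lemma branchK_irreducible : irreducible_divisor branchK.
Proof.
apply: prime_irreducible_divisor branchK_prime.
(* At lambda = 0 the right-hand side vanishes, so it suffices that eta1 eta2 = g(0), whose value is
   [c 0]. *)
pose z : 'I_5 -> K := fun i => nth 0 [:: 1; 0; 1; (c 0); 1] i.
have zE i : (i < 5)%N -> z (inord i) = nth 0 [:: 1; 0; 1; (c 0); 1] i.
  by move=> i5; rewrite /z inordK.
exists z; split.
  by apply: branchK_stable; rewrite mevalM !mevalXU !zE //= mulr1 oner_neq0.
rewrite /branchK /gtermK /ghomK !mevalS raddf_sum (bigD1 (Ordinal (leq_trans (isT : (0 < 4)%N) n_ge4))) //=.
rewrite big1 => [|k k0].
  by rewrite !mevalS !zE //= !expr1n; ring.
have /negPf k0' : (k != 0 :> nat) by apply: contraNneq k0 => k0; apply/eqP/val_inj.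
by rewrite !mevalS !zE //= expr0n k0' mulr0.
Qed.

End BranchDivisor.

(** * A holomorphic square root near 1 *)

Section SquareRoot.
Variable C : numClosedFieldType.

(* The branch cut of [sqrtC] is the positive real axis, so 1 is moved to -1. *)
Definition sqrt1 (z : C) : C := - 'i * sqrtC (- z).

Lemma sqrt1K z : sqrt1 z ^+ 2 = z.
Proof. by rewrite /sqrt1 exprMn sqrrN sqrCi sqrtCK mulrNN mul1r. Qed.

(** For t = sqrtC (- x) one has (i - t)(t + i) = x - 1 and Im t >= 0, hence |t + i| >= 1 and |i - t|
    < 1/2, so Im t >= 1/2. Adding the two imaginary parts gives the bound, which says that both
    roots lie on the same branch. *)
Lemma sqrt1_dist (y z : C) : `|y - 1| < 2^-1 -> `|z - 1| < 2^-1 ->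
  1 <= `|sqrt1 y + sqrt1 z|.
Proof.
have ImN (t : C) : 'Im t <= `|t|.
  apply: le_trans (real_ler_norm (Creal_Im t)) _.
  rewrite -(@ler_pXn2r _ 2) ?nnegrE ?normr_ge0 // (normC2_Re_Im t).
  by rewrite real_normK ?Creal_Im // lerDr -real_normK ?Creal_Re // exprn_ge0.
have key (x : C) : `|x - 1| < 2^-1 -> 2^-1 <= 'Im (sqrtC (- x)).
  move=> x1; set t := sqrtC (- x).
  have t0 : 0 <= 'Im t by apply: Im_rootC_ge0.
  have ti : 1 <= `|t + 'i|.
    by apply: le_trans _ (ImN _); rewrite raddfD /= Im_i lerDr.
  have tx : `|'i - t| * `|t + 'i| = `|x - 1|.
    rewrite -normrM; have -> : ('i - t) * (t + 'i) = x - 1; last by [].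
    transitivity ('i ^+ 2 - t ^+ 2); first by ring.
    by rewrite sqrCi sqrtCK; ring.
  have it : 1 - 'Im t <= 2^-1.
    apply: le_trans _ (ltW x1); rewrite -tx.
    apply: (@le_trans _ _ `|'i - t|); last by rewrite ler_peMr.
    by apply: le_trans _ (ImN _); rewrite raddfB /= Im_i.
  have -> : 2^-1 = 1 - 2^-1 :> C by field.
  by rewrite lerBlDl -lerBlDr.
move=> /key hy /key hz; rewrite /sqrt1 -mulrDr normrM normrN normCi mul1r.
apply: le_trans _ (ImN _); rewrite raddfD /= [leLHS](_ : 1 = 2^-1 + 2^-1) ?lerD //.
by field.
Qed.

End SquareRoot.

Section HolomorphicRoot.
Local Open Scope classical_set_scope.
Variables (C : numFieldType) (sqrt1 : C -> C).
Hypothesis sqrt1K : forall z, sqrt1 z ^+ 2 = z.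
Hypothesis sqrt1_dist : forall y z : C, `|y - 1| < 2^-1 -> `|z - 1| < 2^-1 ->
  1 <= `|sqrt1 y + sqrt1 z|.

Lemma sqrt1_lip (y z : C) : `|y - 1| < 2^-1 -> `|z - 1| < 2^-1 ->
  `|sqrt1 y - sqrt1 z| <= `|y - z|.
Proof.
move=> hy hz; have -> : y - z = (sqrt1 y - sqrt1 z) * (sqrt1 y + sqrt1 z).
  by rewrite -subr_sqr !sqrt1K.
by rewrite normrM ler_peMr // sqrt1_dist.
Qed.

Lemma near_ball1 (z : C) : `|z - 1| < 2^-1 ->
  \forall y \near z, `|y - 1| < 2^-1.
Proof.
move=> hz; have e0 : 0 < 2^-1 - `|z - 1| by rewrite subr_gt0.
apply/nbhs_normP; exists (2^-1 - `|z - 1|) => // y /= zy.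
rewrite -(subrKA z) (le_lt_trans (ler_normD _ _)) //.
by rewrite -ltrBrDr distrC.
Qed.

Lemma sqrt1_continuous (z : C) : `|z - 1| < 2^-1 ->
  sqrt1 y @[y --> z] --> sqrt1 z.
Proof.
move=> hz; apply/(@cvgrPdist_lt C C^o C (nbhs z)) => e e0; near=> y.
apply: le_lt_trans (sqrt1_lip hz _) _; first by near: y; exact: near_ball1.
by near: y; apply/nbhs_normP; exists e.
Unshelve. all: by end_near. Qed.

(** The difference quotient is the inverse of sqrt1 (z + h) + sqrt1 z, which stays away from zero
    and converges by continuity. *)
Lemma sqrt1_differentiable (z : C) : `|z - 1| < 2^-1 ->
  differentiable (sqrt1 : C -> C^o) z.
Proof.
move=> hz; apply/derivable1_diffP.
apply/cvg_ex; exists (sqrt1 z + sqrt1 z)^-1.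
have s0 : sqrt1 z + sqrt1 z != 0.
  by rewrite -normr_gt0 (lt_le_trans ltr01) ?sqrt1_dist.
have zc : (fun h : C => h + z) h @[h --> (0:C)^'] --> z.
  rewrite -[X in _ --> X]add0r; apply: cvgD; last exact: cvg_cst.
  exact: nbhs_dnbhs.
have near_hz1 : \forall h \near (0:C)^', `|h + z - 1| < 2^-1.
  by have := zc _ (near_ball1 hz).
have lim : (sqrt1 (h + z) + sqrt1 z)^-1 @[h --> (0:C)^'] --> (sqrt1 z + sqrt1 z)^-1.
  apply: cvgV => //; apply: cvgD; last exact: cvg_cst.
  by apply: cvg_comp zc _; apply: sqrt1_continuous.
apply: cvg_trans lim; apply: near_eq_cvg; near=> h.
have h0 : h != 0 by near: h; exact: nbhs_dnbhs_neq.
rewrite /= /shift /= [h *: 1]mulr1.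
have hz1 : `|h + z - 1| < 2^-1 by near: h; exact: near_hz1.
have sh0 : sqrt1 (h + z) + sqrt1 z != 0.
  by rewrite -normr_gt0 (lt_le_trans ltr01) ?sqrt1_dist.
apply: (mulIf sh0); rewrite mulVf // -[X in X * _]/(h^-1 * _) -mulrA -subr_sqr.
by rewrite !sqrt1K addrK mulVf.
Unshelve. all: by end_near. Qed.

End HolomorphicRoot.

(** * Transversal A_k singularities of (x1 x2 - G(a))^2 = a^(k+1) Q(a) *)

Section Transversal.
Variable C : numFieldType.
Local Notation V := 'rV[C]_3.

Lemma differentiable_mul (f g : V -> C^o) x : differentiable f x ->
  differentiable g x -> differentiable (fun y => f y * g y : C^o) x.
Proof. exact: differentiableM. Qed.

Lemma differentiable_add (f g : V -> C^o) x : differentiable f x ->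
  differentiable g x -> differentiable (fun y => f y + g y : C^o) x.
Proof. exact: differentiableD. Qed.

Lemma differentiable_horner (q : {poly C}) (f : V -> C^o) x :
  differentiable f x -> differentiable (fun y => q.[f y] : C^o) x.
Proof.
move=> df; elim/poly_ind: q => [|q c IH].
  rewrite (_ : (fun _ => _) = cst 0); first exact: differentiable_cst.
  by apply/funext => y; rewrite horner0.
rewrite (_ : (fun _ => _) = ((fun y => q.[f y]) : V -> C^o) * f + cst c).
  by apply: differentiableD => //; apply: differentiableM.
by apply/funext => y; rewrite !hornerE.
Qed.

Lemma differentiable_row (f : 'I_3 -> V -> C^o) x :
  (forall i, differentiable (f i) x) ->
  differentiable (fun y => \row_i f i y : V) x.
Proof.
move=> df; rewrite (_ : (fun y => _) =
    \sum_(i < 3) (fun y => f i y *: (delta_mx 0 i : V))).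
  by apply: differentiable_sum => i; apply: differentiableZl.
apply/funext => y; rewrite fct_sumE [LHS]row_sum_delta.
by apply: eq_bigr => i _; rewrite mxE.
Qed.

Lemma continuous_near (f : V -> C^o) (x : V) (P : C -> Prop) :
  differentiable f x -> (\forall y \near (f x : C^o), P y) ->
  \forall y \near x, P (f y).
Proof. by move=> /differentiable_continuous cf Py; exact: (cf _ Py). Qed.

Lemma near_neq0 (z : C^o) : z != 0 -> \forall y \near z, y != 0.
Proof.
move=> z0; apply/nbhs_normP; exists `|z|; rewrite /= ?normr_gt0 // => y /= zy.
by apply: contraTneq zy => ->; rewrite subr0 ltxx.
Qed.

Variable s : C -> C.
Hypothesis sK : forall z, s z ^+ 2 = z.
Hypothesis s_dist : forall y z : C, `|y - 1| < 2^-1 -> `|z - 1| < 2^-1 ->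
  1 <= `|s y + s z|.

Variables (f : {mpoly C[3]}) (G Q : {poly C}) (k : nat) (p : V) (i1 i2 : 'I_3).
Let i0 : 'I_3 := inord 0.
Hypotheses (i10 : i1 != i0) (i20 : i2 != i0) (i21 : i2 != i1).
Hypothesis i012 : forall i, [\/ i = i0, i = i1 | i = i2].
Hypothesis fE : forall x : V, f.@[fun i => x 0 i] =
  (x 0 i1 * x 0 i2 - G.[x 0 i0]) ^+ 2 - x 0 i0 ^+ k.+1 * Q.[x 0 i0].
Hypotheses (G0 : G.[0] = 0) (Q0 : Q.[0] = 1).
Hypotheses (p0 : p 0 i0 = 0) (p1 : p 0 i1 != 0) (p2 : p 0 i2 = 0).

(** With X = x1 x2 - G(a), the equation is Q ((X / sqrt Q)^2 - a^(k+1)), so the new coordinates are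
    X / sqrt Q, a and x1 - x1(p), and the unit is Q. They are invertible near [p] because x1 <> 0
    there, so x2 is recovered from X. Keeping [i1] and [i2] abstract lets one proof serve both lines
    of the fibre. *)
Lemma transversal_A_double : transversal_A k f p.
Proof.
pose r (x : V) : C^o := s Q.[x 0 i0].
pose X (x : V) : C^o := x 0 i1 * x 0 i2 - G.[x 0 i0].
pose psi (x : V) : V := \row_(i < 3) (if i == inord 0 then X x / r x else
  if i == inord 1 then x 0 i0 else x 0 i1 - p 0 i1).
pose r' (y : V) : C^o := s Q.[y 0 (inord 1)].
pose d (y : V) : C^o := y 0 (inord 2) + p 0 i1.
pose phi (y : V) : V := \row_(i < 3) (if i == i0 then y 0 (inord 1) else
  if i == i1 then d y else (y 0 (inord 0) * r' y + G.[y 0 (inord 1)]) / d y).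
have coord i (x : V) : differentiable (fun y : V => y 0 i : C^o) x.
  exact: differentiable_coord.
have one_lt : `|1 - 1 : C| < 2^-1 by rewrite subrr normr0 invr_gt0.
have Qnear i (x : V) : x 0 i = 0 ->
    \forall y \near x, `|Q.[(y : V) 0 i] - 1| < 2^-1.
  move=> xi; apply: (continuous_near (P := fun z => `|z - 1| < 2^-1)).
    exact/differentiable_horner/coord.
  by apply: near_ball1; rewrite xi Q0.
have s_neq0 z : `|z - 1| < 2^-1 -> s z != 0.
  move=> z1; have := s_dist z1 z1; apply: contraTneq => ->.
  by rewrite addr0 normr0 ler10.
have s_diff i (x : V) : `|Q.[x 0 i] - 1| < 2^-1 ->
    differentiable (fun y : V => s Q.[y 0 i] : C^o) x.
  move=> xi; apply: (@differentiable_comp _ _ _ _ (fun y : V => Q.[y 0 i] : C^o) s).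
    exact/differentiable_horner/coord.
  exact: (sqrt1_differentiable sK s_dist).
have inv_diff (g : V -> C^o) x : differentiable g x -> g x != 0 ->
    differentiable (fun y => (g y)^-1 : C^o) x by exact: differentiableV.
have i12 : (inord 1 == inord 0 :> 'I_3) = false.
  by rewrite -val_eqE /= !inordK.
have i22 : (inord 2 == inord 0 :> 'I_3) = false.
  by rewrite -val_eqE /= !inordK.
have i23 : (inord 2 == inord 1 :> 'I_3) = false.
  by rewrite -val_eqE /= !inordK.
have ord3 (i : 'I_3) : [\/ i = inord 0, i = inord 1 | i = inord 2].
  by case: i => -[|[|[|//]]] ?; [constructor 1|constructor 2|constructor 3];
    apply/val_inj; rewrite /= inordK.
have psi0 x : psi x 0 (inord 0) = X x / r x by rewrite mxE eqxx.
have psi1 x : psi x 0 (inord 1) = x 0 i0 by rewrite mxE i12 eqxx.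
have psi2 x : psi x 0 (inord 2) = x 0 i1 - p 0 i1 by rewrite mxE i22 i23.
have phi0 y : phi y 0 i0 = y 0 (inord 1) by rewrite mxE eqxx.
have phi1 y : phi y 0 i1 = d y by rewrite mxE (negPf i10) eqxx.
have phi2 y : phi y 0 i2 = (y 0 (inord 0) * r' y + G.[y 0 (inord 1)]) / d y.
  by rewrite mxE (negPf i20) (negPf i21).
have Qp : \forall x \near p, `|Q.[(x : V) 0 i0] - 1| < 2^-1 by apply: Qnear.
have Q00 : \forall y \near (0 : V), `|Q.[(y : V) 0 (inord 1)] - 1| < 2^-1.
  by apply: Qnear; rewrite mxE.
have x1near : \forall x \near p, (x : V) 0 i1 != 0.
  apply: (continuous_near (f := fun y : V => y 0 i1) (P := fun z => z != 0)) => //.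
  exact: near_neq0.
have d_diff x : differentiable d x.
  rewrite (_ : d = (fun y : V => y 0 (inord 2) : C^o) + cst (p 0 i1 : C^o)) //.
  exact: differentiableD.
have d_near : \forall y \near (0 : V), d y != 0.
  apply: (continuous_near (f := d) (P := fun z => z != 0)) => //.
  by apply: near_neq0; rewrite /d mxE add0r.
exists psi, phi, (fun x => Q.[x 0 i0]); split.
- split; last by rewrite p0 Q0 oner_neq0.
    apply/rowP => i; rewrite [RHS]mxE; case: (ord3 i) => ->.
    + by rewrite psi0 /X p2 p0 G0 mulr0 subr0 mul0r.
    + by rewrite psi1.
    + by rewrite psi2 subrr.
  apply/rowP => i; case: (i012 i) => ->.
  + by rewrite phi0 mxE p0.
  + by rewrite phi1 /d mxE add0r.
  + by rewrite phi2 !mxE G0 mul0r add0r mul0r p2.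
- split; last first.
    near=> y; apply: differentiable_row => i.
    have Qy : `|Q.[y 0 (inord 1)] - 1| < 2^-1 by near: y.
    have dy : d y != 0 by near: y.
    case: (i012 i) => ->; rewrite ?eqxx ?(negPf i10) ?(negPf i20) ?(negPf i21).
    + exact: coord.
    + exact: d_diff.
    apply: (@differentiable_mul
      (fun y => y 0 (inord 0) * r' y + G.[y 0 (inord 1)] : C^o)
      (fun y => (d y)^-1 : C^o)); last exact: inv_diff.
    apply: (@differentiable_add (fun y => y 0 (inord 0) * r' y : C^o)
      (fun y => G.[y 0 (inord 1)] : C^o)); last exact/differentiable_horner/coord.
    apply: (@differentiable_mul (fun y : V => y 0 (inord 0) : C^o) r') => //.
    exact: s_diff.
  near=> x; have Qx : `|Q.[x 0 i0] - 1| < 2^-1 by near: x.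
  split; last exact/differentiable_horner/coord.
  apply: differentiable_row => i.
  case: (ord3 i) => ->; rewrite ?eqxx ?i12 ?i22 ?i23.
  + apply: (@differentiable_mul X (fun y => (r y)^-1 : C^o)); last first.
      by apply: inv_diff; [exact: s_diff | exact: s_neq0].
    apply: (@differentiableB _ _ _ (fun y : V => y 0 i1 * y 0 i2 : C^o)
      (fun y => G.[y 0 i0] : C^o)); last exact/differentiable_horner/coord.
    exact: (@differentiable_mul (fun y : V => y 0 i1 : C^o) (fun y => y 0 i2)).
  + exact: coord.
  + exact: (@differentiableB _ _ _ (fun y : V => y 0 i1 : C^o) (cst (p 0 i1 : C^o))).
- split.
    near=> x; have Qx : `|Q.[x 0 i0] - 1| < 2^-1 by near: x.
    have x1 : x 0 i1 != 0 by near: x.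
    have dx : d (psi x) = x 0 i1 by rewrite /d psi2 subrK.
    apply/rowP => i; case: (i012 i) => ->.
    + by rewrite phi0 psi1.
    + by rewrite phi1.
    + rewrite phi2 dx psi0 /r' psi1 mulfVK; last exact: s_neq0.
      by rewrite /X subrK mulrC mulKf.
  near=> y; have Qy : `|Q.[y 0 (inord 1)] - 1| < 2^-1 by near: y.
  have dy : d y != 0 by near: y.
  apply/rowP => i; case: (ord3 i) => ->.
  + rewrite psi0 /X /r phi0 phi1 phi2 [d y * _]mulrC divfK //.
    by rewrite addrK mulfK //; exact: s_neq0.
  + by rewrite psi1 phi0.
  + by rewrite psi2 phi1 addrK.
near=> x; have Qx : `|Q.[x 0 i0] - 1| < 2^-1 by near: x.
rewrite fE psi0 psi1 -/(X x) expr_div_n /r sK.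
have Q_neq0 : Q.[x 0 i0] != 0 by rewrite -[Q.[_]]sK expf_neq0 ?s_neq0.
by rewrite mulrBr [Q.[_] * (_ / _)]mulrC divfK //; congr (_ - _); exact: mulrC.
Unshelve. all: by end_near. Qed.

End Transversal.

(** * Reducedness of a pair of conics *)

Section Fibres.
Variable K : numClosedFieldType.
Implicit Types g d : K.

Local Notation X0 := ('X_(inord 0) : {mpoly K[3]}).
Local Notation X1 := ('X_(inord 1) : {mpoly K[3]}).
Local Notation X2 := ('X_(inord 2) : {mpoly K[3]}).

(** Here [d] stands for the value of the right-hand side itself, so that no square root has to be
    chosen in order to write the pair of conics. *)
Definition conics g d : {mpoly K[3]} :=
  (X0 * X1 - g%:MP * X2 ^+ 2) ^+ 2 - d%:MP * X2 ^+ 4.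

Lemma ord3P (i : 'I_3) : [\/ i = inord 0, i = inord 1 | i = inord 2].
Proof.
by case: i => -[|[|[|//]]] ?; [constructor 1|constructor 2|constructor 3];
  apply/val_inj; rewrite /= inordK.
Qed.

Lemma conics_nonreduced g : ~ reduced_plane_curve (conics g 0).
Proof.
pose h : {mpoly K[3]} := X0 * X1 - g%:MP * X2 ^+ 2.
move=> /(_ (inord 2) h 2) [|a [b hE]].
  by exists 1, 0; rewrite /conics -/h mpolyC0; ring.
(* The line u |-> (g + u, 1, 1) lies in the chart 'X_2 = 1, and [h] takes the value u on it. The
   relation h = a h^2 becomes q(u) u = 1, which fails at u = 0. *)
pose v (i : 'I_3) : K := [:: g; 1; 1]`_i; pose e (i : 'I_3) : K := [:: 1; 0; 0]`_i.
have vE j : (j < 3)%N -> v (inord j) = [:: g; 1; 1]`_j by move=> j3; rewrite /v inordK.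
have eE j : (j < 3)%N -> e (inord j) = [:: 1; 0; 0]`_j by move=> j3; rewrite /e inordK.
have [q Hq] := line_poly a v e.
have : q * 'X - 1 = 0.
  apply: (poly_vanish (q := 'X)) => [|u]; first by rewrite polyX_eq0.
  rewrite hornerX => u0; have [qu _] := Hq u; rewrite !hornerE qu.
  have := congr1 (meval (fun i => v i + u * e i)) hE.
  rewrite /conics /h !mevalS /= !vE // !eE //=.
  move/eqP; rewrite -subr_eq0 => /eqP E; apply: (mulIf u0).
  by rewrite mul0r -oppr0 -E; ring.
move/(congr1 (horner^~ 0)); rewrite /= !hornerE ?mulr0 ?add0r => /eqP.
by rewrite oppr_eq0 oner_eq0.
Qed.

Ltac indep_tac := repeat first [exact: indepC | apply: indepB | apply: indepD | apply: indepN
  | apply: indepMn | apply: indepM | apply: indepXn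
  | by apply: indepXU; rewrite inord_eq].

(** In a chart the equation is quadratic in one of the first two coordinates, with discriminant 4 d
    times an even power of the other remaining coordinate, hence nonzero. A nilpotent function
    vanishes on the curve, so [quad_vanish] applies. *)
Lemma conics_reduced g d : d != 0 -> reduced_plane_curve (conics g d).
Proof.
move=> d0 i h k [a [b hE]].
suff [c cE] : exists c, subst i 1 h = c * subst i 1 (conics g d).
  have [e1 E1] := subst_dvd i 1 h; have [e2 E2] := subst_dvd i 1 (conics g d).
  exists c, (e1 - c * e2); rewrite [in LHS]E1 cE.
  by rewrite [X in _ = c * X + _]E2; ring.
set h' := subst i 1 h; set f' := subst i 1 _.
have hv v : f'.@[v] = 0 -> h'.@[v] = 0.
  move=> fv; have := congr1 (fun p => (subst i 1 p).@[v]) hE.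
  rewrite /= substD !substM [subst i 1 ('X_i - 1)]substB substX -mpolyC1 substC.
  rewrite subrr mulr0 addr0 subst_exp mpolyC1 -/f'.
  by rewrite mevalXn mevalM fv mulr0 => /eqP; rewrite expf_eq0 => /andP[_ /eqP].
have C0 c : c != 0 -> c%:MP_[3] != 0 :> {mpoly K[3]} by rewrite mpolyC_eq0.
have Xn0 j m : ('X_j : {mpoly K[3]}) ^+ m != 0.
  by rewrite expf_neq0 ?mpolyXU_neq0.
have four : 4%:R != 0 :> K by rewrite pnatr_eq0.
have two : 2%:R != 0 :> K by rewrite pnatr_eq0.
(* In the charts where one of the first two coordinates is 1, the equation is monic in the other
   one, and no power has to be cancelled. *)
have chart (j : 'I_3) : j != inord 2 ->
    f' = 1 * 'X_j ^+ 2 + (- ((2%:R * g)%:MP * X2 ^+ 2)) * 'X_j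
           + (g ^+ 2 - d)%:MP * X2 ^+ 4 ->
    exists c, h' = c * f'.
  move=> j2 fE; have [] := @quad_vanish K 3 j 1 (- ((2%:R * g)%:MP * X2 ^+ 2))
      ((g ^+ 2 - d)%:MP * X2 ^+ 4) 1 _ _ _ _ _ _ _ h'.
  - by rewrite -mpolyC1; indep_tac.
  - by indep_tac; apply: indepXU; rewrite eq_sym.
  - by indep_tac; apply: indepXU; rewrite eq_sym.
  - by rewrite -mpolyC1; indep_tac.
  - exact: oner_neq0.
  - rewrite [X in X != 0](_ : _ = (4%:R * d)%:MP * X2 ^+ 4).
      by rewrite mulf_neq0 ?Xn0 ?C0 ?mulf_neq0.
    by rewrite !(mpolyCM, mpolyCB, mpolyC_nat); ring.
  - exact: oner_neq0.
  - by move=> v; rewrite -fE => fv _; apply: hv.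
  by move=> m [c]; rewrite -fE expr1n mul1r => ->; exists c.
case: (ord3P i) => iE.
- apply: (chart (inord 1)); first by rewrite inord_eq.
  rewrite /f' /conics iE !(substB, subst_exp, substM, substC, substX) !substXU ?inord_eq //.
  by rewrite !(mpolyCM, mpolyCB, mpolyC_nat); ring.
- apply: (chart (inord 0)); first by rewrite inord_eq.
  rewrite /f' /conics iE !(substB, subst_exp, substM, substC, substX) !substXU ?inord_eq //.
  by rewrite !(mpolyCM, mpolyCB, mpolyC_nat); ring.
have fE : f' = X1 ^+ 2 * X0 ^+ 2 + (- ((2%:R * g)%:MP * X1)) * X0 + (g ^+ 2 - d)%:MP.
  rewrite /f' /conics iE !(substB, subst_exp, substM, substC, substX) !substXU ?inord_eq //.
  by rewrite !(mpolyCM, mpolyCB, mpolyC_nat); ring.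
have [m [c cE]] : exists m c, (X1 ^+ 2) ^+ m * h' = c * f'.
  rewrite fE; apply: (@quad_vanish K 3 (inord 0) (X1 ^+ 2) (- ((2%:R * g)%:MP * X1))
     (g ^+ 2 - d)%:MP 1).
  - by indep_tac.
  - by indep_tac.
  - by indep_tac.
  - by rewrite -mpolyC1; indep_tac.
  - exact: Xn0.
  - rewrite [X in X != 0](_ : _ = (4%:R * d)%:MP * X1 ^+ 2).
      by rewrite mulf_neq0 ?Xn0 ?C0 ?mulf_neq0.
    by rewrite !(mpolyCM, mpolyCB, mpolyC_nat); ring.
  - exact: oner_neq0.
  - by move=> v; rewrite -fE => fv _; apply: hv.
rewrite -exprM in cE.
(* When g^2 = d one of the conics degenerates to x1 x2 = 0, so 'X_1 divides the equation and cannot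
   be cancelled directly. It is first split off from both [h'] and [f']; the cofactor [f2] is no
   longer divisible by it. *)
have [gd|gd] := eqVneq (g ^+ 2) d; last first.
  apply: cancelX cE; rewrite fE !(substD, substM, subst_exp, substN, substC, substX).
  by rewrite expr0n !(mulr0, mul0r, mulr0n, oppr0, add0r) C0 ?subr_eq0.
have g0 : g != 0 by apply: contraNneq d0 => g0; rewrite -gd g0 expr0n.
pose f2 := X0 * (X1 * X0 - (2%:R * g)%:MP).
have f2E : f' = X1 * f2 by rewrite fE gd subrr mpolyC0 /f2; ring.
have h0 : subst (inord 1) 0 h' = 0.
  apply: mpoly_ext => v; rewrite substE; apply: hv.
  by rewrite f2E mevalM mevalXU upd_same meval0 mul0r.
have [h2 h2E] := subst_dvd (inord 1) 0 h'; rewrite h0 subr0 addr0 in h2E.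
have [c' c'E] : exists c', h2 = c' * f2.
  apply: (@cancelX K 3 (inord 1) (2 * m) f2 h2 c).
    rewrite /f2 !(substM, substB, substC, substX) !substXU ?inord_eq //.
    by rewrite mul0r sub0r mulf_neq0 ?mpolyXU_neq0 ?oppr_eq0 ?C0 ?mulf_neq0.
  apply: (mulfI (mpolyXU_neq0 K (inord 1))).
  by rewrite mulrCA [X1 * h2]mulrC -h2E cE f2E; ring.
by exists c'; rewrite h2E c'E f2E; ring.
Qed.

End Fibres.

Section BranchValues.
Variables (K : numClosedFieldType) (n : nat) (l c : nat -> K).

Definition Gval (a b : K) : K := \sum_(k < n) c k * a ^+ (n.-1 - k) * b ^+ k.
Definition Pval (a b : K) : K := \prod_(3 <= i < n.+2) (b - l i * a).

Lemma ghomK_val v : (ghomK n c).@[v] = Gval (v (inord 0)) (v (inord 1)).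
Proof.
rewrite /ghomK raddf_sum; apply: eq_bigr => k _ /=.
by rewrite !mevalS.
Qed.

Lemma bprodK_val v : (bprodK n l).@[v] = Pval (v (inord 0)) (v (inord 1)).
Proof.
rewrite /bprodK rmorph_prod; apply: eq_bigr => k _ /=.
by rewrite !mevalS.
Qed.

Lemma branchK_val v : (branchK n l c).@[v] =
  (v (inord 2) * v (inord 3) - v (inord 4) ^+ 2 * v (inord 0) ^+ (n - 3) *
     Gval (v (inord 0)) (v (inord 1))) ^+ 2
  - v (inord 4) ^+ 4 * v (inord 0) ^+ (3 * n - 8) *
     (v (inord 1) * Pval (v (inord 0)) (v (inord 1))).
Proof. by rewrite /branchK /gtermK !mevalS ghomK_val bprodK_val. Qed.

Lemma tuple5 (A : nmodType) (t : 5.-tuple A) (k : nat) : (k < 5)%N ->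
  tnth t (inord k) = t`_k.
Proof. by move=> k5; rewrite (tnth_nth 0) inordK. Qed.

Lemma fibre_conics a0 b0 :
  comp_mpoly [tuple a0%:MP; b0%:MP; 'X_(inord 0); 'X_(inord 1); 'X_(inord 2)]
    (branchK n l c) =
  conics (a0 ^+ (n - 3) * Gval a0 b0) (a0 ^+ (3 * n - 8) * (b0 * Pval a0 b0)).
Proof.
apply: mpoly_ext_eq => v; rewrite comp_mpoly_meval branchK_val /conics.
by rewrite !tuple5 //= !mevalS; ring.
Qed.

Lemma conics00 (x : 'I_3 -> K) :
  (conics 0 0).@[x] = 0 <-> x (inord 0) = 0 \/ x (inord 1) = 0.
Proof.
rewrite /conics mpolyC0 !mul0r !subr0 mevalXn mevalM !mevalXU.
split=> [/eqP|[]->]; rewrite ?mul0r ?mulr0 ?expr0n //.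
by rewrite sqrf_eq0 mulf_eq0 => /orP[] /eqP; [left|right].
Qed.

End BranchValues.

(** * The fibres of B and its singularities over lambda = oo *)

Section BranchFibres.
Variables (R : realType) (n : nat) (lam : nat -> R) (g : {poly R}).
Hypotheses (n_ge4 : (4 <= n)%N) (lam2 : lam 2%N = 0).
Local Open Scope complex_scope.
Local Notation l := (fun i => (lam i)%:C).
Local Notation c := (fun k => (g`_k)%:C).

Lemma branch_branchK : branch n lam g = branchK n l c.
Proof. by []. Qed.

Lemma reduced_fibre (a0 b0 : R[i]) :
  ~ reduced_plane_curve (fibre n lam g a0 b0) <->
  (exists2 i : nat, (2 <= i <= n.+1)%N & b0 = (lam i)%:C * a0) \/ a0 = 0.
Proof.
rewrite /fibre branch_branchK fibre_conics.
set d := (X in conics _ X).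
have d0P : d = 0 <->
    (exists2 i : nat, (2 <= i <= n.+1)%N & b0 = (lam i)%:C * a0) \/ a0 = 0.
  split=> [/eqP|].
    rewrite /d !mulf_eq0 expf_eq0 => /orP[/andP[_ /eqP]|/orP[/eqP b00|]].
    - by right.
    - by left; exists 2%N; rewrite ?lam2 ?mul0r //; lia.
    rewrite prodf_seq_eq0 => /hasP[j]; rewrite mem_index_iota subr_eq0 => j3.
    by move=> /eqP ->; left; exists j => //; lia.
  case=> [[i i2 b0E]|a00]; last by rewrite /d a00 expr0n (_ : (3 * n - 8 == 0)%N = false) ?mul0r //; lia.
  have [i_2|i3] := eqVneq i 2%N.
    by rewrite /d b0E i_2 lam2 !mul0r mulr0.
  rewrite /d /Pval (bigD1_seq i) ?iota_uniq ?mem_index_iota //=; last by lia.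
  by rewrite b0E subrr mul0r !mulr0.
rewrite -d0P; split=> [nred|->]; last exact: conics_nonreduced.
by apply/eqP; apply: contrapT => /negP d0; apply/nred/conics_reduced.
Qed.

Lemma fibre_infty (x : 'I_3 -> R[i]) :
  (fibre n lam g 0 1).@[x] = 0 <-> x (inord 0) = 0 \/ x (inord 1) = 0.
Proof.
have n3 : (n - 3 == 0)%N = false by lia.
have n8 : (3 * n - 8 == 0)%N = false by lia.
by rewrite /fibre branch_branchK fibre_conics !expr0n n3 n8 !mul0r; apply: conics00.
Qed.

(** In the chart b = w = 1 the exponent of a is 3n - 8 = k + 1, whence k = 3n - 9. The fibre is x1
    x2 = 0; away from the crossing of its two lines exactly one of x1, x2 is nonzero, and it plays
    the part of the invertible coordinate. *)
Lemma branch_at_infty_A (p : 'rV[R[i]]_3) : p 0 (inord 0) = 0 ->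
  (branch_at_infty n lam g).@[fun i => p 0 i] = 0 ->
  ~ (p 0 (inord 1) = 0 /\ p 0 (inord 2) = 0) ->
  transversal_A (3 * n - 9) (branch_at_infty n lam g) p.
Proof.
move=> p0 fp p12.
pose G : {poly R[i]} := 'X^(n - 3) * \sum_(k < n) (c k)%:P * 'X^(n.-1 - k).
pose Q : {poly R[i]} := \prod_(3 <= i < n.+2) (1 - (l i)%:P * 'X).
have fE (x : 'rV[R[i]]_3) : (branch_at_infty n lam g).@[fun i => x 0 i] =
    (x 0 (inord 1) * x 0 (inord 2) - G.[x 0 (inord 0)]) ^+ 2
    - x 0 (inord 0) ^+ (3 * n - 9).+1 * Q.[x 0 (inord 0)].
  rewrite /branch_at_infty branch_branchK comp_mpoly_meval branchK_val.
  rewrite !tuple5 //= !mevalXU meval1 !expr1n !mul1r /Gval /Pval.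
  have -> : (3 * n - 8 = (3 * n - 9).+1)%N by lia.
  congr ((_ - _) ^+ 2 - _ * _).
    rewrite /G hornerM hornerXn horner_sum; congr (_ * _); apply: eq_bigr => k _.
    by rewrite hornerM hornerC hornerXn expr1n mulr1.
  rewrite /Q horner_prod; apply: eq_bigr => i _.
  by rewrite hornerD hornerN hornerM hornerX !hornerC.
have G0 : G.[0] = 0.
  by rewrite /G hornerM hornerXn expr0n (_ : (n - 3 == 0)%N = false) ?mul0r //; lia.
have Q0 : Q.[0] = 1.
  rewrite /Q horner_prod big1 // => i _.
  by rewrite hornerD hornerN hornerM hornerX !hornerC mulr0 subr0.
have pp : p 0 (inord 1) * p 0 (inord 2) = 0.
  by move/eqP: fp; rewrite fE p0 G0 subr0 expr0n mul0r subr0 sqrf_eq0 => /eqP.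
have sK := @sqrt1K (R[i] : numClosedFieldType).
have sd := @sqrt1_dist (R[i] : numClosedFieldType).
have i10 : inord 1 != inord 0 :> 'I_3 by rewrite inord_eq.
have i20 : inord 2 != inord 0 :> 'I_3 by rewrite inord_eq.
have i21 : inord 2 != inord 1 :> 'I_3 by rewrite inord_eq.
have [p1|p1] := eqVneq (p 0 (inord 1)) 0.
  have p2 : p 0 (inord 2) != 0 by apply: contra_notN p12 => /eqP.
  apply: (transversal_A_double sK sd i20 i10 _ _ _ G0 Q0 p0 p2 p1).
  - by rewrite eq_sym.
  - by move=> i; case: (ord3P i); [constructor 1|constructor 3|constructor 2].
  - by move=> x; rewrite [x 0 (inord 2) * _]mulrC; apply: fE.
have p2 : p 0 (inord 2) = 0.
  by move/eqP: pp; rewrite mulf_eq0 (negPf p1) => /eqP.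
exact: (transversal_A_double sK sd i10 i20 i21 ord3P fE G0 Q0 p0 p1 p2).
Qed.

End BranchFibres.

(** * Multihomogeneous polynomials and the torus action *)

Section Multihomogeneous.
Variables (K : numClosedFieldType) (T : ambient).
Implicit Types (f g : {mpoly K[ncoor T]}) (d e : 'I_(nblk T) -> nat)
  (p : {mpoly K[ncoor T]} * {mpoly K[ncoor T]}).

Lemma mhomog_ext d e f : (forall j, d j = e j) -> mhomog d f -> mhomog e f.
Proof. by move=> de hf m mf j; rewrite -de hf. Qed.

Lemma mhomog0 d : @mhomog K T d 0.
Proof. by move=> m; rewrite msupp0. Qed.

Lemma mhomogC c : @mhomog K T (fun=> 0%N) c%:MP.
Proof.
move=> m; rewrite msuppC; case: eqP => // _; rewrite inE => /eqP -> j.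
by rewrite big1 // => i _; rewrite mnm0E.
Qed.

Lemma mhomogX i : @mhomog K T (wt i) 'X_i.
Proof.
move=> m; rewrite msuppX inE => /eqP -> j.
rewrite (bigD1 i) //= mnm1E eqxx mul1n big1 ?addn0 // => k ki.
by rewrite mnm1E eq_sym (negPf ki).
Qed.

Lemma mhomogD d f g : mhomog d f -> mhomog d g -> mhomog d (f + g).
Proof.
by move=> hf hg m /msuppD_le; rewrite mem_cat => /orP[/hf|/hg].
Qed.

Lemma mhomogN d f : mhomog d f -> mhomog d (- f).
Proof. by move=> hf m; rewrite (perm_mem (msuppN _)); apply: hf. Qed.

Lemma mhomogB d f g : mhomog d f -> mhomog d g -> mhomog d (f - g).
Proof. by move=> hf hg; apply/mhomogD/mhomogN. Qed.

Lemma mhomogM d e f g : mhomog d f -> mhomog e g ->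
  mhomog (fun j => d j + e j)%N (f * g).
Proof.
move=> hf hg m /msuppM_le /allpairsP[[m1 m2] /= [h1 h2 ->]] j.
rewrite -(hf m1 h1 j) -(hg m2 h2 j) -big_split; apply: eq_bigr => i _ /=.
by rewrite mnmDE mulnDl.
Qed.

Lemma mhomogXn d f k : mhomog d f -> mhomog (fun j => k * d j)%N (f ^+ k).
Proof.
move=> hf; elim: k => [|k IH]; first by rewrite expr0 -mpolyC1; apply: mhomogC.
by rewrite exprS; apply: mhomog_ext (mhomogM hf IH) => j; rewrite mulSn.
Qed.

Lemma mhomog_sum d (I : Type) (s : seq I) (Q : pred I)
    (F : I -> {mpoly K[ncoor T]}) :
  (forall i, Q i -> mhomog d (F i)) -> mhomog d (\sum_(i <- s | Q i) F i).
Proof. by move=> hF; elim/big_ind: _ => //; [apply: mhomog0 | apply: mhomogD]. Qed.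

Lemma mhomog_prod d (I : Type) (s : seq I) (F : I -> {mpoly K[ncoor T]}) :
  (forall i, mhomog d (F i)) ->
  mhomog (fun j => size s * d j)%N (\prod_(i <- s) F i).
Proof.
move=> hF; elim: s => [|i s IH]; first by rewrite big_nil -mpolyC1; apply: mhomogC.
by rewrite big_cons; apply: mhomog_ext (mhomogM (hF i) IH) => j; rewrite mulSn.
Qed.

Lemma mhomog_mderiv d e f i : (forall j, e j + wt i j = d j)%N ->
  mhomog d f -> mhomog e f^`M(i).
Proof.
move=> de hf m; rewrite mcoeff_msupp mcoeff_mderiv => fm j.
have mf : (m + U_(i))%MM \in msupp f.
  by rewrite mcoeff_msupp; apply: contraNneq fm => ->; rewrite mul0rn.
apply: (@addIn (wt i j)); rewrite de -(hf _ mf j).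
rewrite [RHS](eq_bigr (fun k => m k * wt k j + (k == i) * wt k j)%N); last first.
  by move=> k _; rewrite mnmDE mnm1E eq_sym mulnDl.
rewrite big_split; congr (_ + _)%N; rewrite (bigD1 i) //= eqxx mul1n.
by rewrite big1 ?addn0 // => k /negPf ->.
Qed.

Definition act (t : 'I_(nblk T) -> K) (v : pt K T) : pt K T :=
  fun i => (\prod_j t j ^+ wt i j) * v i.

Lemma meval_act d f t v : mhomog d f ->
  f.@[act t v] = (\prod_j t j ^+ d j) * f.@[v].
Proof.
move=> hf; rewrite !mevalE mulr_sumr big_seq [RHS]big_seq; apply: eq_bigr => m mf.
rewrite mulrCA; congr (_ * _).
rewrite (eq_bigr (fun i => (\prod_j t j ^+ (wt i j * m i)) * v i ^+ m i)).
  rewrite big_split exchange_big /=; congr (_ * _).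
  apply: eq_bigr => j _.
  by rewrite prodrXr -(hf _ mf j); congr (_ ^+ _); apply: eq_bigr => i _; rewrite mulnC.
by move=> i _; rewrite exprMn -prodrXl; congr (_ * _); apply: eq_bigr => j _; rewrite exprM.
Qed.

(** Both sides are derivatives at 0 of polynomials in one variable that are proportional by
    [meval_act]. *)
Lemma mdiff_act d f t v h : mhomog d f ->
  mdiff f (act t v) (act t h) = (\prod_j t j ^+ d j) * mdiff f v h.
Proof.
move=> hf; have [q1 H1] := line_poly f (act t v) (act t h).
have [q2 H2] := line_poly f v h.
have q12 : q1 = (\prod_j t j ^+ d j) *: q2.
  apply/eqP; rewrite -subr_eq0; apply/eqP/(poly_vanish (oner_neq0 _)) => x _.
  rewrite hornerD hornerN hornerZ; have [-> _] := H1 x; have [-> _] := H2 x.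
  rewrite -(meval_act _ _ hf); apply/eqP; rewrite subr_eq0; apply/eqP.
  by apply: meval_eq => i; rewrite /act; ring.
have [_] := H1 0; have [_] := H2 0; rewrite q12 derivZ hornerZ => -> E.
have H0 w k : (fun i => w i + 0 * k i) = w :> ('I_(ncoor T) -> K).
  by apply/funext => i; rewrite mul0r addr0.
by rewrite !H0 in E; rewrite E.
Qed.

(** The tangent direction of the torus orbit of [v] along the j-th factor. *)
Definition radial (j : 'I_(nblk T)) (v : pt K T) : pt K T :=
  fun i => (wt i j)%:R * v i.

(** Euler's identity for the j-th grading, checked on each monomial. *)
Lemma mdiff_radial d f j v : mhomog d f ->
  mdiff f v (radial j v) = (d j)%:R * f.@[v].
Proof.
move=> hf; rewrite /mdiff /radial.
have -> : \sum_i (f^`M(i)).@[v] * ((wt i j)%:R * v i) =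
    (\sum_i (wt i j)%:R *: ('X_i * f^`M(i))).@[v].
  rewrite raddf_sum; apply: eq_bigr => i _ /=.
  by rewrite mevalZ mevalM mevalXU; ring.
rewrite -mevalZ; congr (meval v _); apply/mpolyP => m.
rewrite mcoeffZ raddf_sum /=.
have XE i : ('X_i * f^`M(i))@_m = (m i)%:R * f@_m.
  have [mi0|mi0] := posnP (m i).
    rewrite mi0 mul0r; apply: memN_msupp_eq0; rewrite mulrC.
    rewrite (perm_mem (msuppMX _ _)); apply/mapP => -[m' _ mE].
    by move: mi0; rewrite mE mnmDE mnm1E eqxx.
  pose m' := (m - U_(i))%MM; have mE : m = (m' + U_(i))%MM.
    by rewrite submK // lep1mP -lt0n.
  rewrite mE mulrC [in LHS]addmC mcoeffMX mcoeff_mderiv.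
  by rewrite mnmDE mnm1E eqxx addn1 mulr_natl.
rewrite (eq_bigr (fun i => (m i * wt i j)%:R * f@_m)); last first.
  by move=> i _; rewrite mcoeffZ XE natrM; ring.
rewrite -mulr_suml -natr_sum.
have [mf|/memN_msupp_eq0 ->] := boolP (m \in msupp f); last by rewrite !mulr0.
by rewrite (hf _ mf j).
Qed.

Lemma prod_act_neq0 d (t : 'I_(nblk T) -> K) : (forall j, t j != 0) ->
  \prod_j t j ^+ d j != 0.
Proof. by move=> t0; apply/prodf_neq0 => j _; rewrite expf_neq0. Qed.

Lemma rval_act p t v : ratfun p -> (forall j, t j != 0) -> p.2.@[v] != 0 ->
  rval p (act t v) = rval p v.
Proof.
move=> [d [h1 h2]] t0 pv; rewrite /rval (meval_act _ _ h1) (meval_act _ _ h2).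
by field; rewrite pv prod_act_neq0.
Qed.

Lemma rdiff_act p t v h : ratfun p -> (forall j, t j != 0) -> p.2.@[v] != 0 ->
  rdiff p (act t v) (act t h) = rdiff p v h.
Proof.
move=> [d [h1 h2]] t0 pv; rewrite /rdiff (meval_act _ _ h1) (meval_act _ _ h2).
rewrite (mdiff_act _ _ _ h1) (mdiff_act _ _ _ h2).
by field; rewrite pv prod_act_neq0.
Qed.

Lemma rdiff_radial p j v : ratfun p -> rdiff p v (radial j v) = 0.
Proof.
move=> [d [h1 h2]]; rewrite /rdiff (mdiff_radial _ _ h1) (mdiff_radial _ _ h2).
by rewrite [X in X / _](_ : _ = 0) ?mul0r //; ring.
Qed.

Lemma rdiffDr p v h h' : rdiff p v (fun i => h i + h' i) = rdiff p v h + rdiff p v h'.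
Proof. by rewrite /rdiff !mdiffDr; ring. Qed.

Lemma rdiffZr p v c h : rdiff p v (fun i => c * h i) = c * rdiff p v h.
Proof. by rewrite /rdiff !mdiffZr; ring. Qed.

Lemma zclosed_locus d f : mhomog d f -> zclosed (locus f).
Proof.
move=> hf; exists (eq f); split=> [_ <-|v]; first by exists d.
split=> [[sv fv]|[sv fv]]; first by split=> // _ <-.
by split=> //; apply: fv.
Qed.

End Multihomogeneous.

(** * Regular functions on the affine curve y^2 = Q(x) *)

Section DoubleCover.
Variables (K : numClosedFieldType) (Q : {poly K}).
Hypothesis Q0 : Q != 0.
Implicit Types (r s h p : {poly K}) (x y : K).

(* Functions on the affine curve y^2 = Q(x) with a normal form r(x) + s(x) y. *)
Definition nf (phi : K -> K -> K) := exists r s : {poly K},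
  forall x y, y ^+ 2 = Q.[x] -> phi x y = r.[x] + s.[x] * y.

Lemma nf_poly r : nf (fun x _ => r.[x]).
Proof. by exists r, 0 => x y _; rewrite horner0 mul0r addr0. Qed.

Lemma nf_const c : nf (fun _ _ => c).
Proof. by exists c%:P, 0 => x y _; rewrite horner0 hornerC mul0r addr0. Qed.

Lemma nf_x : nf (fun x _ => x).
Proof. by exists 'X, 0 => x y _; rewrite horner0 hornerX mul0r addr0. Qed.

Lemma nf_y : nf (fun _ y => y).
Proof. by exists 0, 1 => x y _; rewrite horner0 hornerC mul1r add0r. Qed.

Lemma nfD f g : nf f -> nf g -> nf (fun x y => f x y + g x y).
Proof.
move=> [r [s fE]] [r' [s' gE]]; exists (r + r'), (s + s') => x y xy.
by rewrite fE // gE // !hornerD; ring.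
Qed.

Lemma nfM f g : nf f -> nf g -> nf (fun x y => f x y * g x y).
Proof.
move=> [r [s fE]] [r' [s' gE]].
exists (r * r' + s * s' * Q), (r * s' + s * r') => x y xy.
by rewrite fE // gE // !hornerD !hornerM -xy; ring.
Qed.

Lemma nfN f : nf f -> nf (fun x y => - f x y).
Proof.
move=> [r [s fE]]; exists (- r), (- s) => x y xy.
by rewrite fE // !hornerN; ring.
Qed.

Lemma nfXn f k : nf f -> nf (fun x y => f x y ^+ k).
Proof.
move=> nff; elim: k => [|k IH]; first exact: (nf_const 1).
by case: (nfM nff IH) => r [s E]; exists r, s => x y xy; rewrite exprS E.
Qed.

Lemma nf_sum (I : Type) (l : seq I) (P : pred I) (F : I -> K -> K -> K) :
  (forall i, nf (F i)) -> nf (fun x y => \sum_(i <- l | P i) F i x y).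
Proof.
move=> hF; elim: l => [|i l IH].
  by case: (nf_const 0) => r [s E]; exists r, s => x y xy; rewrite big_nil -E.
have [hi|hi] := boolP (P i).
  case: (nfD (hF i) IH) => r [s E]; exists r, s => x y xy.
  by rewrite big_cons hi E.
by case: IH => r [s E]; exists r, s => x y xy; rewrite big_cons (negPf hi) E.
Qed.

Lemma nf_prod (I : Type) (l : seq I) (P : pred I) (F : I -> K -> K -> K) :
  (forall i, nf (F i)) -> nf (fun x y => \prod_(i <- l | P i) F i x y).
Proof.
move=> hF; elim: l => [|i l IH].
  by case: (nf_const 1) => r [s E]; exists r, s => x y xy; rewrite big_nil -E.
have [hi|hi] := boolP (P i).
  case: (nfM (hF i) IH) => r [s E]; exists r, s => x y xy.
  by rewrite big_cons hi E.
by case: IH => r [s E]; exists r, s => x y xy; rewrite big_cons (negPf hi) E.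
Qed.

Lemma nf_meval m (f : {mpoly K[m]}) (V : K -> K -> 'I_m -> K) :
  (forall i, nf (fun x y => V x y i)) -> nf (fun x y => f.@[V x y]).
Proof.
move=> hV; elim/mpoly_ring_ind: f => [c|p q hp hq|i p hp].
- by case: (nf_const c) => r [s E]; exists r, s => x y xy; rewrite mevalC -E.
- by case: (nfD hp hq) => r [s E]; exists r, s => x y xy; rewrite mevalD -E.
by case: (nfM (hV i) hp) => r [s E]; exists r, s => x y xy; rewrite mevalM mevalXU -E.
Qed.

Lemma nf_mdiff m (f : {mpoly K[m]}) (V H : K -> K -> 'I_m -> K) :
  (forall i, nf (fun x y => V x y i)) -> (forall i, nf (fun x y => H x y i)) ->
  nf (fun x y => mdiff f (V x y) (H x y)).
Proof. by move=> hV hH; apply: nf_sum => i; apply: nfM => //; apply: nf_meval. Qed.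

(** Comparing y with - y gives r(x) = s(x) = 0 wherever Q(x) <> 0, which is enough by
    [poly_vanish]. *)
Lemma nf_separate r s : (forall x y, y ^+ 2 = Q.[x] -> r.[x] + s.[x] * y = 0) ->
  r = 0 /\ s = 0.
Proof.
move=> rs; have rs0 x : Q.[x] != 0 -> r.[x] = 0 /\ s.[x] = 0.
  move=> Qx; pose y := sqrtC Q.[x].
  have y2 : y ^+ 2 = Q.[x] by rewrite sqrtCK.
  have y0 : y != 0 by rewrite sqrtC_eq0.
  have E1 := rs x y y2; have := rs x (- y); rewrite sqrrN => /(_ y2) E2.
  have two : 2%:R != 0 :> K by rewrite pnatr_eq0.
  have r0 : r.[x] = 0.
    apply: (mulfI two); transitivity ((r.[x] + s.[x] * y) + (r.[x] + s.[x] * - y)).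
      by ring.
    by rewrite E1 E2 addr0 mulr0.
  split=> //; move/eqP: E1; rewrite r0 add0r mulf_eq0 (negPf y0) orbF.
  by move/eqP.
by split; apply: (poly_vanish Q0) => x /rs0 [].
Qed.

Definition locally_nf (phi : K -> K -> K) := forall x0 y0, y0 ^+ 2 = Q.[x0] ->
  exists p q : K -> K -> K, [/\ nf p, nf q, q x0 y0 != 0 & forall x y, y ^+ 2 = Q.[x] ->
    q x y != 0 -> q x y * phi x y = p x y].

(* Denominators are removed one root at a time: if (x - x0) h phi has a normal form
   r + s y, the local expressions p / q of phi over x0 force (x - x0) | r, s. *)
Lemma locally_nf_root phi h x0 : locally_nf phi ->
  nf (fun x y => (x - x0) * h.[x] * phi x y) -> nf (fun x y => h.[x] * phi x y).
Proof.
move=> loc [r [s rsE]].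
have loc2 y0 : y0 ^+ 2 = Q.[x0] -> exists A B C D : {poly K},
    [/\ A.[x0] + B.[x0] * y0 != 0,
        (A.[x0] + B.[x0] * y0) * phi x0 y0 = C.[x0] + D.[x0] * y0,
        A * r + B * s * Q = ('X - x0%:P) * h * C &
        A * s + B * r = ('X - x0%:P) * h * D].
  move=> y0E; have [p [q [nfp nfq q0 qphi]]] := loc x0 y0 y0E.
  have [A [B qqE]] := nfM nfq nfq; have [C [D pqE]] := nfM nfp nfq.
  (* The relation q phi = p is known only where q <> 0. Multiplied once more by q it holds on the
     whole curve, so it can be separated into its two components; A + B y is q^2 and C + D y is p
     q. *)
  have /nf_separate[] : forall x y, y ^+ 2 = Q.[x] ->
      (A * r + B * s * Q - ('X - x0%:P) * h * C).[x] +
      (A * s + B * r - ('X - x0%:P) * h * D).[x] * y = 0.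
    move=> x y xy.
    transitivity ((A.[x] + B.[x] * y) * (r.[x] + s.[x] * y)
        - (x - x0) * h.[x] * (C.[x] + D.[x] * y)).
      by rewrite !hornerE -xy; ring.
    rewrite -rsE // -qqE // -pqE //.
    have [q_0|/qphi <- //] := eqVneq (q x y) 0; last by ring.
    by rewrite q_0; ring.
  move=> /eqP; rewrite subr_eq0 => /eqP E1 /eqP; rewrite subr_eq0 => /eqP E2.
  exists A, B, C, D; rewrite -!(qqE, pqE) //; split=> //; first by rewrite mulf_neq0.
  by rewrite -qphi //; ring.
have rs0 y0 : y0 ^+ 2 = Q.[x0] -> r.[x0] + s.[x0] * y0 = 0.
  move=> y0E; have [A [B [C [D [AB _ E1 E2]]]]] := loc2 y0 y0E.
  apply: (mulfI AB); rewrite mulr0.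
  transitivity ((A * r + B * s * Q).[x0] + (A * s + B * r).[x0] * y0).
    by rewrite !hornerE -y0E; ring.
  by rewrite E1 E2 !hornerE subrr !mul0r addr0.
pose y0 := sqrtC Q.[x0]; have y0E : y0 ^+ 2 = Q.[x0] by rewrite sqrtCK.
have [r0 s0] : r.[x0] = 0 /\ s.[x0] = 0.
  have E1 := rs0 y0 y0E; have := rs0 (- y0); rewrite sqrrN => /(_ y0E) E2.
  have two : 2%:R != 0 :> K by rewrite pnatr_eq0.
  have r0 : r.[x0] = 0.
    apply: (mulfI two); transitivity ((r.[x0] + s.[x0] * y0) + (r.[x0] + s.[x0] * - y0)).
      by ring.
    by rewrite E1 E2 addr0 mulr0.
  (* At a branch point the two conjugate points coincide and yield no second equation; s(x0) = 0
     then comes from A s + B r = (x - x0) h D, where A(x0) <> 0. *)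
  split=> //; have [y00|y00] := eqVneq y0 0; last first.
    by move/eqP: E1; rewrite r0 add0r mulf_eq0 (negPf y00) orbF => /eqP.
  have [A [B [C [D [AB _ _ E3]]]]] := loc2 y0 y0E.
  rewrite y00 mulr0 addr0 in AB; apply: (mulfI AB).
  have := congr1 (horner^~ x0) E3; rewrite /= !hornerE r0 subrr mulr0 addr0 !mul0r.
  by move=> ->.
have /factor_theorem[r1 r1E] : root r x0 by apply/eqP.
have /factor_theorem[s1 s1E] : root s x0 by apply/eqP.
have X0 : 'X - x0%:P != 0 by rewrite polyXsubC_eq0.
exists r1, s1 => x y xy; have [xx0|xx0] := eqVneq x x0; last first.
  have x0' : x - x0 != 0 by rewrite subr_eq0.
  apply: (mulfI x0'); rewrite mulrA rsE // r1E s1E !hornerE; ring.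
rewrite xx0 in xy *; have [A [B [C [D [AB phiE E1 E2]]]]] := loc2 y xy.
have E1' : A * r1 + B * s1 * Q = h * C.
  by apply: (mulfI X0); rewrite mulrA -E1 r1E s1E; ring.
have E2' : A * s1 + B * r1 = h * D.
  by apply: (mulfI X0); rewrite mulrA -E2 r1E s1E; ring.
apply: (mulfI AB); rewrite mulrCA phiE.
transitivity ((h * C).[x0] + (h * D).[x0] * y); first by rewrite !hornerM; ring.
by rewrite -E1' -E2' !hornerE -xy; ring.
Qed.

(** Some nonzero multiple h(x) phi has a normal form, and the roots of h are then removed one by
    one, the field being algebraically closed. The first multiple comes from the local expression at
    the branch point over [x0]. *)
Lemma locally_nf_nf phi (x0 : K) : Q.[x0] = 0 -> locally_nf phi -> nf phi.
Proof.
move=> Qx0 loc.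
suff [h h0] : exists2 h, h != 0 & nf (fun x y => h.[x] * phi x y).
  have [N] := ubnP (size h); elim: N => // N IH in h h0 *; rewrite ltnS => hN nfh.
  have [h1|h1] := leqP (size h) 1.
    have hc : h = (h.[0])%:P by rewrite {1}(size1_polyC h1) horner_coef0.
    have h00 : h.[0] != 0 by apply: contraNneq h0 => h00; rewrite hc h00.
    case: (nfM (nf_const h.[0]^-1) nfh) => r [s E]; exists r, s => x y xy.
    by rewrite -E // mulrA [h in h.[x]]hc hornerC mulVf // mul1r.
  have /closed_rootP[x] : size h != 1 by rewrite neq_ltn h1 orbT.
  move=> /factor_theorem[h2 h2E].
  have h20 : h2 != 0 by apply: contraNneq h0 => h20; rewrite h2E h20 mul0r.
  apply: (IH h2 h20).
    by move: hN; rewrite h2E size_Mmonic ?monicXsubC // size_XsubC addn2 /=.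
  apply: (@locally_nf_root _ _ x loc).
  case: nfh => r [s E]; exists r, s => u y uy.
  by rewrite -E // h2E !hornerE; ring.
have y0E : 0 ^+ 2 = Q.[x0] by rewrite Qx0 expr0n.
have [p [q [nfp [q0 [q1 qE]] q_neq0 qphi]]] := loc x0 0 y0E.
(* The norm of q = q0 + q1 y. As Q(x0) = 0, its value at x0 is q0(x0)^2, the square of the nonzero
   number q(x0, 0). *)
pose n := q0 ^+ 2 - q1 ^+ 2 * Q; pose qi x y := q0.[x] - q1.[x] * y.
have nE x y : y ^+ 2 = Q.[x] -> n.[x] = q x y * qi x y.
  by move=> xy; rewrite qE // /n /qi !hornerE -xy; ring.
have n0 : n != 0.
  apply: contra_neq q_neq0 => n_0.
  rewrite qE // mulr0 addr0; apply/eqP; rewrite -sqrf_eq0.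
  have := congr1 (horner^~ x0) n_0; rewrite /= /n !hornerE Qx0 mulr0 subr0.
  by move=> ->.
(* One factor n turns q into a polynomial in x; the second makes the identity hold also where q =
   0. *)
exists (n ^+ 2); first by rewrite expf_neq0.
have nfqi : nf qi by apply: nfD (nf_poly q0) (nfN (nfM (nf_poly q1) nf_y)).
case: (nfM (nfM (nf_poly n) nfqi) nfp) => r [s E]; exists r, s => x y xy.
rewrite -E // horner_exp; have [q_0|q_0] := eqVneq (q x y) 0.
  by rewrite (nE _ _ xy) q_0; ring.
by rewrite -qphi // (nE _ _ xy); ring.
Qed.

End DoubleCover.

(** * Regular differential forms along the torus and along polynomial families *)

Section RegularForms.
Variables (K : numClosedFieldType) (T : ambient) (X : pt K T -> Prop).
Variable om : pt K T * pt K T -> K.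
Implicit Types (p : {mpoly K[ncoor T]} * {mpoly K[ncoor T]}).

Lemma regular_form1 :
  (forall v, X v -> exists p q, [/\ ratfun p, ratfun q, p.2.@[v] != 0,
     q.2.@[v] != 0 & forall v' h, tangent_pairs X (v', h) ->
       p.2.@[v'] != 0 -> q.2.@[v'] != 0 -> om (v', h) = rval p v' * rdiff q v' h]) ->
  regular_form X om.
Proof.
move=> H v /H[p [q [rp rq pv qv omE]]]; exists 1%N, (fun=> p), (fun=> q).
split=> // v' h tvh /(_ ord0)[pv' qv'].
by rewrite big_ord1 omE.
Qed.

Hypothesis om_reg : regular_form X om.

Lemma rdiff_radials p v (rho : 'I_(nblk T) -> K) : ratfun p ->
  rdiff p v (fun i => \sum_j rho j * radial j v i) = 0.
Proof.
move=> rp; elim: (index_enum _) => [|j s IH].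
  rewrite (_ : (fun i => _) = fun i => 0 * v i) ?rdiffZr ?mul0r //.
  by apply/funext => i; rewrite big_nil mul0r.
rewrite (_ : (fun i => _) = fun i => rho j * radial j v i +
    \sum_(k <- s) rho k * radial k v i); last by apply/funext => i; rewrite big_cons.
by rewrite rdiffDr rdiffZr rdiff_radial // IH mulr0 addr0.
Qed.

(* Regular forms are invariant under the torus and vanish on its orbits. *)
Lemma regular_transport v h t tau alpha (rho : 'I_(nblk T) -> K) :
  X v -> tangent X v h -> X (act t v) -> tangent X (act t v) tau ->
  (forall j, t j != 0) ->
  (forall i, act t h i = alpha * tau i + \sum_j rho j * radial j (act t v) i) ->
  om (v, h) = alpha * om (act t v, tau).
Proof.
move=> Xv tvh Xtv ttau t0 hE; have [N [a [b [abP omE]]]] := om_reg Xv.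
have den f d : mhomog d f -> f.@[v] != 0 -> f.@[act t v] != 0.
  by move=> hf fv; rewrite (meval_act _ _ hf) mulf_neq0 ?prod_act_neq0.
rewrite (omE v h) //; last by move=> k; case: (abP k).
rewrite (omE (act t v) tau) //; last first.
  move=> k; case: (abP k) => -[d1 [_ h1]] [d2 [_ h2]] a0 b0.
  by split; [apply: den h1 a0 | apply: den h2 b0].
rewrite mulr_sumr; apply: eq_bigr => k _; case: (abP k) => ra rb a0 b0.
rewrite -(rval_act ra t0 a0) -(rdiff_act h rb t0 b0).
rewrite (_ : act t h = fun i => alpha * tau i + \sum_j rho j * radial j (act t v) i).
  by rewrite rdiffDr rdiffZr rdiff_radials // addr0; ring.
by apply/funext.
Qed.

(** The local expression of the form is a sum of fractions with denominators a.2 b.2^2. Over a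
    common denominator it is a quotient of functions in normal form, so [locally_nf_nf] applies. *)
Lemma regular_nf (Q : {poly K}) x0 (V H : K -> K -> pt K T) :
  Q != 0 -> Q.[x0] = 0 ->
  (forall i, nf Q (fun x y => V x y i)) -> (forall i, nf Q (fun x y => H x y i)) ->
  (forall x y, y ^+ 2 = Q.[x] -> tangent_pairs X (V x y, H x y)) ->
  nf Q (fun x y => om (V x y, H x y)).
Proof.
move=> Q0 Qx0 nV nH tVH; apply: (locally_nf_nf Q0 Qx0) => x1 y1 xy1.
have [Xv1 _] := tVH _ _ xy1; have [N [a [b [abP omE]]]] := om_reg Xv1.
pose q (k : 'I_N) x y := (a k).2.@[V x y] * (b k).2.@[V x y] ^+ 2.
pose p (k : 'I_N) x y := (a k).1.@[V x y] *
  (mdiff (b k).1 (V x y) (H x y) * (b k).2.@[V x y]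
   - (b k).1.@[V x y] * mdiff (b k).2 (V x y) (H x y)).
have nfq k : nf Q (q k) by apply: nfM; [|apply: nfXn]; apply: nf_meval.
have nfp k : nf Q (p k).
  apply: nfM; first exact: nf_meval.
  apply: nfD; first by apply: nfM; [apply: nf_mdiff | apply: nf_meval].
  by apply: nfN; apply: nfM; [apply: nf_meval | apply: nf_mdiff].
exists (fun x y => \sum_k p k x y * \prod_(j | j != k) q j x y),
  (fun x y => \prod_k q k x y); split.
- by apply: nf_sum => k; apply: nfM => //; apply: nf_prod.
- exact: nf_prod.
- by apply/prodf_neq0 => k _; case: (abP k) => _ _ ak bk; rewrite mulf_neq0 ?expf_neq0.
move=> x y xy /prodf_neq0 qk.
have den k : (a k).2.@[V x y] != 0 /\ (b k).2.@[V x y] != 0.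
  by have := qk k isT; rewrite mulf_eq0 sqrf_eq0 negb_or => /andP.
rewrite (omE (V x y) (H x y)) //; last exact: tVH.
rewrite mulr_sumr; apply: eq_bigr => k _; rewrite (bigD1 k) //= mulrAC mulrC.
rewrite [RHS]mulrC; congr (_ * _); rewrite /rval /rdiff /p /q.
by have [ak bk] := den k; field; rewrite ak bk.
Qed.

End RegularForms.

(** * The bundle P(O(m) + O) over P^1, and linear algebra for tangent spaces *)

Section Hirzebruch.
Variable m : nat.

(** The coordinates are a, b on the base and y, w on the fibre, with y twisted by O(m); the second
    column is the fibre degree. *)
Definition hirz_wt (i : 'I_4) (j : 'I_2) : nat :=
  nth 0%N (nth [::] [:: [:: 1; 0]; [:: 1; 0]; [:: m; 1]; [:: 0; 1]] i)%N j.
Definition hirz_blk (i : 'I_4) : 'I_2 := inord (2 <= i)%N.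

Lemma hirz_blkE i : hirz_blk i = (2 <= i)%N :> nat.
Proof. by rewrite inordK //; case: (1 < i)%N. Qed.

Lemma hirz_diag i : hirz_wt i (hirz_blk i) = 1%N.
Proof.
by rewrite /hirz_wt hirz_blkE; case: i => [[|[|[|[|i]]]]].
Qed.

Lemma hirz_trig i (j : 'I_2) : (hirz_blk i < j)%N -> hirz_wt i j = 0%N.
Proof.
rewrite /hirz_wt hirz_blkE.
by case: i j => [[|[|[|[|i]]]] i4] [[|[|j]] j2].
Qed.

Definition hirz : ambient := Ambient hirz_diag hirz_trig.

End Hirzebruch.

Section Coordinates.
Variable A : Type.

Definition vec4 (a b y w : A) : 'I_4 -> A := fun i => nth a [:: a; b; y; w] i.

Lemma vec4_0 a b y w : vec4 a b y w (inord 0) = a.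
Proof. by rewrite /vec4 inordK. Qed.
Lemma vec4_1 a b y w : vec4 a b y w (inord 1) = b.
Proof. by rewrite /vec4 inordK. Qed.
Lemma vec4_2 a b y w : vec4 a b y w (inord 2) = y.
Proof. by rewrite /vec4 inordK. Qed.
Lemma vec4_3 a b y w : vec4 a b y w (inord 3) = w.
Proof. by rewrite /vec4 inordK. Qed.
Definition vec4E := (vec4_0, vec4_1, vec4_2, vec4_3).

Lemma ord4P (i : 'I_4) : [\/ i = inord 0, i = inord 1, i = inord 2 | i = inord 3].
Proof.
by case: i => -[|[|[|[|//]]]] ?;
  [constructor 1|constructor 2|constructor 3|constructor 4];
  apply/val_inj; rewrite /= inordK.
Qed.

Lemma vec4_eta (v : 'I_4 -> A) :
  v = vec4 (v (inord 0)) (v (inord 1)) (v (inord 2)) (v (inord 3)).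
Proof. by apply/funext => i; case: (ord4P i) => ->; rewrite vec4E. Qed.

End Coordinates.

Lemma sum_ord4 (V : nmodType) (F : 'I_4 -> V) :
  \sum_i F i = F (inord 0) + F (inord 1) + F (inord 2) + F (inord 3).
Proof.
rewrite !big_ord_recl big_ord0 addr0 !addrA.
by congr (F _ + F _ + F _ + F _); apply/val_inj; rewrite /= inordK.
Qed.

Section KernelDimension.
Variable K : fieldType.

(** The coordinates other than the pivot [i0] are free. Applied to the differential of one equation,
    this is the dimension of the tangent space of a smooth hypersurface. *)
Lemma has_dim_kernel n (l : 'I_n.+1 -> K) (i0 : 'I_n.+1) : l i0 != 0 ->
  has_dim (fun=> True) (fun h : 'I_n.+1 -> K => \sum_i l i * h i = 0) n.
Proof.
move=> l0; pose e (k : 'I_n) (i : 'I_n.+1) : K :=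
  if i == i0 then - l (lift i0 k) / l i0 else (i == lift i0 k)%:R.
have e0 k : e k i0 = - l (lift i0 k) / l i0 by rewrite /e eqxx.
have e1 k k' : e k (lift i0 k') = (k' == k)%:R.
  by rewrite /e eq_sym (negPf (neq_lift _ _)) (inj_eq lift_inj).
have sum_delta (F : 'I_n -> K) k : \sum_k' F k' * (k == k')%:R = F k.
  rewrite (bigD1 k) //= eqxx mulr1 big1 ?addr0 // => k' k'k.
  by rewrite eq_sym (negPf k'k) mulr0.
exists e; split=> [k|c ce k|h hh].
- rewrite (bigD1_ord i0) //= e0 (eq_bigr (fun k' => l (lift i0 k') * (k == k')%:R)).
    by rewrite sum_delta mulrC divfK // addNr.
  by move=> k' _; rewrite e1 eq_sym.
- have := ce (lift i0 k) I; rewrite (eq_bigr (fun k' => c k' * (k == k')%:R)).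
    by rewrite sum_delta.
  by move=> k' _; rewrite e1.
exists (fun k => h (lift i0 k)) => x _; case: (unliftP i0 x) => [k|] ->.
  rewrite (eq_bigr (fun k' => h (lift i0 k') * (k == k')%:R)) ?sum_delta //.
  by move=> k' _; rewrite e1.
move: hh; rewrite (bigD1_ord i0) //= => /eqP; rewrite addr_eq0 => /eqP hh.
apply: (mulfI l0); rewrite hh mulr_sumr -sumrN; apply: eq_bigr => k _.
by rewrite e0; field.
Qed.

End KernelDimension.

(** * The smooth curve y^2 = w^2 P(a, b), with P a binary form of degree 2m *)

Section HyperellipticCurve.
Variables (K : numClosedFieldType) (m : nat) (P E : {mpoly K[4]}).
Local Notation o0 := (inord 0 : 'I_4).
Local Notation o1 := (inord 1 : 'I_4).
Local Notation o2 := (inord 2 : 'I_4).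
Local Notation o3 := (inord 3 : 'I_4).
Local Notation T := (hirz m).

Definition bideg (a b : nat) : 'I_2 -> nat := fun j => nth 0%N [:: a; b] j.

Hypothesis m_gt1 : (1 < m)%N.
Hypothesis P_homog : @mhomog K T (bideg (2 * m) 0) P.
Hypotheses (P_y : indep o2 P) (P_w : indep o3 P).
Hypotheses (PE : P = 'X_o1 * E) (E_neq0 : subst o1 0 E != 0).
Hypothesis P_sqfree : forall v, P.@[v] = 0 -> (v o0 != 0) || (v o1 != 0) ->
  (P^`M(o0).@[v] != 0) || (P^`M(o1).@[v] != 0).

Definition curve : {mpoly K[ncoor T]} := 'X_o2 ^+ 2 - 'X_o3 ^+ 2 * P.

Local Notation pa v := (P^`M(o0).@[v]).
Local Notation pb v := (P^`M(o1).@[v]).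
Local Notation X := (locus curve).

Lemma hirz_stable (v : pt K T) :
  stable v <-> ((v o0 != 0) || (v o1 != 0)) && ((v o2 != 0) || (v o3 != 0)).
Proof.
split=> [sv|/andP[ab yw] [[|[|//]] j2]].
- apply/andP; split.
    have [i [bi vi]] := sv (Ordinal (isT : (0 < 2)%N)).
    have := congr1 val bi; rewrite /= hirz_blkE.
    by case: (ord4P i) vi => -> vi; rewrite ?vi ?orbT // inordK.
  have [i [bi vi]] := sv (Ordinal (isT : (1 < 2)%N)).
  have := congr1 val bi; rewrite /= hirz_blkE.
  by case: (ord4P i) vi => -> vi; rewrite ?vi ?orbT // inordK.
- by case/orP: ab => vi; [exists o0|exists o1]; split=> //;
    apply/val_inj; rewrite /= hirz_blkE inordK.
by case/orP: yw => vi; [exists o2|exists o3]; split=> //;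
  apply/val_inj; rewrite /= hirz_blkE inordK.
Qed.

Lemma mderiv_indep i f : indep i f -> f^`M(i) = 0 :> {mpoly K[4]}.
Proof.
move=> fi; apply: mpoly_ext => v; have [q Hq] := line_poly f v (fun j => (j == i)%:R).
have qE : q = (f.@[v])%:P.
  apply/eqP; rewrite -subr_eq0; apply/eqP/(poly_vanish (oner_neq0 _)) => x _.
  rewrite hornerD hornerN hornerC; have [-> _] := Hq x; rewrite -(fi v (v i + x)).
  apply/eqP; rewrite subr_eq0; apply/eqP/meval_eq => j; rewrite /upd.
  by case: eqP => [->|_]; rewrite ?mulr1 // mulr0 addr0.
have [_] := Hq 0; rewrite qE derivC horner0 /mdiff (bigD1 i) //= big1.
  rewrite eqxx mulr1 addr0 => /esym <-; apply: meval_eq => j.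
  by rewrite mul0r addr0.
by move=> j /negPf ->; rewrite mulr0.
Qed.

Lemma mdiff_P v h : mdiff P v h = pa v * h o0 + pb v * h o1.
Proof.
by rewrite /mdiff sum_ord4 (mderiv_indep P_y) (mderiv_indep P_w) !meval0 !mul0r !addr0.
Qed.

Lemma euler_P v : v o0 * pa v + v o1 * pb v = (2 * m)%:R * P.@[v].
Proof.
have := @mdiff_radial K T _ _ (Ordinal (isT : (0 < 2)%N)) v P_homog.
rewrite mdiff_P /radial /= /hirz_wt !inordK //= !mul1r => <-.
by rewrite mulrC [v o1 * _]mulrC.
Qed.

Lemma curve_val v : curve.@[v] = v o2 ^+ 2 - v o3 ^+ 2 * P.@[v].
Proof. by rewrite /curve !mevalS. Qed.

Lemma mdiff_curve v h : mdiff curve v h =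
  2%:R * v o2 * h o2 - (2%:R * v o3 * h o3 * P.@[v]
    + v o3 ^+ 2 * (pa v * h o0 + pb v * h o1)).
Proof.
rewrite /curve mdiffB mdiffM -mdiff_P !expr2 !mdiffM !mdiffX !mevalS; ring.
Qed.

Lemma hirz_wtE (j : 'I_2) :
  [/\ wt (o0 : 'I_(ncoor T)) j = bideg 1 0 j, wt (o1 : 'I_(ncoor T)) j = bideg 1 0 j,
      wt (o2 : 'I_(ncoor T)) j = bideg m 1 j & wt (o3 : 'I_(ncoor T)) j = bideg 0 1 j].
Proof. by rewrite /= /hirz_wt !inordK. Qed.

Lemma mhomog_o0 : @mhomog K T (bideg 1 0) 'X_o0.
Proof. by apply: mhomog_ext (@mhomogX K T o0) => j; case: (hirz_wtE j). Qed.
Lemma mhomog_o1 : @mhomog K T (bideg 1 0) 'X_o1.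
Proof. by apply: mhomog_ext (@mhomogX K T o1) => j; case: (hirz_wtE j). Qed.
Lemma mhomog_o2 : @mhomog K T (bideg m 1) 'X_o2.
Proof. by apply: mhomog_ext (@mhomogX K T o2) => j; case: (hirz_wtE j). Qed.
Lemma mhomog_o3 : @mhomog K T (bideg 0 1) 'X_o3.
Proof. by apply: mhomog_ext (@mhomogX K T o3) => j; case: (hirz_wtE j). Qed.

Lemma curve_homog : @mhomog K T (bideg (2 * m) 2) curve.
Proof.
apply: mhomogB; first by apply: (@mhomog_ext K T _ _ _ _ (mhomogXn (k := 2) mhomog_o2)) => -[[|[|]]].
by apply: (@mhomog_ext K T _ _ _ _ (mhomogM (mhomogXn (k := 2) mhomog_o3) P_homog)) => -[[|[|]]].
Qed.

(** On the curve w = 0 would force y = 0, which stability forbids; so the curve avoids the section w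
    = 0 and w may be normalized to 1. *)
Lemma locus_curve (v : pt K T) : X v <->
  [/\ (v o0 != 0) || (v o1 != 0), v o3 != 0 & v o2 ^+ 2 = v o3 ^+ 2 * P.@[v]].
Proof.
rewrite /locus curve_val; split=> [[/hirz_stable/andP[ab yw] /eqP]|[ab w0 E2]].
  rewrite subr_eq0 => /eqP E2; split=> //; apply: contraTneq yw => w0.
  by move/eqP: E2; rewrite w0 expr0n mul0r sqrf_eq0 => /eqP ->; rewrite eqxx.
by split; [apply/hirz_stable; rewrite ab w0 orbT | rewrite E2 subrr].
Qed.

(** As a quadratic in y the equation has discriminant 4 w^2 P, in which b occurs exactly once, so it
    is not a square. *)
Lemma curve_prime h1 h2 : (forall v, X v -> h1.@[v] * h2.@[v] = 0) ->
  (exists c, h1 = c * curve) \/ (exists c, h2 = c * curve).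
Proof.
move=> hv; have indepP1 : indep o2 (1 : {mpoly K[4]}).
  by rewrite -mpolyC1; apply: indepC.
have o_neq i : i != 2%N -> (i < 4)%N -> indep o2 ('X_(inord i) : {mpoly K[4]}).
  by move=> i2 i4; apply: indepXU; rewrite inord_eq.
have quadE : curve = 1 * 'X_o2 ^+ 2 + 0 * 'X_o2 + (- ('X_o3 ^+ 2 * P)).
  by rewrite /curve; ring.
pose e : {mpoly K[4]} := 4%:R * 'X_o3 ^+ 2 * E.
have DE : 0 ^+ 2 - 4%:R * 1 * (- ('X_o3 ^+ 2 * P)) = 'X_o1 * e.
  by rewrite /e PE; ring.
have e0 : subst o1 0 e != 0.
  rewrite !(substM, subst_exp) substXU ?inord_eq // !mulf_neq0 ?E_neq0 ?expf_neq0 ?mpolyXU_neq0 //.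
  by rewrite -mpolyC_nat substC mpolyC_eq0 pnatr_eq0.
have en0 : e != 0 by apply: contraNneq e0 => ->; rewrite /subst rmorph0.
have [] := @quad_prime K 4 o2 1 0 (- ('X_o3 ^+ 2 * P)) ('X_o0 * 'X_o3) _ _ _ _ _ _ _ _ h1 h2.
- exact: indepP1.
- by rewrite -mpolyC0; apply: indepC.
- by apply/indepN/indepM => //; apply/indepXn/o_neq.
- by apply: indepM; apply: o_neq.
- exact: oner_neq0.
- by rewrite DE mulf_neq0 ?mpolyXU_neq0.
- by rewrite mulf_neq0 ?mpolyXU_neq0.
- by move=> r s; rewrite DE; apply: square_descent.
- move=> v; rewrite -quadE => cv; rewrite mevalM !mevalXU mulf_eq0 negb_or => /andP[v0 v3].
  apply: hv; apply/locus_curve; split=> //; first by rewrite v0.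
  by apply/eqP; rewrite -subr_eq0 -curve_val cv.
- by move=> [k [c]]; rewrite expr1n mul1r -quadE => ->; left; exists c.
by move=> [k [c]]; rewrite expr1n mul1r -quadE => ->; right; exists c.
Qed.

Lemma curve_point x y : y ^+ 2 = P.@[vec4 1 x y 1] -> X (vec4 1 x y 1).
Proof.
move=> xy; apply/locus_curve; rewrite !vec4E oner_neq0; split=> //.
by rewrite expr1n mul1r.
Qed.

Lemma curve_point' x y : y ^+ 2 = P.@[vec4 x 1 y 1] -> X (vec4 x 1 y 1).
Proof.
move=> xy; apply/locus_curve; rewrite !vec4E oner_neq0 orbT; split=> //.
by rewrite expr1n mul1r.
Qed.

Lemma curve_irreducible : irreducible_divisor curve.
Proof.
apply: prime_irreducible_divisor curve_prime.
exists (vec4 1 0 0 1); apply: curve_point.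
by rewrite PE mevalM mevalXU vec4E mul0r expr0n.
Qed.

(** By primality every polynomial vanishing on the curve is a multiple of its equation, so the
    tangent space is cut out by a single differential. *)
Lemma tangent_curve (v h : pt K T) : X v -> tangent X v h <-> mdiff curve v h = 0.
Proof.
move=> Xv; split=> [th|dh d f hf fX].
  by apply: th curve_homog _ => v' [].
have [[c ->]|[c ->]] : (exists c, f = c * curve) \/ (exists c, f = c * curve).
  by apply: curve_prime => v' /fX ->; rewrite mul0r.
all: by case: Xv => _ cv; rewrite mdiffM dh cv !mulr0 addr0.
Qed.

Lemma curve_branch_point (v : pt K T) : X v -> v o2 = 0 ->
  P.@[v] = 0 /\ ((pa v != 0) || (pb v != 0)).
Proof.
move=> /locus_curve[ab w0 yE] y0.
have p0 : P.@[v] = 0.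
  move/esym/eqP: yE; rewrite y0 expr0n mulf_eq0 sqrf_eq0 (negPf w0).
  by move/eqP.
by split=> //; apply: P_sqfree.
Qed.

Lemma curve_smooth : smooth_proj_curve X.
Proof.
split; first exact: zclosed_locus curve_homog.
  by case: curve_irreducible.
move=> v Xv; have [ab w0 yE] := (locus_curve v).1 Xv.
pose l i := curve^`M(i).@[v].
have lE i : l i = mdiff curve v (fun j => (j == i)%:R).
  rewrite /mdiff (bigD1 i) //= big1 ?addr0 ?eqxx ?mulr1 // => j /negPf ->.
  by rewrite mulr0.
have [i li] : exists i, l i != 0.
  have two : 2%:R != 0 :> K by rewrite pnatr_eq0.
  have [y0|y0] := eqVneq (v o2) 0.
    have [_ /orP[a0|b0]] := curve_branch_point Xv y0; [exists o0|exists o1].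
      rewrite lE mdiff_curve !inord_eq //= !(mulr0, mulr1, mul0r, addr0, add0r, subr0, sub0r).
      by rewrite oppr_eq0 mulf_neq0 ?expf_neq0.
    rewrite lE mdiff_curve !inord_eq //= !(mulr0, mulr1, mul0r, addr0, add0r, subr0, sub0r).
    by rewrite oppr_eq0 mulf_neq0 ?expf_neq0.
  exists o2; rewrite lE mdiff_curve !inord_eq //= !(mulr0, mulr1, mul0r, addr0, add0r, subr0, sub0r).
  by rewrite mulf_neq0.
have [e [e1 e2 e3]] := has_dim_kernel li.
exists e; split=> [k|//|h /(tangent_curve _ Xv)/e3 //].
by apply/(tangent_curve _ Xv); apply: e1.
Qed.


(** Reduces an identity modulo three relations to a [ring] check with explicit cofactors. *)
Lemma lincomb3 (x y c1 c2 c3 d1 d2 d3 : K) : d1 = 0 -> d2 = 0 -> d3 = 0 ->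
  x - y = c1 * d1 + c2 * d2 + c3 * d3 -> x = y.
Proof.
move=> -> -> ->; rewrite !mulr0 !addr0 => /eqP.
by rewrite subr_eq0 => /eqP.
Qed.

(* The form [w (a db - b da) / y], of weight (2 - m, 0), and its continuation
   across the branch points [y = 0]. *)
Definition omega_spec (v h : pt K T) (t : K) := [/\
  t * v o2 = v o3 * (v o0 * h o1 - v o1 * h o0),
  t * (v o3 ^+ 2 * pb v) = 2%:R *
    (v o0 * v o3 * h o2 - v o0 * v o2 * h o3 - m%:R * v o3 * v o2 * h o0) &
  t * (v o3 ^+ 2 * pa v) = - (2%:R *
    (v o1 * v o3 * h o2 - v o1 * v o2 * h o3 - m%:R * v o3 * v o2 * h o1))].

(** The relations are the equation of the curve, Euler's identity and tangency. Where y <> 0 the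
    first condition determines t; where y = 0 one of the partial derivatives of P is nonzero, and t
    is read off from the second or third condition. *)
Lemma omega_exists v h : X v -> tangent X v h -> exists t, omega_spec v h t.
Proof.
move=> Xv; have [_ w0 /eqP] := (locus_curve v).1 Xv.
rewrite -subr_eq0 => /eqP D1 /(tangent_curve _ Xv); rewrite mdiff_curve => D3.
have /eqP := euler_P v; rewrite -subr_eq0 => /eqP D2.
have branch_pt := curve_branch_point Xv; rewrite /omega_spec.
move: D1 D2 D3 w0 branch_pt.
move: (v o0) (v o1) (v o2) (v o3) (h o0) (h o1) (h o2) (h o3) (pa v) (pb v) P.@[v].
move=> a b y w ha hb hy hw A B p; rewrite natrM.
set D1 := (X in X = 0 -> _) => D1E; set D2 := (X in X = 0 -> _) => D2E.
set D3 := (X in X = 0 -> _) => D3E w0 branch_pt.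
have [y0|y0] := eqVneq y 0; last first.
  exists (w * (a * hb - b * ha) / y); split; first by rewrite divfK.
    apply: (mulIf y0); rewrite mulrAC divfK //.
    (* [c1], [c2], [c3] are the cofactors of the equation of the curve, of Euler's identity and of
       tangency. *)
    apply: (lincomb3 D1E D2E D3E (c1 := 2%:R * a * hw + 2%:R * m%:R * w * ha)
      (c2 := - (w ^+ 3 * ha)) (c3 := - (w * a))).
    by rewrite /D1 /D2 /D3; ring.
  apply: (mulIf y0); rewrite mulrAC divfK //.
  apply: (lincomb3 D1E D2E D3E (c1 := - (2%:R * b * hw + 2%:R * m%:R * w * hb))
    (c2 := w ^+ 3 * hb) (c3 := w * b)).
  by rewrite /D1 /D2 /D3; ring.
have [p0 AB] := branch_pt y0; have w2 : w ^+ 2 != 0 by rewrite expf_neq0.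
have D2' : a * A + b * B = 0 by rewrite -D2E /D2 p0 mulr0 subr0.
have D3' : A * ha + B * hb = 0.
  by apply: (mulfI w2); rewrite mulr0 -oppr0 -D3E /D3 y0 p0; ring.
case/orP: AB => [A0|B0].
  exists (- (2%:R * b * hy) / (w * A)); rewrite y0; split.
  - rewrite mulr0; apply: (mulIf A0); rewrite mul0r.
    apply: (lincomb3 D2' D3' D3' (c1 := - (w * hb)) (c2 := w * b) (c3 := 0)).
    by ring.
  - have -> : - (2%:R * b * hy) / (w * A) * (w ^+ 2 * B) =
        - (2%:R * hy * w * (b * B)) / A by field; rewrite w0 A0.
    have -> : b * B = - (a * A) by apply/eqP; rewrite -addr_eq0 addrC D2'.
    by field; rewrite A0.
  - by field; rewrite w0 A0.
exists (2%:R * a * hy / (w * B)); rewrite y0; split.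
- rewrite mulr0; apply: (mulIf B0); rewrite mul0r.
  apply: (lincomb3 D2' D3' D3' (c1 := w * ha) (c2 := - (w * a)) (c3 := 0)).
  by ring.
- by field; rewrite w0 B0.
have -> : 2%:R * a * hy / (w * B) * (w ^+ 2 * A) =
    2%:R * hy * w * (a * A) / B by field; rewrite w0 B0.
have -> : a * A = - (b * B) by apply/eqP; rewrite -addr_eq0 D2'.
by field; rewrite B0.
Qed.

(** A choice by [xget]; on tangent pairs of the curve the value is unique, by [omega_eq]. *)
Definition omega v h : K := xget 0 [set t | omega_spec v h t]%classic.

Lemma omegaP v h : X v -> tangent X v h -> omega_spec v h (omega v h).
Proof. by move=> Xv tvh; apply: (xgetPex 0 (omega_exists Xv tvh)). Qed.

(** The monomial of degree m - 2 compensates the weight of [omega]. For k <= m - 2 and in the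
    coordinate lambda = b / a, this is the classical form lambda^k dlambda / y. *)
Definition form k (x : pt K T * pt K T) : K :=
  x.1 o0 ^+ (m - 2 - k) * x.1 o1 ^+ k * omega x.1 x.2.

Definition mono (i j k e : nat) : {mpoly K[ncoor T]} :=
  'X_o0 ^+ i * 'X_o1 ^+ j * 'X_o2 ^+ k * 'X_o3 ^+ e.

Lemma mhomog_mono c i j k e :
  @mhomog K T (bideg (i + j + k * m) (k + e)) (c%:MP * mono i j k e).
Proof.
have h := mhomogM (@mhomogC K T c) (mhomogM (mhomogM (mhomogM
  (mhomogXn (k := i) mhomog_o0) (mhomogXn (k := j) mhomog_o1))
  (mhomogXn (k := k) mhomog_o2)) (mhomogXn (k := e) mhomog_o3)).
by apply: (mhomog_ext _ h) => -[[|[|//]] ?]; rewrite /bideg /=; lia.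
Qed.

Lemma mhomog_pa : @mhomog K T (bideg (2 * m - 1) 0) P^`M(o0).
Proof.
apply: (mhomog_mderiv _ P_homog) => j; have [-> _ _ _] := hirz_wtE j.
by case: j => [[|[|//]] ?]; rewrite /bideg /=; lia.
Qed.

Lemma mhomog_pb : @mhomog K T (bideg (2 * m - 1) 0) P^`M(o1).
Proof.
apply: (mhomog_mderiv _ P_homog) => j; have [_ -> _ _] := hirz_wtE j.
by case: j => [[|[|//]] ?]; rewrite /bideg /=; lia.
Qed.

(** Each point gets a single term p dq. Where y <> 0, q is b/a or a/b; at a branch point it is the
    local parameter y / (a^m w) or y / (b^m w), with P_b or P_a as denominator of p. *)
Lemma form_regular k : (k < m - 1)%N -> regular_form X (form k).
Proof.
move=> km; apply: regular_form1 => v Xv.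
have [ab w0 yE] := (locus_curve v).1 Xv.
have mhE a b a' b' f : @mhomog K T (bideg a b) f -> a = a' -> b = b' ->
    @mhomog K T (bideg a' b') f by move=> h <- <-.
pose e := (m - 2 - k)%N.
have [y0|y0] := eqVneq (v o2) 0; last first.
  have [a0|a0] := eqVneq (v o0) 0; last first.
    (* From a db - b da = a^2 d(b/a), whence the two extra powers of a. *)
    exists (1%:MP * mono (e + 2) k 0 1, 'X_o2), ('X_o1, 'X_o0).
    split; rewrite /= ?mevalXU //.
    - exists (bideg m 1); split; last exact: mhomog_o2.
      by apply: (mhE _ _ _ _ _ (@mhomog_mono _ _ _ _ _)); lia.
    - by exists (bideg 1 0); split; [exact: mhomog_o1 | exact: mhomog_o0].
    move=> v' h [Xv' tvh]; rewrite !mevalXU => y0' a0'.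
    have [E1 _ _] := omegaP Xv' tvh.
    rewrite /form /rval /rdiff /= /mono !mdiffX !mevalS /= -/e.
    have -> : omega v' h = v' o3 * (v' o0 * h o1 - v' o1 * h o0) / v' o2.
      by rewrite -E1 mulfK.
    by rewrite exprD; field; rewrite y0' a0'.
  have b0 : v o1 != 0 by move: ab; rewrite a0 eqxx.
  exists ((-1)%:MP * mono e (k + 2) 0 1, 'X_o2), ('X_o0, 'X_o1).
  split; rewrite /= ?mevalXU //.
  - exists (bideg m 1); split; last exact: mhomog_o2.
    by apply: (mhE _ _ _ _ _ (@mhomog_mono _ _ _ _ _)); lia.
  - by exists (bideg 1 0); split; [exact: mhomog_o0 | exact: mhomog_o1].
  move=> v' h [Xv' tvh]; rewrite !mevalXU => y0' b0'.
  have [E1 _ _] := omegaP Xv' tvh.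
  rewrite /form /rval /rdiff /= /mono !mdiffX !mevalS /= -/e.
  have -> : omega v' h = v' o3 * (v' o0 * h o1 - v' o1 * h o0) / v' o2.
    by rewrite -E1 mulfK.
  by rewrite exprD; field; rewrite y0' b0'.
have [p0 AB] := curve_branch_point Xv y0.
have eu := euler_P v; rewrite p0 mulr0 in eu.
have mE : m = (m - 1).+1 by lia.
have [a0|a0] := eqVneq (v o0) 0; last first.
  have pb0 : pb v != 0.
    apply: contraTneq AB => pb0; rewrite pb0 eqxx orbF negbK.
    by move/eqP: eu; rewrite pb0 mulr0 addr0 mulf_eq0 (negPf a0).
  (* The second condition on [omega] reads omega = (2 a^(m+1) / P_b) d(y / (a^m w)); the exponent is
     e + m + 1, written with m - 1 so that a^m can be expanded later. *)
  exists (2%:R%:MP * mono (e + (m - 1) + 2) k 0 0, P^`M(o1)),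
    ('X_o2, 1%:MP * mono m 0 0 1).
  split; rewrite /= ?mevalXU //.
  - exists (bideg (2 * m - 1) 0); split; last exact: mhomog_pb.
    by apply: (mhE _ _ _ _ _ (@mhomog_mono _ _ _ _ _)); lia.
  - exists (bideg m 1); split; first exact: mhomog_o2.
    by apply: (mhE _ _ _ _ _ (@mhomog_mono _ _ _ _ _)); lia.
  - by rewrite /mono !mevalS !expr0 !mulr1 mul1r mulf_neq0 ?expf_neq0.
  move=> v' h [Xv' tvh] pb0'; rewrite /mono !mevalS => aw0.
  have [_ w0' _] := (locus_curve v').1 Xv'.
  have a0' : v' o0 != 0.
    by apply: contraNneq aw0 => ->; rewrite mE exprS !(mul0r, mulr0).
  have [_ E2 _] := omegaP Xv' tvh.
  rewrite /form /rval /rdiff /= /mono !(mdiffM, mdiffC, mdiffXn, mdiffX) !mevalS /= -/e.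
  have -> : omega v' h = 2%:R * (v' o0 * v' o3 * h o2 - v' o0 * v' o2 * h o3 -
      m%:R * v' o3 * v' o2 * h o0) / (v' o3 ^+ 2 * pb v').
    by rewrite -E2 mulfK // mulf_neq0 ?expf_neq0.
  have -> : m.-1 = (m - 1)%N by lia.
  have -> : v' o0 ^+ m = v' o0 * v' o0 ^+ (m - 1) by rewrite -exprS -mE.
  have c0 : v' o0 ^+ (m - 1) != 0 by rewrite expf_neq0.
  rewrite !exprD; move: c0; set c := v' o0 ^+ (m - 1) => c0.
  by field; rewrite pb0' w0' a0' c0.
have b0 : v o1 != 0 by move: ab; rewrite a0 eqxx.
have pa0 : pa v != 0.
  apply: contraTneq AB => pa0; rewrite pa0 eqxx negbK.
  by move/eqP: eu; rewrite pa0 mulr0 add0r mulf_eq0 (negPf b0).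
exists ((- 2%:R)%:MP * mono e (k + (m - 1) + 2) 0 0, P^`M(o0)),
  ('X_o2, 1%:MP * mono 0 m 0 1).
split; rewrite /= ?mevalXU //.
- exists (bideg (2 * m - 1) 0); split; last exact: mhomog_pa.
  by apply: (mhE _ _ _ _ _ (@mhomog_mono _ _ _ _ _)); lia.
- exists (bideg m 1); split; first exact: mhomog_o2.
  by apply: (mhE _ _ _ _ _ (@mhomog_mono _ _ _ _ _)); lia.
- by rewrite /mono !mevalS !expr0 !mulr1 !mul1r mulf_neq0 ?expf_neq0.
move=> v' h [Xv' tvh] pa0'; rewrite /mono !mevalS => bw0.
have [_ w0' _] := (locus_curve v').1 Xv'.
have b0' : v' o1 != 0.
  by apply: contraNneq bw0 => ->; rewrite mE exprS !(mul0r, mulr0).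
have [_ _ E3] := omegaP Xv' tvh.
rewrite /form /rval /rdiff /= /mono !(mdiffM, mdiffC, mdiffXn, mdiffX) !mevalS /= -/e.
have -> : omega v' h = - (2%:R * (v' o1 * v' o3 * h o2 - v' o1 * v' o2 * h o3 -
    m%:R * v' o3 * v' o2 * h o1)) / (v' o3 ^+ 2 * pa v').
  by rewrite -E3 mulfK // mulf_neq0 ?expf_neq0.
have -> : m.-1 = (m - 1)%N by lia.
have -> : v' o1 ^+ m = v' o1 * v' o1 ^+ (m - 1) by rewrite -exprS -mE.
have c0 : v' o1 ^+ (m - 1) != 0 by rewrite expf_neq0.
rewrite !exprD; move: c0; set c := v' o1 ^+ (m - 1) => c0.
by field; rewrite pa0' w0' b0' c0.
Qed.


Hypothesis P_inf : exists u, P.@[vec4 u 1 0 0] = 0.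

(** The coefficients of t in the three conditions have no common zero on the curve, by
    smoothness. *)
Lemma omega_eq v h t : X v -> tangent X v h -> omega_spec v h t -> omega v h = t.
Proof.
move=> Xv tvh [E1 E2 E3]; have [F1 F2 F3] := omegaP Xv tvh.
have [_ w0 _] := (locus_curve v).1 Xv.
have [y0|y0] := eqVneq (v o2) 0; last by apply: (mulIf y0); rewrite E1 F1.
have [_ /orP[a0|b0]] := curve_branch_point Xv y0.
  by apply: (@mulIf _ (v o3 ^+ 2 * pa v)); rewrite ?mulf_neq0 ?expf_neq0 // E3 F3.
by apply: (@mulIf _ (v o3 ^+ 2 * pb v)); rewrite ?mulf_neq0 ?expf_neq0 // E2 F2.
Qed.

(* The charts a = w = 1 and b = w = 1, each with a tangent field normalized by
   [omega = 2]; see [chart1] and [chart2]. *)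
Definition V1 (x y : K) : pt K T := vec4 1 x y 1.
Definition H1 (x y : K) : pt K T := vec4 0 (2%:R * y) (pb (V1 x y)) 0.
Definition V2 (x y : K) : pt K T := vec4 x 1 y 1.
Definition H2 (x y : K) : pt K T := vec4 (- (2%:R * y)) 0 (- pa (V2 x y)) 0.

Lemma chart1 x y : y ^+ 2 = P.@[V1 x y] ->
  tangent_pairs X (V1 x y, H1 x y) /\ omega (V1 x y) (H1 x y) = 2%:R.
Proof.
move=> xy; have Xv := curve_point xy; have eu := euler_P (V1 x y).
rewrite /V1 !vec4E -/(V1 x y) -xy in eu.
have tvh : tangent X (V1 x y) (H1 x y).
  by apply/(tangent_curve _ Xv); rewrite mdiff_curve /H1 !vec4E; ring.
split=> //; apply: omega_eq => //; rewrite /omega_spec /H1 /V1 !vec4E -/(V1 x y).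
have -> : pa (V1 x y) = (2 * m)%:R * y ^+ 2 - x * pb (V1 x y) by rewrite -eu; ring.
by rewrite natrM; split; ring.
Qed.

Lemma chart2 x y : y ^+ 2 = P.@[V2 x y] ->
  tangent_pairs X (V2 x y, H2 x y) /\ omega (V2 x y) (H2 x y) = 2%:R.
Proof.
move=> xy; have Xv := curve_point' xy; have eu := euler_P (V2 x y).
rewrite /V2 !vec4E -/(V2 x y) -xy in eu.
have tvh : tangent X (V2 x y) (H2 x y).
  by apply/(tangent_curve _ Xv); rewrite mdiff_curve /H2 !vec4E; ring.
split=> //; apply: omega_eq => //; rewrite /omega_spec /H2 /V2 !vec4E -/(V2 x y).
have -> : pb (V2 x y) = (2 * m)%:R * y ^+ 2 - x * pa (V2 x y) by rewrite -eu; ring.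
by rewrite natrM; split; ring.
Qed.

Definition torus (t0 t1 : K) : 'I_2 -> K := fun j => nth 1 [:: t0; t1] j.

Lemma prod_torus t0 t1 a b : \prod_j torus t0 t1 j ^+ bideg a b j = t0 ^+ a * t1 ^+ b.
Proof. by rewrite !big_ord_recl big_ord0 mulr1. Qed.

Lemma torus_neq0 t0 t1 : t0 != 0 -> t1 != 0 -> forall j, torus t0 t1 j != 0.
Proof. by move=> h0 h1 [[|[|//]] ?]. Qed.

Lemma act_torus t0 t1 a b y w : @act K T (torus t0 t1) (vec4 a b y w) =
  vec4 (t0 * a) (t0 * b) (t0 ^+ m * t1 * y) (t1 * w).
Proof.
have wE := hirz_wtE; apply/funext => i; rewrite /act.
case: (ord4P i) => ->; rewrite vec4E.
- rewrite (eq_bigr (fun j => torus t0 t1 j ^+ bideg 1 0 j)) ?prod_torus ?vec4E.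
    by rewrite expr0 expr1 mulr1.
  by move=> j _; case: (wE j) => ->.
- rewrite (eq_bigr (fun j => torus t0 t1 j ^+ bideg 1 0 j)) ?prod_torus ?vec4E.
    by rewrite expr0 expr1 mulr1.
  by move=> j _; case: (wE j) => _ ->.
- rewrite (eq_bigr (fun j => torus t0 t1 j ^+ bideg m 1 j)) ?prod_torus ?vec4E //.
  by move=> j _; case: (wE j) => _ _ ->.
rewrite (eq_bigr (fun j => torus t0 t1 j ^+ bideg 0 1 j)) ?prod_torus ?vec4E.
  by rewrite expr0 expr1 mul1r.
by move=> j _; case: (wE j) => _ _ _ ->.
Qed.

Lemma radials_vec4 (rho : 'I_2 -> K) a b y w i :
  \sum_j rho j * @radial K T j (vec4 a b y w) i =
  vec4 (rho ord0 * a) (rho ord0 * b)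
    (rho ord0 * m%:R * y + rho (lift ord0 ord0) * y) (rho (lift ord0 ord0) * w) i.
Proof.
rewrite !big_ord_recl big_ord0 addr0 /radial /=.
case: (ord4P i) => ->; rewrite !vec4E /hirz_wt ?inordK //=; ring.
Qed.

Lemma curve_act t0 t1 v : t0 != 0 -> t1 != 0 -> X v -> X (@act K T (torus t0 t1) v).
Proof.
move=> h0 h1 /locus_curve[ab w0 yE]; apply/locus_curve.
rewrite (meval_act _ _ P_homog) prod_torus (vec4_eta v) act_torus !vec4E -vec4_eta.
rewrite !mulf_eq0 (negPf h0) (negPf h1) /=; split=> //.
by rewrite !exprMn yE expr0 -exprM mulnC; ring.
Qed.

Lemma tangent_act t0 t1 v h : t0 != 0 -> t1 != 0 -> X v -> tangent X v h ->
  tangent X (@act K T (torus t0 t1) v) (@act K T (torus t0 t1) h).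
Proof.
move=> h0 h1 Xv /(tangent_curve _ Xv) th.
by apply/(tangent_curve _ (curve_act h0 h1 Xv)); rewrite (mdiff_act _ _ _ curve_homog) th mulr0.
Qed.

(** Subtracting orbit directions makes the a and w components zero. Tangency then reads 2 y h2 = P_b
    h1, and since 2 y and P_b do not vanish together, (h1, h2) is a multiple of (2 y, P_b). *)
Lemma tangent_chart1 x y h : y ^+ 2 = P.@[V1 x y] -> tangent X (V1 x y) h ->
  exists alpha (rho : 'I_2 -> K), forall i, h i = alpha * H1 x y i +
    \sum_j rho j * @radial K T j (V1 x y) i.
Proof.
move=> xy; have Xv := curve_point xy; move=> /(tangent_curve _ Xv).
rewrite mdiff_curve /V1 !vec4E -/(V1 x y) -xy => D.
have eu := euler_P (V1 x y); rewrite /V1 !vec4E -/(V1 x y) -xy natrM in eu.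
pose h1 := h o1 - h o0 * x; pose h2 := h o2 - h o0 * m%:R * y - h o3 * y.
have two : 2%:R != 0 :> K by rewrite pnatr_eq0.
have D' : 2%:R * y * h2 = pb (V1 x y) * h1.
  apply/eqP; rewrite -subr_eq0 -[X in _ == X]D /h1 /h2.
  have -> : pa (V1 x y) = 2%:R * m%:R * y ^+ 2 - x * pb (V1 x y) by rewrite -eu; ring.
  by apply/eqP; ring.
suff [alpha [E1 E2]] : exists alpha, h1 = alpha * (2%:R * y) /\ h2 = alpha * pb (V1 x y).
  exists alpha, (torus (h o0) (h o3)) => i; rewrite radials_vec4 /H1 /torus /=.
  case: (ord4P i) => ->; rewrite !vec4E.
  - by ring.
  - by rewrite -E1 /h1; ring.
  - by rewrite -E2 /h2; ring.
  - by ring.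
have [y0|y0] := eqVneq y 0; last first.
  by exists (h1 / (2%:R * y)); split; [field; rewrite y0
    | apply: (@mulfI _ (2%:R * y)); rewrite ?mulf_neq0 // D'; field; rewrite y0].
have pab : (pa (V1 x y) != 0) || (pb (V1 x y) != 0).
  by have [] := curve_branch_point Xv (etrans (vec4_2 _ _ _ _) y0).
have pb0 : pb (V1 x y) != 0.
  case/orP: pab => [|//]; apply: contra_neq => pb0.
  by move: eu; rewrite pb0 y0 expr0n !mulr0 addr0 mul1r -y0.
have y2 : 2%:R * y = 0 by rewrite y0 mulr0.
exists (h2 / pb (V1 x y)); rewrite y2 mulr0 divfK //; split=> //.
by move/esym/eqP: D'; rewrite y2 mul0r mulf_eq0 (negPf pb0) => /eqP.
Qed.

Lemma tangent_chart2 x y h : y ^+ 2 = P.@[V2 x y] -> tangent X (V2 x y) h ->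
  exists alpha (rho : 'I_2 -> K), forall i, h i = alpha * H2 x y i +
    \sum_j rho j * @radial K T j (V2 x y) i.
Proof.
move=> xy; have Xv := curve_point' xy; move=> /(tangent_curve _ Xv).
rewrite mdiff_curve /V2 !vec4E -/(V2 x y) -xy => D.
have eu := euler_P (V2 x y); rewrite /V2 !vec4E -/(V2 x y) -xy natrM in eu.
pose h1 := h o0 - h o1 * x; pose h2 := h o2 - h o1 * m%:R * y - h o3 * y.
have two : 2%:R != 0 :> K by rewrite pnatr_eq0.
have D' : 2%:R * y * h2 = pa (V2 x y) * h1.
  apply/eqP; rewrite -subr_eq0 -[X in _ == X]D /h1 /h2.
  have -> : pb (V2 x y) = 2%:R * m%:R * y ^+ 2 - x * pa (V2 x y) by rewrite -eu; ring.
  by apply/eqP; ring.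
suff [alpha [E1 E2]] : exists alpha,
    h1 = alpha * - (2%:R * y) /\ h2 = alpha * - pa (V2 x y).
  exists alpha, (torus (h o1) (h o3)) => i; rewrite radials_vec4 /H2 /torus /=.
  case: (ord4P i) => ->; rewrite !vec4E.
  - by rewrite -E1 /h1; ring.
  - by ring.
  - by rewrite -E2 /h2; ring.
  - by ring.
have [y0|y0] := eqVneq y 0; last first.
  by exists (- h1 / (2%:R * y)); split; [field; rewrite y0
    | apply: (@mulfI _ (2%:R * y)); rewrite ?mulf_neq0 // D'; field; rewrite y0].
have pab : (pa (V2 x y) != 0) || (pb (V2 x y) != 0).
  by have [] := curve_branch_point Xv (etrans (vec4_2 _ _ _ _) y0).
have pa0 : pa (V2 x y) != 0.
  case/orP: pab => [//|]; apply: contra_neq => pa0.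
  by move: eu; rewrite pa0 y0 expr0n !mulr0 add0r mul1r -y0.
have y2 : 2%:R * y = 0 by rewrite y0 mulr0.
exists (- h2 / pa (V2 x y)); rewrite y2 oppr0 mulr0 mulrN divfK // opprK.
by split=> //; move/esym/eqP: D'; rewrite y2 mul0r mulf_eq0 (negPf pa0) => /eqP.
Qed.

Lemma P_vec4 a b y w : P.@[vec4 a b y w] = P.@[vec4 a b 0 0].
Proof.
have <- : upd (upd (vec4 a b 0 0) o2 y) o3 w = vec4 a b y w.
  by rewrite [LHS]vec4_eta /upd !inord_eq //= !vec4E.
by rewrite P_w P_y.
Qed.

Lemma P_neq0 : P != 0.
Proof.
rewrite PE mulf_neq0 ?mpolyXU_neq0 //.
by apply: contraNneq E_neq0 => ->; rewrite /subst rmorph0.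
Qed.

Lemma P_torus t0 t1 a b y w : P.@[vec4 (t0 * a) (t0 * b) (t0 ^+ m * t1 * y) (t1 * w)]
  = t0 ^+ (2 * m) * P.@[vec4 a b y w].
Proof.
by rewrite -act_torus (meval_act _ _ P_homog) prod_torus expr0 mulr1.
Qed.

(** The root 0, which exists because b divides P, is the branch point required by [regular_nf] in
    this chart. *)
Lemma chart_poly1 : exists Q : {poly K},
  [/\ Q != 0, Q.[0] = 0 & forall x y w, Q.[x] = P.@[vec4 1 x y w]].
Proof.
have [Q HQ] := line_poly P (vec4 1 0 0 0) (vec4 0 1 0 0).
have QE x y w : Q.[x] = P.@[vec4 1 x y w].
  have [-> _] := HQ x; rewrite [RHS]P_vec4; apply: meval_eq => i.
  by case: (ord4P i) => ->; rewrite !vec4E; ring.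
exists Q; split=> //; last by rewrite (QE 0 0 0) PE mevalM mevalXU vec4E mul0r.
have [v] : exists v, ('X_o0 * P).@[v] != 0.
  by apply: mpoly_neq0P; rewrite mulf_neq0 ?mpolyXU_neq0 ?P_neq0.
rewrite mevalM mevalXU mulf_eq0 negb_or (vec4_eta v) vec4E => /andP[a0].
apply: contraNneq => Q0.
have := P_torus (v o0) 1 1 (v o1 / v o0) 0 0; rewrite -QE Q0 horner0 !mulr0.
by rewrite mulr1 [_ * (_ / _)]mulrC divfK // => E0; rewrite P_vec4 E0.
Qed.

(** Here the required branch point is supplied by [P_inf]. *)
Lemma chart_poly2 : exists (Q : {poly K}) u,
  [/\ Q != 0, Q.[u] = 0 & forall x y w, Q.[x] = P.@[vec4 x 1 y w]].
Proof.
have [u Pu] := P_inf.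
have [Q HQ] := line_poly P (vec4 0 1 0 0) (vec4 1 0 0 0).
have QE x y w : Q.[x] = P.@[vec4 x 1 y w].
  have [-> _] := HQ x; rewrite [RHS]P_vec4; apply: meval_eq => i.
  by case: (ord4P i) => ->; rewrite !vec4E; ring.
exists Q, u; split=> //; last by rewrite (QE _ 0 0) Pu.
have [v] : exists v, ('X_o1 * P).@[v] != 0.
  by apply: mpoly_neq0P; rewrite mulf_neq0 ?mpolyXU_neq0 ?P_neq0.
rewrite mevalM mevalXU mulf_eq0 negb_or (vec4_eta v) vec4E => /andP[b0].
apply: contraNneq => Q0.
have := P_torus (v o1) 1 (v o0 / v o1) 1 0 0; rewrite -QE Q0 horner0 !mulr0.
by rewrite mulr1 [_ * (_ / _)]mulrC divfK // => E0; rewrite P_vec4 E0.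
Qed.

Lemma V1_act x y : x != 0 ->
  @act K T (torus x^-1 1) (V1 x y) = V2 x^-1 (y / x ^+ m).
Proof.
by move=> x0; rewrite /V1 act_torus !mulr1 mulVf // exprVn [_ * y]mulrC.
Qed.

Section RegularForm.
Variable om : pt K T * pt K T -> K.
Hypothesis om_reg : regular_form X om.

(** Both tangent fields have [omega] equal to 2, and [omega] has weight 2 - m; passing between the
    charts with the torus element (1/x, 1) therefore costs the factor x^(m-2). *)
Lemma chart_relation x y : x != 0 -> y ^+ 2 = P.@[V1 x y] ->
  let x' := x^-1 in let y' := y / x ^+ m in
  y' ^+ 2 = P.@[V2 x' y'] /\
  om (V1 x y, H1 x y) = x ^+ (m - 2) * om (V2 x' y', H2 x' y').
Proof.
move=> x0 xy x' y'; have [[Xv tvh] _] := chart1 xy.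
have V1E := V1_act y x0.
have t0 : forall j, torus x^-1 1 j != 0 by apply: torus_neq0; rewrite ?invr_eq0 ?oner_neq0.
have Xv' : X (V2 x' y') by rewrite -V1E; apply: curve_act; rewrite ?invr_eq0 ?oner_neq0.
have xy' : y' ^+ 2 = P.@[V2 x' y'].
  have [_ _] := (locus_curve _).1 Xv'.
  by rewrite /V2 !vec4E expr1n mul1r.
split=> //; have [[_ tvh'] _] := chart2 xy'.
rewrite -V1E in Xv' tvh' *.
(* The transported first field has no a component while [H2] has one; the orbit direction with
   coefficient 2 y / x cancels it. *)
apply: (@regular_transport K T X om om_reg _ _ _ _ _ (torus (2%:R * y / x) 0)) => //.
move=> i; rewrite V1E /H1 act_torus /V2 radials_vec4 /H2 -/(V2 x' y') /torus /=.
have mE : m = (m - 2).+2 by lia.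
have m2E : (2 * m - 1 = (m - 2) + (m - 2) + 3)%N by lia.
have c0 : x ^+ (m - 2) != 0 by rewrite expf_neq0.
have xm : x ^+ m = x ^+ (m - 2) * x * x by rewrite {1}mE !exprSr.
have paE : pa (V2 x' y') = (x ^+ (m - 2) * x ^+ (m - 2) * x ^+ 3)^-1 *
    (2%:R * m%:R * y ^+ 2 - x * pb (V1 x y)).
  rewrite -V1E (meval_act _ _ mhomog_pa) prod_torus expr0 mulr1 exprVn m2E !exprD.
  congr (_ * _); have := euler_P (V1 x y).
  by rewrite /V1 !vec4E -/(V1 x y) -xy natrM => <-; ring.
rewrite paE /x' /y' exprVn xm; move: c0; set c := x ^+ (m - 2) => c0.
by case: (ord4P i) => ->; rewrite !vec4E; field; rewrite ?x0 ?c0.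
Qed.

(** In both charts the form has a normal form, r1 + s1 y and r2 + s2 y'. The gluing gives r1(x) =
    x^(m-2) r2(1/x) and s1(x) = x^(-2) s2(1/x); the second forces s1 = s2 = 0, the first bounds the
    degree of r1 by m - 2. *)
Lemma regular_form_chart : exists r : {poly K}, [/\ (size r <= m - 1)%N,
  forall x y, y ^+ 2 = P.@[V1 x y] -> om (V1 x y, H1 x y) = r.[x] &
  forall x y, y ^+ 2 = P.@[V2 x y] -> om (V2 x y, H2 x y) =
    \sum_(k < m - 1) r`_k * x ^+ (m - 2 - k)].
Proof.
have [Q1 [Q10 Q1root Q1E]] := chart_poly1.
have [Q2 [u [Q20 Q2root Q2E]]] := chart_poly2.
have nf_vec4 Q (A B Y W : K -> K -> K) i : nf Q A -> nf Q B -> nf Q Y -> nf Q W ->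
    nf Q (fun x y => vec4 (A x y) (B x y) (Y x y) (W x y) i).
  have swap (f g : K -> K -> K) : (forall x y, f x y = g x y) -> nf Q g -> nf Q f.
    by move=> fg [r [s E']]; exists r, s => x y xy; rewrite fg E'.
  by move=> hA hB hY hW; case: (ord4P i) => ->;
    [apply: swap hA|apply: swap hB|apply: swap hY|apply: swap hW] => x y;
    rewrite vec4E.
have nfc Q c := @nf_const K Q c; have nfx Q := @nf_x K Q; have nfy Q := @nf_y K Q.
have nfV1 i : nf Q1 (fun x y => V1 x y i) by apply: nf_vec4.
have nfV2 i : nf Q2 (fun x y => V2 x y i) by apply: nf_vec4.
have [r1 [s1 om1]] : nf Q1 (fun x y => om (V1 x y, H1 x y)).
  apply: (regular_nf om_reg Q10 Q1root nfV1) => [i|x y].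
    by apply: nf_vec4 => //; [apply: nfM | apply: nf_meval].
  by rewrite (Q1E x y 1) => /chart1[].
have [r2 [s2 om2]] : nf Q2 (fun x y => om (V2 x y, H2 x y)).
  apply: (regular_nf om_reg Q20 Q2root nfV2) => [i|x y].
    by apply: nf_vec4 => //; [apply/nfN/nfM | apply/nfN/nf_meval].
  by rewrite (Q2E x y 1) => /chart2[].
have [M rM sM] : exists2 M, (size r2 <= M)%N & (size s2 <= M)%N.
  by exists (size r2 + size s2)%N; rewrite ?leq_addr ?leq_addl.
(* Reversal: [rv p] is x^M p(1/x), with [M] large enough for both r2 and s2. *)
pose rv (p : {poly K}) := \poly_(i < M.+1) p`_(M - i).
have rvE (p : {poly K}) x : (size p <= M)%N -> x != 0 ->
    (rv p).[x] = x ^+ M * p.[x^-1].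
  move=> pM x0; rewrite /rv horner_poly (horner_coef_wide _ (leqW pM)) mulr_sumr.
  rewrite (reindex_inj rev_ord_inj); apply: eq_bigr => i _ /=.
  have iM : (i <= M)%N by rewrite -ltnS.
  have xM : x ^+ M = x ^+ (M - i) * x ^+ i by rewrite -exprD subnK.
  rewrite subSS subKn // exprVn xM.
  by field; rewrite expf_neq0.
(* The factor x^(M+2) would already clear the denominators; one more power of x makes both sides
   vanish at x = 0, where the gluing says nothing. *)
have [rE sE] : 'X^(M.+3) * r1 - 'X^(m.+1) * rv r2 = 0 /\
    'X^(M.+3) * s1 - 'X * rv s2 = 0.
  apply: (nf_separate Q10) => x y xy; have [->|x0] := eqVneq x 0.
    by rewrite !hornerE /= !expr0n /= !mul0r subrr mul0r addr0.
  have xyP : y ^+ 2 = P.@[V1 x y] by rewrite xy (Q1E x y 1).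
  have [xy' omE] := chart_relation x0 xyP; rewrite -(Q2E _ _ 1) in xy'.
  rewrite om1 // om2 // in omE.
  rewrite !hornerE !rvE //.
  transitivity (x ^+ M.+3 * (r1.[x] + s1.[x] * y)
    - (x ^+ m.+1 * (x ^+ M * r2.[x^-1]) + x * (x ^+ M * s2.[x^-1]) * y)); first by ring.
  rewrite omE; have mE : m = (m - 2).+2 by lia.
  have c0 : x ^+ (m - 2) != 0 by rewrite expf_neq0.
  have xm : x ^+ m = x ^+ (m - 2) * x * x by rewrite {1}mE !exprSr.
  rewrite [x ^+ m.+1]exprS !xm !exprS; move: c0; set c := x ^+ (m - 2) => c0.
  by field; rewrite x0 c0.
have X0 k : 'X^k != 0 :> {poly K} by rewrite expf_neq0 ?polyX_eq0.
(* For s1 <> 0 the left-hand side has size at least M + 4, the right-hand side at most M + 2. *)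
have s10 : s1 = 0.
  have [//|s10] := eqVneq s1 0; exfalso.
  have : size ('X^(M.+3) * s1) = size ('X * rv s2).
    by move/eqP: sE; rewrite subr_eq0 => /eqP ->.
  rewrite size_mul // size_polyXn /= => sz.
  have rvs0 : rv s2 != 0.
    by apply/eqP => rv0; move: sz; rewrite rv0 mulr0 size_poly0.
  have : (size (rv s2) <= M.+1)%N by apply: size_poly.
  have := s10; rewrite -size_poly_gt0; move: sz.
  rewrite size_mul ?polyX_eq0 // size_polyX add2n [_.+2.-1]/=.
  by move: (size s1) (size (rv s2)) => a b; clear; lia.
have s20 : s2 = 0.
  move: sE; rewrite s10 mulr0 sub0r => /eqP; rewrite oppr_eq0 mulf_eq0 polyX_eq0.
  move=> /eqP rv0; apply/polyP => j; rewrite coef0.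
  have [jM|Mj] := ltnP M j; first by rewrite nth_default // (leq_trans sM) // ltnW.
  by have := congr1 (fun p : {poly K} => p`_(M - j)) rv0;
    rewrite /= coef_poly coef0 ltnS leq_subr subKn.
move/eqP: rE; rewrite subr_eq0 => /eqP rE.
have r1m : (size r1 <= m - 1)%N.
  have [->|r10] := eqVneq r1 0; first by rewrite size_poly0.
  have : size ('X^(M.+3) * r1) = size ('X^(m.+1) * rv r2) by rewrite rE.
  rewrite size_mul // size_polyXn [(M.+4 + _).-1]/= => sz.
  have rvr0 : rv r2 != 0.
    by apply/eqP => rv0; move: sz; rewrite rv0 mulr0 size_poly0.
  have : (size (rv r2) <= M.+1)%N by apply: size_poly.
  move: sz; rewrite size_mul // size_polyXn [(m.+2 + _).-1]/=.
  by move: (size r1) (size (rv r2)) => a b; clear -m_gt1; lia.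
have r2E : r2 = \sum_(k < m - 1) r1`_k *: 'X^(m - 2 - k).
  apply/eqP; rewrite -subr_eq0; apply/eqP; apply: (@poly_vanish _ _ 'X).
    by rewrite polyX_eq0.
  move=> x; rewrite hornerX => x0; have xi0 : x^-1 != 0 by rewrite invr_eq0.
  rewrite hornerD hornerN horner_sum; apply/eqP; rewrite subr_eq0; apply/eqP.
  have := congr1 (horner^~ x^-1) rE; rewrite /= !(hornerXn, hornerM) rvE // invrK => rxE.
  rewrite (horner_coef_wide _ r1m) in rxE.
  have r2x : r2.[x] = x ^+ (m - 2) * \sum_(i < m - 1) r1`_i * x^-1 ^+ i.
    have mE : (m.+1 = (m - 2) + 3)%N by lia.
    apply: (@mulfI _ (x^-1 ^+ M.+3 * x^-1 ^+ (m - 2))).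
      by rewrite mulf_neq0 ?expf_neq0.
    transitivity (x^-1 ^+ m.+1 * (x^-1 ^+ M * r2.[x])).
      by rewrite mE exprD !exprS; ring.
    rewrite -rxE; set S := \sum_(i < _) _.
    have xx : x^-1 ^+ (m - 2) * x ^+ (m - 2) = 1 by rewrite -exprMn mulVf // expr1n.
    transitivity (x^-1 ^+ (m - 2) * x ^+ (m - 2) * (x^-1 ^+ M.+3 * S)).
      by rewrite xx mul1r.
    by move: (x ^+ (m - 2)) (x^-1 ^+ (m - 2)) (x^-1 ^+ M.+3) => e1 e2 e3; ring.
  rewrite r2x mulr_sumr; apply: eq_bigr => i _.
  rewrite hornerZ hornerXn exprVn mulrCA; congr (_ * _).
  by rewrite -expfB_cond ?(negPf x0) //=; have := ltn_ord i; lia.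
exists r1; split=> // [x y xy|x y xy].
  by rewrite om1 ?s10 ?horner0 ?mul0r ?addr0 // (Q1E x y 1).
rewrite om2 ?s20 ?horner0 ?mul0r ?addr0 // ?(Q2E x y 1) // r2E horner_sum.
by apply: eq_bigr => k _; rewrite hornerZ hornerXn.
Qed.

End RegularForm.

(** The factor alpha is found before the form is given, so a linear relation between regular forms
    on the chart extends to all tangent vectors with a <> 0. *)
Lemma to_chart1 v h : X v -> tangent X v h -> v o0 != 0 ->
  exists x y alpha, y ^+ 2 = P.@[V1 x y] /\ forall om, regular_form X om ->
    om (v, h) = alpha * om (V1 x y, H1 x y).
Proof.
move=> Xv tvh a0; have [_ w0 _] := (locus_curve v).1 Xv.
have [ia iw] : (v o0)^-1 != 0 /\ (v o3)^-1 != 0 by rewrite !invr_eq0.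
pose x := (v o0)^-1 * v o1; pose y := (v o0)^-1 ^+ m * (v o3)^-1 * v o2.
pose t := torus (v o0)^-1 (v o3)^-1.
have vE : @act K T t v = V1 x y.
  by rewrite [v in LHS]vec4_eta act_torus !mulVf.
have Xv1 : X (V1 x y) by rewrite -vE; apply: curve_act.
have tv1 : tangent X (V1 x y) (@act K T t h) by rewrite -vE; apply: tangent_act.
have xy : y ^+ 2 = P.@[V1 x y].
  have [_ _] := (locus_curve _).1 Xv1.
  by rewrite /V1 !vec4E expr1n mul1r.
have [alpha [rho hE]] := tangent_chart1 xy tv1.
exists x, y, alpha; split=> // om om_reg; have [[_ tH] _] := chart1 xy.
rewrite -vE in Xv1 tH hE *.
exact: (regular_transport om_reg Xv tvh Xv1 tH (torus_neq0 ia iw) hE).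
Qed.

Lemma to_chart2 v h : X v -> tangent X v h -> v o1 != 0 ->
  exists x y alpha, y ^+ 2 = P.@[V2 x y] /\ forall om, regular_form X om ->
    om (v, h) = alpha * om (V2 x y, H2 x y).
Proof.
move=> Xv tvh b0; have [_ w0 _] := (locus_curve v).1 Xv.
have [ib iw] : (v o1)^-1 != 0 /\ (v o3)^-1 != 0 by rewrite !invr_eq0.
pose x := (v o1)^-1 * v o0; pose y := (v o1)^-1 ^+ m * (v o3)^-1 * v o2.
pose t := torus (v o1)^-1 (v o3)^-1.
have vE : @act K T t v = V2 x y.
  by rewrite [v in LHS]vec4_eta act_torus !mulVf.
have Xv1 : X (V2 x y) by rewrite -vE; apply: curve_act.
have tv1 : tangent X (V2 x y) (@act K T t h) by rewrite -vE; apply: tangent_act.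
have xy : y ^+ 2 = P.@[V2 x y].
  have [_ _] := (locus_curve _).1 Xv1.
  by rewrite /V2 !vec4E expr1n mul1r.
have [alpha [rho hE]] := tangent_chart2 xy tv1.
exists x, y, alpha; split=> // om om_reg; have [[_ tH] _] := chart2 xy.
rewrite -vE in Xv1 tH hE *.
exact: (regular_transport om_reg Xv tvh Xv1 tH (torus_neq0 ib iw) hE).
Qed.

Lemma form_chart1 k x y : y ^+ 2 = P.@[V1 x y] ->
  form k (V1 x y, H1 x y) = 2%:R * x ^+ k.
Proof.
move=> xy; have [_ oE] := chart1 xy.
by rewrite /form /= oE /V1 !vec4E expr1n; ring.
Qed.

Lemma form_chart2 k x y : y ^+ 2 = P.@[V2 x y] ->
  form k (V2 x y, H2 x y) = 2%:R * x ^+ (m - 2 - k).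
Proof.
move=> xy; have [_ oE] := chart2 xy.
by rewrite /form /= oE /V2 !vec4E expr1n; ring.
Qed.

(** On the first chart [form k] is 2 x^k, which gives independence. A regular form is given there by
    a polynomial r of degree at most m - 2, and the second chart shows the same coefficients r_k /
    2. *)
Lemma curve_genus : genus X (m - 1).
Proof.
exists (fun k : 'I_(m - 1) => form k); split=> [k|c cE k|om om_reg].
- by apply: form_regular; apply: ltn_ord.
- have two : 2%:R != 0 :> K by rewrite pnatr_eq0.
  pose p := \poly_(i < m - 1) (if insub i is Some j then c j else 0).
  suff p0 : p = 0.
    have := congr1 (fun q : {poly K} => q`_k) p0.
    by rewrite /= coef_poly ltn_ord coef0 valK.
  apply: (poly_vanish (oner_neq0 _)) => x _.
  pose y := sqrtC P.@[V1 x 0].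
  have xy : y ^+ 2 = P.@[V1 x y] by rewrite sqrtCK /V1 [RHS]P_vec4 P_vec4.
  have [tV _] := chart1 xy; have := cE _ tV.
  under eq_bigr do rewrite form_chart1 // mulrCA.
  rewrite -mulr_sumr => /eqP; rewrite mulf_eq0 (negPf two) => /eqP <-.
  by rewrite horner_poly; apply: eq_bigr => i _; rewrite valK.
have [r [rm r1 r2]] := regular_form_chart om_reg.
have two : 2%:R != 0 :> K by rewrite pnatr_eq0.
exists (fun k => r`_k / 2%:R) => -[v h] [/= Xv tvh].
have [ab _ _] := (locus_curve v).1 Xv; case/orP: ab => [a0|b0].
  have [x [y [alpha [xy omE]]]] := to_chart1 Xv tvh a0.
  rewrite omE // r1 // (horner_coef_wide _ rm) mulr_sumr; apply: eq_bigr => k _.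
  rewrite (omE _ (form_regular (ltn_ord k))) form_chart1 //.
  by field.
have [x [y [alpha [xy omE]]]] := to_chart2 Xv tvh b0.
rewrite omE // r2 // mulr_sumr; apply: eq_bigr => k _.
rewrite (omE _ (form_regular (ltn_ord k))) form_chart2 //.
by field.
Qed.

End HyperellipticCurve.

(** * Morphisms given by one tuple of multihomogeneous polynomials *)

Section Morphisms.
Variable K : numClosedFieldType.

Lemma same_pt_refl (T : ambient) (v : pt K T) : same_pt v v.
Proof.
exists (fun=> 1); split=> [j|i]; first exact: oner_neq0.
by rewrite big1 ?mul1r // => j _; rewrite expr1n.
Qed.

Lemma morphism_poly (T T' : ambient) (U : pt K T -> Prop) (V : pt K T' -> Prop)
    (d : 'I_(nblk T') -> 'I_(nblk T) -> nat)
    (G : 'I_(ncoor T') -> {mpoly K[ncoor T]}) :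
  (forall i, @mhomog K T (fun j => \sum_k wt i k * d k j)%N (G i)) ->
  (forall v, V v -> stable v) ->
  (forall v, U v -> V (fun i => (G i).@[v])) ->
  morphism U V (fun v i => (G i).@[v]).
Proof.
move=> hG sV UV; split=> // v Uv; exists d, G; split=> //; split.
  exact/sV/UV.
by move=> v' _ _; apply: same_pt_refl.
Qed.

Lemma mhomog_bigprod (T : ambient) (I : Type) (s : seq I)
    (d : I -> 'I_(nblk T) -> nat) (F : I -> {mpoly K[ncoor T]}) :
  (forall i, mhomog (d i) (F i)) ->
  mhomog (fun j => \sum_(i <- s) d i j)%N (\prod_(i <- s) F i).
Proof.
move=> hF; elim: s => [|i s IH].
  rewrite big_nil -mpolyC1; apply: (mhomog_ext _ (@mhomogC K T 1)) => j.
  by rewrite big_nil.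
rewrite big_cons; apply: (mhomog_ext _ (mhomogM (hF i) IH)) => j.
by rewrite big_cons.
Qed.

(** The matrix [d] of degrees acts on multidegrees; this is used to pull the equations of a curve
    back to its product with P^1. *)
Lemma mhomog_comp (T T' : ambient) (d : 'I_(nblk T') -> 'I_(nblk T) -> nat)
    (G : 'I_(ncoor T') -> {mpoly K[ncoor T]}) (e : 'I_(nblk T') -> nat) f :
  (forall i, @mhomog K T (fun j => \sum_k wt i k * d k j)%N (G i)) ->
  @mhomog K T' e f ->
  @mhomog K T (fun j => \sum_k e k * d k j)%N (f \mPo [tuple G i | i < ncoor T']).
Proof.
move=> hG hf; rewrite comp_mpolyEX big_seq; apply: mhomog_sum => m mf.
rewrite -mul_mpolyC comp_mpolyX.
have h := mhomogM (@mhomogC K T f@_m)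
  (mhomog_bigprod (s := index_enum 'I_(ncoor T')) (fun i => mhomogXn (k := m i) (hG i))).
move: h; rewrite (eq_bigr (fun i => tnth [tuple G i | i < ncoor T'] i ^+ m i)); last first.
  by move=> i _; rewrite tnth_mktuple.
apply: mhomog_ext => j; rewrite add0n.
rewrite (eq_bigr (fun i => \sum_k m i * wt i k * d k j)%N); last first.
  by move=> i _; rewrite big_distrr; apply: eq_bigr => k _; exact: mulnA.
rewrite exchange_big; apply: eq_bigr => k _; rewrite -big_distrl /=.
by rewrite (hf _ mf).
Qed.

Lemma zclosed_empty (T : ambient) : zclosed (fun _ : pt K T => False).
Proof.
exists (eq 1); split=> [f <-|v].
  by exists (fun=> 0%N); rewrite -mpolyC1; apply: mhomogC.
by split=> // -[_ /(_ _ erefl)] /eqP; rewrite meval1 oner_eq0.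
Qed.

End Morphisms.

(** * The trivial ruled surface X x P^1 *)

Section TrivialBundle.
Variables (K : numClosedFieldType) (T : ambient) (X : pt K T -> Prop).
Hypotheses (X_closed : zclosed X).
Local Notation TP := (prod_ambient T (proj 1)).
Local Notation W := (times_P1 X).

Lemma stable_fst (T2 : ambient) (v : pt K (prod_ambient T T2)) :
  stable v <-> stable (fst_pt v) /\ stable (snd_pt v).
Proof.
split=> [sv|[s1 s2] j].
  split=> j.
    have [i [bi vi]] := sv (lshift _ j); move: bi vi; rewrite -{2}(fintype.splitK (i : 'I_(ncoor T + ncoor T2))) /= /prod_blk.
    case: (fintype.split i) => k /=; last by move/eqP; rewrite eq_sym eq_lrshift.
    by move/lshift_inj => <- vk; exists k.
  have [i [bi vi]] := sv (rshift _ j); move: bi vi; rewrite -{2}(fintype.splitK (i : 'I_(ncoor T + ncoor T2))) /= /prod_blk.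
  case: (fintype.split i) => k /=; first by move/eqP; rewrite eq_lrshift.
  by move/rshift_inj => <- vk; exists k.
rewrite -(fintype.splitK (j : 'I_(nblk T + nblk T2))); case: (fintype.split j) => k /=.
  have [i [<- vi]] := s1 k; exists (lshift _ i); split=> //.
  by rewrite /= /prod_blk (fintype.unsplitK (inl _ i)).
have [i [<- vi]] := s2 k; exists (rshift _ i); split=> //.
by rewrite /= /prod_blk (fintype.unsplitK (inr _ i)).
Qed.

Definition fst_deg (k : 'I_(nblk T)) (j : 'I_(nblk TP)) : nat :=
  match fintype.split j with inl j1 => k == j1 | inr _ => 0 end.

Lemma fst_homog i : @mhomog K TP (fun j => \sum_k wt i k * fst_deg k j)%N
  'X_(lshift (ncoor (proj 1)) i).
Proof.
apply: (mhomog_ext _ (@mhomogX K TP (lshift (ncoor (proj 1)) i))) => j.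
rewrite /fst_deg /= /prod_wt (fintype.unsplitK (inl _ i)); case: (fintype.split j) => j1.
  rewrite (bigD1 j1) //= eqxx muln1 big1 ?addn0 // => k /negPf ->.
  by rewrite muln0.
by rewrite big1 // => k _; rewrite muln0.
Qed.

Lemma id_homog i :
  @mhomog K TP (fun j => \sum_k wt i k * (k == j))%N 'X_i.
Proof.
apply: (mhomog_ext _ (@mhomogX K TP i)) => j.
rewrite (bigD1 j) //= eqxx muln1 big1 ?addn0 // => k /negPf ->.
by rewrite muln0.
Qed.

Lemma X_stable v : X v -> stable v.
Proof. by case: X_closed => S [_ XP] /XP []. Qed.

Lemma times_P1_stable v : W v -> stable v.
Proof. by move=> [Xv sv]; apply/stable_fst; split=> //; apply: X_stable. Qed.

Lemma times_P1_closed : zclosed W.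
Proof.
have [S [hS XP]] := X_closed.
pose lift_eq (f : {mpoly K[ncoor T]}) : {mpoly K[ncoor TP]} := f \mPo [tuple 'X_(lshift (ncoor (proj 1)) i) | i < ncoor T].
have liftE f (v : pt K TP) : (lift_eq f).@[v] = f.@[fst_pt v].
  rewrite comp_mpoly_meval; apply: meval_eq => i.
  by rewrite tnth_mktuple mevalXU.
exists (fun f' => exists2 f, S f & f' = lift_eq f); split=> [_ [f /hS[d hf] ->]|v].
  by exists (fun j => \sum_k d k * fst_deg k j)%N; apply: mhomog_comp hf; apply: fst_homog.
split=> [Wv|[/stable_fst[s1 s2] Sv]].
  split; first exact: times_P1_stable.
  by move=> _ [f Sf ->]; rewrite liftE; case: Wv => /XP[_ ->].
split=> //; apply/XP; split=> // f Sf; rewrite -liftE.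
by apply: Sv; exists f.
Qed.

(** The whole of X serves as trivializing open set, with the identity as trivialization. *)
Lemma times_P1_bundle : P1_bundle W X (@fst_pt K T (proj 1)).
Proof.
have X_open : zopen_in X X.
  exists (fun=> False); first exact: zclosed_empty.
  by move=> v; split=> [Xv|[]] //; split.
have id_morph (U V : pt K TP -> Prop) : (forall v, V v -> stable v) ->
    (forall v, U v -> V v) -> morphism U V id.
  move=> sV UV; split=> // v Uv; exists (fun k j => (k == j) : nat), (fun i => 'X_i).
  have XE (v' : pt K TP) : (fun i => ('X_i : {mpoly K[ncoor TP]}).@[v']) = v'.
    by apply/funext => i; rewrite mevalXU.
  split; first exact: id_homog.
  by split=> [|v' _ _]; rewrite XE; [exact/sV/UV | apply: same_pt_refl].
split.
  split=> [v []//|v [Xv sv]]; exists fst_deg, (fun i => 'X_(lshift _ i)).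
  have XE (v' : pt K TP) :
      (fun i => ('X_(lshift _ i) : {mpoly K[ncoor TP]}).@[v']) = fst_pt v'.
    by apply/funext => i; rewrite mevalXU.
  split; first exact: fst_homog.
  by split=> [|v' _ _]; rewrite XE; [exact: X_stable | apply: same_pt_refl].
move=> x Xx; exists X; split=> //; exists id, id; split; last first.
  by move=> w _ _; apply: same_pt_refl.
split; try by move=> *; apply: same_pt_refl.
- by apply: id_morph => [v /times_P1_stable|v []].
- by apply: id_morph => [v [/times_P1_stable]|v Wv] //; split=> //; case: Wv.
Qed.

Lemma times_P1_ruled g : smooth_proj_curve X -> genus X g ->
  ruled_surface_of_genus W g.
Proof.
move=> sX gX; split; first exact: times_P1_closed.
by exists T, X, (@fst_pt K T (proj 1)); split=> //; apply: times_P1_bundle.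
Qed.

End TrivialBundle.

(** * The hyperelliptic curve of the branch divisor *)

Section BranchCurve.
Variables (K : numClosedFieldType) (n : nat) (l c : nat -> K).
Hypotheses (n_ge4 : (4 <= n)%N)
  (l0 : forall i, (3 <= i < n.+2)%N -> l i != 0)
  (l_inj : forall i j, (3 <= i < n.+2)%N -> (3 <= j < n.+2)%N -> l i = l j -> i = j).

Local Notation o0 := (inord 0 : 'I_4).
Local Notation o1 := (inord 1 : 'I_4).
Local Notation o2 := (inord 2 : 'I_4).
Local Notation o3 := (inord 3 : 'I_4).
Let m := (n.+1 %/ 2)%N.
Let e := (2 * m - n)%N.

Definition branch_prod : {mpoly K[4]} :=
  \prod_(3 <= i < n.+2) ('X_o1 - (l i)%:MP * 'X_o0).
(** The right-hand side has degree n in lambda. For odd n the factor a^e, with e = 1, raises the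
    degree to 2m and makes lambda = oo a branch point; for even n, e = 0. *)
Definition branch_form : {mpoly K[4]} := 'X_o1 * ('X_o0 ^+ e * branch_prod).

Lemma branch_prod_val v : branch_prod.@[v] = Pval n l (v o0) (v o1).
Proof.
by rewrite /branch_prod rmorph_prod; apply: eq_bigr => i _ /=; rewrite !mevalS.
Qed.

Lemma branch_form_val v :
  branch_form.@[v] = v o1 * (v o0 ^+ e * Pval n l (v o0) (v o1)).
Proof. by rewrite /branch_form !mevalS branch_prod_val. Qed.

Lemma half_gt1 : (1 < m)%N. Proof. by rewrite /m; lia. Qed.
Lemma half_excess : (e + n = 2 * m)%N. Proof. by rewrite /e /m; lia. Qed.
Lemma half_excess_le1 : (e <= 1)%N. Proof. by rewrite /e /m; lia. Qed.

Lemma branch_form_homog : @mhomog K (hirz m) (bideg (2 * m) 0) branch_form.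
Proof.
have hprod : @mhomog K (hirz m) (fun j => size (index_iota 3 n.+2) * bideg 1 0 j)%N branch_prod.
  apply: mhomog_prod => i; apply: mhomogB; first exact: mhomog_o1.
  exact: (mhomog_ext _ (mhomogM (@mhomogC K (hirz m) (l i)) (@mhomog_o0 K m))).
apply: (mhomog_ext _ (mhomogM (@mhomog_o1 K m)
  (mhomogM (mhomogXn (k := e) (@mhomog_o0 K m)) hprod))).
by move: half_excess n_ge4; rewrite size_iota => em n4 [[|[|//]] ?]; rewrite /bideg /=; lia.
Qed.

Lemma branch_form_indep i : (2 <= i < 4)%N -> indep (inord i) branch_form.
Proof.
move=> /andP[i2 i4]; have o_neq j : (j < 2)%N -> indep (inord i) ('X_(inord j) : {mpoly K[4]}).
  by move=> j2; apply: indepXU; rewrite inord_eq //; lia.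
apply: indepM; first exact: o_neq.
apply: indepM; first by apply/indepXn/o_neq.
apply: indep_prod => k; apply: indepB; first exact: o_neq.
by apply: indepM; [apply: indepC | apply: o_neq].
Qed.

Lemma Pval_neq0 a b : (forall i, (3 <= i < n.+2)%N -> b != l i * a) -> Pval n l a b != 0.
Proof.
move=> H; rewrite /Pval prodf_seq_neq0; apply/allP => i.
by rewrite mem_index_iota => /H; rewrite subr_eq0.
Qed.

Lemma branch_form_E_neq0 : subst o1 0 ('X_o0 ^+ e * branch_prod) != 0.
Proof.
apply/negP => /eqP /(congr1 (meval (fun=> 1))).
rewrite substE !mevalS branch_prod_val upd_same upd_other ?inord_eq // expr1n mul1r.
by apply/eqP/Pval_neq0 => i /l0; rewrite mulr1 eq_sym.
Qed.

Lemma mderiv_mdiff k (f : {mpoly K[k]}) i v :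
  f^`M(i).@[v] = mdiff f v (fun j => (j == i)%:R).
Proof.
rewrite /mdiff (bigD1 i) //= big1 ?addr0 ?eqxx ?mulr1 // => j /negPf ->.
by rewrite mulr0.
Qed.

Lemma mderiv_simple_factor k (L F : {mpoly K[k]}) i v : L.@[v] = 0 -> F.@[v] != 0 ->
  mdiff L v (fun j => (j == i)%:R) != 0 -> (L * F)^`M(i).@[v] != 0.
Proof. by move=> Lv Fv dL; rewrite mderiv_mdiff mdiffM Lv mul0r addr0 mulf_neq0. Qed.

(** Each zero lies on exactly one of the linear factors a (present if e = 1), b, b - l_i a, and that
    factor is simple. Its derivative in a or b is 1, and the cofactor is nonzero there. *)
Lemma branch_form_sqfree v : branch_form.@[v] = 0 -> (v o0 != 0) || (v o1 != 0) ->
  (branch_form^`M(o0).@[v] != 0) || (branch_form^`M(o1).@[v] != 0).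
Proof.
move=> fv; have [a0 /= b0|a0 _] := eqVneq (v o0) 0.
  have P0 : Pval n l (v o0) (v o1) != 0.
    by apply: Pval_neq0 => i _; rewrite a0 mulr0.
  have e1 : e = 1%N.
    have := half_excess_le1; case E : e fv => [|[|//]] //.
    by rewrite branch_form_val E expr0 mul1r => /eqP; rewrite mulf_eq0 (negPf b0) (negPf P0).
  apply/orP; left.
  have -> : branch_form = 'X_o0 * ('X_o1 * branch_prod).
    by rewrite /branch_form e1 expr1; ring.
  apply: mderiv_simple_factor; first by rewrite mevalXU.
    by rewrite !mevalS branch_prod_val mulf_neq0.
  by rewrite mdiffX eqxx oner_neq0.
apply/orP; right; have [b0|b0] := eqVneq (v o1) 0.
  apply: mderiv_simple_factor; first by rewrite mevalXU.
    rewrite !mevalS branch_prod_val mulf_neq0 ?expf_neq0 //.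
    by apply: Pval_neq0 => i i3; rewrite b0 eq_sym mulf_neq0 ?l0.
  by rewrite mdiffX eqxx oner_neq0.
have /eqP : Pval n l (v o0) (v o1) = 0.
  move/eqP: fv; rewrite branch_form_val !mulf_eq0 (negPf b0) expf_eq0 (negPf a0).
  by rewrite andbF => /eqP.
rewrite prodf_seq_eq0 => /hasP[k]; rewrite mem_index_iota subr_eq0 => k3 /eqP bE.
pose F := \prod_(j <- index_iota 3 n.+2 | j != k) ('X_o1 - (l j)%:MP * 'X_o0 : {mpoly K[4]}).
have -> : branch_form = ('X_o1 - (l k)%:MP * 'X_o0) * ('X_o1 * 'X_o0 ^+ e * F).
  rewrite /branch_form /branch_prod (bigD1_seq k) ?iota_uniq ?mem_index_iota //= -/F.
  by ring.
apply: mderiv_simple_factor.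
- by rewrite mevalB !mevalS bE subrr.
- rewrite !mevalS !mulf_neq0 ?expf_neq0 // /F rmorph_prod big_seq_cond.
  rewrite prodf_seq_neq0; apply/allP => j _; apply/implyP => /andP[].
  rewrite mem_index_iota => j3 jk; rewrite /= mevalB !mevalS bE -mulrBl mulf_neq0 //.
  by rewrite subr_eq0; apply: contraNneq jk => /l_inj ->.
rewrite mdiffB mdiffM mdiffC !mdiffX !mevalS eqxx inord_eq //.
by rewrite !(mul0r, mulr0, addr0, subr0) oner_neq0.
Qed.

Lemma branch_form_inf : exists u, branch_form.@[vec4 u 1 0 0] = 0.
Proof.
exists (l 3%N)^-1; rewrite branch_form_val !vec4E /Pval big_ltn; last by lia.
have l3 : l 3%N != 0 by apply: l0; lia.
by rewrite divff // subrr !(mul0r, mulr0).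
Qed.

Local Notation C := (locus (curve m branch_form)).
Local Notation W := (times_P1 C).

Lemma branch_ruled : ruled_surface_of_genus W ((n - 1) %/ 2).
Proof.
have Py : indep o2 branch_form by apply: branch_form_indep.
have Pw : indep o3 branch_form by apply: branch_form_indep.
have -> : ((n - 1) %/ 2 = m - 1)%N by rewrite /m; lia.
apply: times_P1_ruled.
- exact: zclosed_locus (curve_homog branch_form_homog).
- exact: (curve_smooth branch_form_homog Py Pw erefl branch_form_E_neq0 branch_form_sqfree).
exact: (curve_genus half_gt1 branch_form_homog Py Pw erefl branch_form_E_neq0
  branch_form_sqfree branch_form_inf).
Qed.

End BranchCurve.

Section ProductWeights.
Variables T1 T2 : ambient.
Local Notation TT := (prod_ambient T1 T2).

Lemma prod_wt_ll i j : wt (lshift (ncoor T2) i : 'I_(ncoor TT)) (lshift (nblk T2) j) = wt i j.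
Proof. by rewrite /= /prod_wt (fintype.unsplitK (inl _ i)) (fintype.unsplitK (inl _ j)). Qed.
Lemma prod_wt_lr i j : wt (lshift (ncoor T2) i : 'I_(ncoor TT)) (rshift (nblk T1) j) = 0%N.
Proof. by rewrite /= /prod_wt (fintype.unsplitK (inl _ i)) (fintype.unsplitK (inr _ j)). Qed.
Lemma prod_wt_rl i j : wt (rshift (ncoor T1) i : 'I_(ncoor TT)) (lshift (nblk T2) j) = 0%N.
Proof. by rewrite /= /prod_wt (fintype.unsplitK (inr _ i)) (fintype.unsplitK (inl _ j)). Qed.
Lemma prod_wt_rr i j : wt (rshift (ncoor T1) i : 'I_(ncoor TT)) (rshift (nblk T1) j) = wt i j.
Proof. by rewrite /= /prod_wt (fintype.unsplitK (inr _ i)) (fintype.unsplitK (inr _ j)). Qed.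

End ProductWeights.

(** * The birational map between B and the product of the curve with P^1 *)

Section Birational.
Variables (K : numClosedFieldType) (n : nat) (l c : nat -> K).
Hypothesis n_ge4 : (4 <= n)%N.
Let m := (n.+1 %/ 2)%N.
Let e := (2 * m - n)%N.
Local Notation T := (bundle n).
Local Notation T' := (prod_ambient (hirz m) (proj 1)).
Local Notation C := (locus (curve m (branch_form n l))).
Local Notation B := (locus (branchK n l c)).

Definition tri (x y z : nat) : 'I_(2 + 1) -> nat := fun j => nth 0%N [:: x; y; z] j.

Lemma ord2P (i : 'I_2) : i = inord 0 \/ i = inord 1.
Proof. by case: i => -[|[|//]] ?; [left|right]; apply/val_inj; rewrite /= inordK. Qed.

Lemma ord5P (i : 'I_5) : [\/ i = inord 0, i = inord 1, i = inord 2 | i = inord 3 \/ i = inord 4].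
Proof.
by case: i => -[|[|[|[|[|//]]]]] ?;
  [constructor 1|constructor 2|constructor 3|constructor 4; left|constructor 4; right];
  apply/val_inj; rewrite /= inordK.
Qed.

Lemma wt_T' j :
  [/\ wt (lshift 2 (inord 0 : 'I_4) : 'I_(ncoor T')) j = tri 1 0 0 j,
      wt (lshift 2 (inord 1 : 'I_4) : 'I_(ncoor T')) j = tri 1 0 0 j,
      wt (lshift 2 (inord 2 : 'I_4) : 'I_(ncoor T')) j = tri m 1 0 j,
      wt (lshift 2 (inord 3 : 'I_4) : 'I_(ncoor T')) j = tri 0 1 0 j &
      forall i : 'I_2, wt (rshift 4 i : 'I_(ncoor T')) j = tri 0 0 1 j].
Proof.
rewrite -(fintype.splitK (j : 'I_(2 + 1))); case: (fintype.split _) => k.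
  have h i : wt (lshift 2 i : 'I_(ncoor T')) (lshift 1 k) = hirz_wt m i k.
    exact: (@prod_wt_ll (hirz m) (proj 1) i k).
  rewrite /= in h *; rewrite !h /hirz_wt !inordK //; split=> //;
    try by case: k {h} => [[|[|]]].
  move=> i; rewrite -[LHS]/(wt (rshift 4 i : 'I_(ncoor T')) (lshift 1 k)).
  by rewrite (@prod_wt_rl (hirz m) (proj 1)); case: k {h} => [[|[|]]].
have h i : wt (lshift 2 i : 'I_(ncoor T')) (rshift 2 k) = 0%N.
  exact: (@prod_wt_lr (hirz m) (proj 1) i k).
rewrite /= in h *; rewrite !h /tri /= ord1; split=> // i.
by rewrite -[LHS]/(wt (rshift 4 i : 'I_(ncoor T')) (rshift 2 ord0))
  (@prod_wt_rr (hirz m) (proj 1)).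
Qed.

Lemma sum_T' x y z j (d : nat -> nat -> nat) :
  (\sum_(k < 2 + 1) tri x y z k * d k j = x * d 0 j + y * d 1 j + z * d 2 j)%N.
Proof. by rewrite !big_ord_recl big_ord0 /tri /= addn0 !addnA. Qed.

Lemma prod_T' (t0 t1 t2 : K) x y z :
  \prod_(j < 2 + 1) [:: t0; t1; t2]`_j ^+ tri x y z j = t0 ^+ x * t1 ^+ y * t2 ^+ z.
Proof. by rewrite !big_ord_recl big_ord0 /tri /= mulr1 !mulrA. Qed.

Lemma wt_T j :
  [/\ wt (inord 0 : 'I_(ncoor T)) j = bideg 1 0 j,
      wt (inord 1 : 'I_(ncoor T)) j = bideg 1 0 j,
      wt (inord 2 : 'I_(ncoor T)) j = bideg (n - 2) 1 j,
      wt (inord 3 : 'I_(ncoor T)) j = bideg (n - 2) 1 j &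
      wt (inord 4 : 'I_(ncoor T)) j = bideg 0 1 j].
Proof. by rewrite /= /bundle_wt !inordK. Qed.

Lemma prod_T (t0 t1 : K) x y :
  \prod_(j < 2) [:: t0; t1]`_j ^+ bideg x y j = t0 ^+ x * t1 ^+ y.
Proof. by rewrite !big_ord_recl big_ord0 /bideg /= mulr1. Qed.

Lemma sum_T x y j (d : nat -> nat -> nat) :
  (\sum_(k < 2) bideg x y k * d k j = x * d 0 j + y * d 1 j)%N.
Proof. by rewrite !big_ord_recl big_ord0 /bideg /= addn0. Qed.

Local Notation a := ('X_(inord 0) : {mpoly K[ncoor T]}).
Local Notation b := ('X_(inord 1) : {mpoly K[ncoor T]}).
Local Notation x1 := ('X_(inord 2) : {mpoly K[ncoor T]}).
Local Notation x2 := ('X_(inord 3) : {mpoly K[ncoor T]}).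
Local Notation w := ('X_(inord 4) : {mpoly K[ncoor T]}).
Local Notation a' := ('X_(lshift 2 (inord 0 : 'I_4)) : {mpoly K[ncoor T']}).
Local Notation b' := ('X_(lshift 2 (inord 1 : 'I_4)) : {mpoly K[ncoor T']}).
Local Notation y' := ('X_(lshift 2 (inord 2 : 'I_4)) : {mpoly K[ncoor T']}).
Local Notation w' := ('X_(lshift 2 (inord 3 : 'I_4)) : {mpoly K[ncoor T']}).
Local Notation s0 := ('X_(rshift 4 (inord 0 : 'I_2)) : {mpoly K[ncoor T']}).
Local Notation s1 := ('X_(rshift 4 (inord 1 : 'I_2)) : {mpoly K[ncoor T']}).

Definition ghomW : {mpoly K[ncoor T']} :=
  \sum_(k < n) (c k)%:MP * a' ^+ (n.-1 - k) * b' ^+ k.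

(* With lambda = b / a, y = eta1 eta2 - g(lambda) and s = eta1 = x1 / (a^(n-2) w),
   the maps are (lambda, eta1, eta2) |-> (lambda, y, s) and
   (lambda, y, s) |-> (lambda, s, (g(lambda) + y) / s). *)
Definition toW (i : 'I_(ncoor T')) : {mpoly K[ncoor T]} :=
  match fintype.split (i : 'I_(4 + 2)) with
  | inl i1 => vec4 a b (x1 * x2 - gtermK n c) (w ^+ 2 * a ^+ (2 * n - 4 - m)) i1
  | inr i2 => nth 0 [:: x1; a ^+ (n - 2) * w] i2
  end.

Definition fromW (i : 'I_(ncoor T)) : {mpoly K[ncoor T']} :=
  nth 0 [:: a'; b'; a' ^+ (n - 1) * w' * s0 ^+ 2;
    s1 ^+ 2 * (w' * ghomW + a' ^+ (n - 1 - m) * y'); a' * w' * s0 * s1] i.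

(** x1 x2 has bidegree (2n - 4, 2), while y carries the base weight m times and its own fibre weight
    once. Hence the second row (2n - 4 - m, 2), which is also the degree of the w coordinate. *)
Lemma toW_homog i : @mhomog K T (fun j => \sum_k wt i k *
  nth 0 (nth [::] [:: [:: 1; 0]; [:: 2 * n - 4 - m; 2]; [:: n - 2; 1]] k) j)%N (toW i).
Proof.
have ha : @mhomog K T (bideg 1 0) a.
  by apply: (mhomog_ext _ (@mhomogX K T _)) => j; case: (wt_T j).
have hb : @mhomog K T (bideg 1 0) b.
  by apply: (mhomog_ext _ (@mhomogX K T _)) => j; case: (wt_T j).
have hx1 : @mhomog K T (bideg (n - 2) 1) x1.
  by apply: (mhomog_ext _ (@mhomogX K T _)) => j; case: (wt_T j).
have hx2 : @mhomog K T (bideg (n - 2) 1) x2.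
  by apply: (mhomog_ext _ (@mhomogX K T _)) => j; case: (wt_T j).
have hw : @mhomog K T (bideg 0 1) w.
  by apply: (mhomog_ext _ (@mhomogX K T _)) => j; case: (wt_T j).
have mn : (m <= n - 1)%N by rewrite /m; lia.
have hG : @mhomog K T (bideg (n - 1) 0) (ghomK n c).
  apply: mhomog_sum => k _.
  apply: (mhomog_ext _ (mhomogM (mhomogM (@mhomogC K T (c k))
    (mhomogXn (k := (n.-1 - k)%N) ha)) (mhomogXn (k := k) hb))).
  by have := ltn_ord k => kn [[|[|//]] ?]; rewrite /bideg /=; lia.
have hH : @mhomog K T (bideg (2 * n - 4) 2) (gtermK n c).
  apply: (mhomog_ext _ (mhomogM (mhomogM (mhomogXn (k := 2) hw)
    (mhomogXn (k := (n - 3)%N) ha)) hG)).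
  by move=> [[|[|//]] ?]; rewrite /bideg /=; lia.
set dG := fun k j : nat =>
  (nth 0 (nth [::] [:: [:: 1; 0]; [:: 2 * n - 4 - m; 2]; [:: n - 2; 1]] k) j)%N.
have ext x y z x' y'' f : @mhomog K T (bideg x' y'') f ->
    (forall j : 'I_2, bideg x' y'' j = x * dG 0 j + y * dG 1 j + z * dG 2 j)%N ->
    (forall k, wt i k = tri x y z k) ->
    @mhomog K T (fun j => \sum_k wt i k * dG k j)%N f.
  move=> hf deg wti; apply: (mhomog_ext _ hf) => j; rewrite deg -sum_T'.
  by apply: eq_bigr => k _; rewrite wti.
rewrite /toW; move: ext; rewrite -{1}(fintype.splitK (i : 'I_(4 + 2))).
case: (fintype.split _) => k /= ext.
  case: (ord4P k) ext => -> ext; rewrite vec4E.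
  - apply: (ext 1%N 0%N 0%N _ _ _ ha) => [[[|[|//]] ?]|j]; rewrite /bideg /dG /=; try lia.
    by case: (wt_T' j).
  - apply: (ext 1%N 0%N 0%N _ _ _ hb) => [[[|[|//]] ?]|j]; rewrite /bideg /dG /=; try lia.
    by case: (wt_T' j).
  - apply: (ext m 1%N 0%N (2 * n - 4)%N 2%N) => [|[[|[|//]] ?]|j];
      rewrite /bideg /dG /=; try lia.
      apply: mhomogB => //; apply: (mhomog_ext _ (mhomogM hx1 hx2)).
      by move=> [[|[|//]] ?]; rewrite /bideg /=; lia.
    by case: (wt_T' j).
  - apply: (ext 0%N 1%N 0%N (2 * n - 4 - m)%N 2%N) => [|[[|[|//]] ?]|j]; rewrite /bideg /dG /=; try lia.
      apply: (mhomog_ext _ (mhomogM (mhomogXn (k := 2) hw)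
        (mhomogXn (k := (2 * n - 4 - m)%N) ha))).
      by move=> [[|[|//]] ?]; rewrite /bideg /=; lia.
    by case: (wt_T' j).
apply: (ext 0%N 0%N 1%N (n - 2)%N 1%N) => [|[[|[|//]] ?]|j]; rewrite /bideg /dG /=; try lia.
  case: (ord2P k) => ->; rewrite inordK //=.
  apply: (mhomog_ext _ (mhomogM (mhomogXn (k := (n - 2)%N) ha) hw)).
  by move=> [[|[|//]] ?]; rewrite /bideg /=; lia.
by case: (wt_T' j) => _ _ _ _ h; apply: h.
Qed.

(** The component for w, of degree (1, 1, 2), is the common factor that clears the denominators of
    eta1 = s0 / s1 and eta2. *)
Lemma fromW_homog i : @mhomog K T' (fun j => \sum_k wt i k *
  nth 0 (nth [::] [:: [:: 1; 0; 0]; [:: 1; 1; 2]] k) j)%N (fromW i).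
Proof.
have ha : @mhomog K T' (tri 1 0 0) a'.
  by apply: (mhomog_ext _ (@mhomogX K T' _)) => j; case: (wt_T' j).
have hb : @mhomog K T' (tri 1 0 0) b'.
  by apply: (mhomog_ext _ (@mhomogX K T' _)) => j; case: (wt_T' j).
have hy : @mhomog K T' (tri m 1 0) y'.
  by apply: (mhomog_ext _ (@mhomogX K T' _)) => j; case: (wt_T' j).
have hw : @mhomog K T' (tri 0 1 0) w'.
  by apply: (mhomog_ext _ (@mhomogX K T' _)) => j; case: (wt_T' j).
have hs k : @mhomog K T' (tri 0 0 1) 'X_(rshift 4 (k : 'I_2)).
  by apply: (mhomog_ext _ (@mhomogX K T' _)) => j; case: (wt_T' j) => _ _ _ _ ->.
have mn : (m <= n - 1)%N by rewrite /m; lia.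
have hG : @mhomog K T' (tri (n - 1) 0 0) ghomW.
  apply: mhomog_sum => k _.
  apply: (mhomog_ext _ (mhomogM (mhomogM (@mhomogC K T' (c k))
    (mhomogXn (k := (n.-1 - k)%N) ha)) (mhomogXn (k := k) hb))).
  by have := ltn_ord k => kn [[|[|[|//]]] ?]; rewrite /tri /=; lia.
set dH := fun k j : nat => (nth 0 (nth [::] [:: [:: 1; 0; 0]; [:: 1; 1; 2]] k) j)%N.
have ext x y x' y'' z' f : @mhomog K T' (tri x' y'' z') f ->
    (forall j : 'I_3, tri x' y'' z' j = x * dH 0 j + y * dH 1 j)%N ->
    (forall k, wt i k = bideg x y k) ->
    @mhomog K T' (fun j => \sum_k wt i k * dH k j)%N f.
  move=> hf deg wti; apply: (mhomog_ext _ hf) => j; rewrite deg -sum_T.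
  by apply: eq_bigr => k _; rewrite wti.
move: ext; rewrite /fromW; case: (ord5P i) => [->|->|->|[->|->]] ext; rewrite inordK //=.
- apply: (ext 1%N 0%N _ _ _ _ ha) => [[[|[|[|//]]] ?]|j]; rewrite /tri /dH /=; try lia.
  by case: (wt_T j).
- apply: (ext 1%N 0%N _ _ _ _ hb) => [[[|[|[|//]]] ?]|j]; rewrite /tri /dH /=; try lia.
  by case: (wt_T j).
- apply: (ext (n - 2)%N 1%N (n - 1)%N 1%N 2%N) => [|[[|[|[|//]]] ?]|j]; rewrite /tri /dH /=; try lia.
    apply: (mhomog_ext _ (mhomogM (mhomogM (mhomogXn (k := (n - 1)%N) ha) hw)
      (mhomogXn (k := 2) (hs _)))).
    by move=> [[|[|[|//]]] ?]; rewrite /tri /=; lia.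
  by case: (wt_T j).
- apply: (ext (n - 2)%N 1%N (n - 1)%N 1%N 2%N) => [|[[|[|[|//]]] ?]|j]; rewrite /tri /dH /=; try lia.
    have h : @mhomog K T' (tri (n - 1) 1 0) (w' * ghomW + a' ^+ (n - 1 - m) * y').
      apply: mhomogD; first apply: (mhomog_ext _ (mhomogM hw hG)).
        by move=> [[|[|[|//]]] ?]; rewrite /tri /=; lia.
      apply: (mhomog_ext _ (mhomogM (mhomogXn (k := (n - 1 - m)%N) ha) hy)).
      by move=> [[|[|[|//]]] ?]; rewrite /tri /=; lia.
    apply: (mhomog_ext _ (mhomogM (mhomogXn (k := 2) (hs _)) h)).
    by move=> [[|[|[|//]]] ?]; rewrite /tri /=; lia.
  by case: (wt_T j).
apply: (ext 0%N 1%N 1%N 1%N 2%N) => [|[[|[|[|//]]] ?]|j]; rewrite /tri /dH /=; try lia.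
  apply: (mhomog_ext _ (mhomogM (mhomogM (mhomogM ha hw) (hs _)) (hs _))).
  by move=> [[|[|[|//]]] ?]; rewrite /tri /=; lia.
by case: (wt_T j).
Qed.

Lemma toW_fst v : @fst_pt K (hirz m) (proj 1) (fun i => (toW i).@[v]) =
  vec4 (v (inord 0)) (v (inord 1)) (v (inord 2) * v (inord 3) - (gtermK n c).@[v])
    (v (inord 4) ^+ 2 * v (inord 0) ^+ (2 * n - 4 - m)).
Proof.
apply/funext => i; rewrite /fst_pt /toW (fintype.unsplitK (inl _ i)).
by case: (ord4P i) => ->; rewrite !vec4E ?mevalB !mevalS.
Qed.

Lemma toW_snd v (k : 'I_2) : @snd_pt K (hirz m) (proj 1) (fun i => (toW i).@[v]) k =
  nth 0 [:: v (inord 2); v (inord 0) ^+ (n - 2) * v (inord 4)] k.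
Proof.
rewrite /snd_pt /toW (fintype.unsplitK (inr _ k)).
by case: (ord2P k) => ->; rewrite inordK //= !mevalS.
Qed.

Lemma gtermK_val v : (gtermK n c).@[v] =
  v (inord 4) ^+ 2 * v (inord 0) ^+ (n - 3) * Gval n c (v (inord 0)) (v (inord 1)).
Proof. by rewrite /gtermK !mevalS ghomK_val. Qed.

Lemma ghomW_val v : ghomW.@[v] =
  Gval n c (v (lshift 2 (inord 0 : 'I_4))) (v (lshift 2 (inord 1 : 'I_4))).
Proof.
by rewrite /ghomW raddf_sum; apply: eq_bigr => k _ /=; rewrite !mevalS.
Qed.

Lemma fromW_val p (v : pt K T) : v = (fun i => (fromW i).@[p]) ->
  let A := p (lshift 2 (inord 0 : 'I_4)) in let b0 := p (lshift 2 (inord 1 : 'I_4)) in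
  let Y := p (lshift 2 (inord 2 : 'I_4)) in let W := p (lshift 2 (inord 3 : 'I_4)) in
  let S0 := p (rshift 4 (inord 0 : 'I_2)) in let S1 := p (rshift 4 (inord 1 : 'I_2)) in
  [/\ v (inord 0) = A, v (inord 1) = b0,
      v (inord 2) = A ^+ (n - 1) * W * S0 ^+ 2,
      v (inord 3) = S1 ^+ 2 * (W * Gval n c A b0 + A ^+ (n - 1 - m) * Y) &
      v (inord 4) = A * W * S0 * S1].
Proof. by move=> ->; rewrite /fromW !inordK //= !mevalS ghomW_val. Qed.

Lemma toW_val v (p : pt K T') : p = (fun i => (toW i).@[v]) ->
  [/\ p (lshift 2 (inord 0 : 'I_4)) = v (inord 0),
      p (lshift 2 (inord 1 : 'I_4)) = v (inord 1),
      p (lshift 2 (inord 2 : 'I_4)) = v (inord 2) * v (inord 3) -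
        v (inord 4) ^+ 2 * v (inord 0) ^+ (n - 3) * Gval n c (v (inord 0)) (v (inord 1)),
      p (lshift 2 (inord 3 : 'I_4)) = v (inord 4) ^+ 2 * v (inord 0) ^+ (2 * n - 4 - m) &
      p (rshift 4 (inord 0 : 'I_2)) = v (inord 2) /\
      p (rshift 4 (inord 1 : 'I_2)) = v (inord 0) ^+ (n - 2) * v (inord 4)].
Proof.
move=> pE; have h (i : 'I_4) : p (lshift 2 i) =
    @fst_pt K (hirz m) (proj 1) (fun i => (toW i).@[v]) i by rewrite pE.
have h' (i : 'I_2) : p (rshift 4 i) =
    @snd_pt K (hirz m) (proj 1) (fun i => (toW i).@[v]) i by rewrite pE.
by rewrite !h !h' toW_fst !toW_snd !vec4E !inordK // gtermK_val.
Qed.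

Lemma times_P1_C p : let A := p (lshift 2 (inord 0 : 'I_4)) in
  let b0 := p (lshift 2 (inord 1 : 'I_4)) in let Y := p (lshift 2 (inord 2 : 'I_4)) in
  let W := p (lshift 2 (inord 3 : 'I_4)) in let S0 := p (rshift 4 (inord 0 : 'I_2)) in
  A != 0 -> S0 != 0 ->
  times_P1 C p <-> W != 0 /\ Y ^+ 2 = W ^+ 2 * (b0 * (A ^+ e * Pval n l A b0)).
Proof.
move=> A b0 Y W S0 A0 S00; split=> [[/locus_curve[_ W0 YE] _]|[W0 YE]].
  by split=> //; rewrite branch_form_val in YE.
split.
  by apply/locus_curve; split; rewrite ?branch_form_val //; apply/orP; left.
move=> j; exists (inord 0 : 'I_2); split=> //; apply/val_inj.
by case: j => [[|]].
Qed.

(** On the open sets a w x1 <> 0 and a s0 s1 <> 0 both maps are defined by a single tuple of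
    polynomials, and only the torus elements comparing the composites with the identity remain to be
    found. *)
Lemma birational_branch : zclosed C -> birational B (times_P1 C).
Proof.
move=> C_closed; have mn : (m <= n - 1)%N by rewrite /m; lia.
have em : (e + n = 2 * m)%N by rewrite /e /m; lia.
pose D1 : {mpoly K[ncoor T]} := a * w * x1.
pose D2 : {mpoly K[ncoor T']} := a' * s0 * s1.
have D1_homog : exists d, @mhomog K T d D1.
  eexists; apply: mhomogM; [apply: mhomogM|]; exact: mhomogX.
have D2_homog : exists d, @mhomog K T' d D2.
  eexists; apply: mhomogM; [apply: mhomogM|]; exact: mhomogX.
pose U v := B v /\ ~ locus D1 v; pose V v := times_P1 C v /\ ~ locus D2 v.
have UP v : U v <-> [/\ (branchK n l c).@[v] = 0, v (inord 0) != 0,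
    v (inord 2) != 0 & v (inord 4) != 0].
  split=> [[[sv fv] nD]|[fv a0 x0 w0]].
    have : D1.@[v] != 0 by apply/eqP => D0; apply: nD.
    by rewrite !mevalM !mevalXU !mulf_eq0 !negb_or => /andP[/andP[]].
  have D0 : D1.@[v] != 0 by rewrite !mevalM !mevalXU !mulf_neq0.
  split; last by move=> [_ /eqP]; rewrite (negPf D0).
  by split=> //; apply: branchK_stable; rewrite mevalM !mevalXU mulf_neq0.
have V_stable p : V p -> stable p by move=> [/(times_P1_stable C_closed)].
have VP p : V p <-> [/\ p (lshift 2 (inord 0 : 'I_4)) != 0,
    p (rshift 4 (inord 0 : 'I_2)) != 0, p (rshift 4 (inord 1 : 'I_2)) != 0 &
    times_P1 C p].
  split=> [[Wp nD]|[a0 s00 s10 Wp]].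
    have : D2.@[p] != 0.
      by apply/eqP => D0; apply: nD; split=> //; apply: (times_P1_stable C_closed).
    by rewrite !mevalM !mevalXU !mulf_eq0 !negb_or => /andP[/andP[]].
  have D0 : D2.@[p] != 0 by rewrite !mevalM !mevalXU !mulf_neq0.
  by split=> // -[_ /eqP]; rewrite (negPf D0).
exists U, V; split.
- by exists (locus D1) => //; have [d] := D1_homog; apply: zclosed_locus.
- by exists (locus D2) => //; have [d] := D2_homog; apply: zclosed_locus.
- pose z (i : 'I_5) : K := nth 0 [:: 1; 0; 1; Gval n c 1 0; 1] i.
  exists z; apply/UP; rewrite branchK_val /z !inordK //= oner_neq0; split=> //.
  by rewrite !expr1n !mul1r subrr mul0r subr0 expr0n.
(* All exponents are expressed through q and r, so that [ring] and [field] need not handle symbolic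
   ones; 3n - 8 = 2(n - 1 - m) + 2(n - 3) + e uses e = 2m - n. *)
have expA (A : K) : A != 0 -> let q := A ^+ (n - 1 - m) in let r := A ^+ (n - 3) in
    [/\ A ^+ (n - 1) = A ^+ 2 * r, A ^+ (n - 2) = A * r,
        A ^+ (2 * n - 4 - m) = q * r & A ^+ (3 * n - 8) = q ^+ 2 * r ^+ 2 * A ^+ e].
  move=> A0 q r; rewrite -?exprM -?exprD -?[A * r]exprS.
  by split; congr (A ^+ _); move: mn em n_ge4; clear; lia.
pose phi v : pt K T' := fun i => (toW i).@[v].
pose psi p : pt K T := fun i => (fromW i).@[p].
have UV v : U v -> V (phi v).
  move=> /UP[fv a0 x0 w0]; have [pa pb py pw [ps0 ps1]] := toW_val (erefl (phi v)).
  apply/VP; rewrite pa ps0 ps1; split=> //; first by rewrite mulf_neq0 ?expf_neq0.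
  apply/times_P1_C; rewrite ?pa ?ps0 // pb py pw; split.
    by rewrite mulf_neq0 ?expf_neq0.
  have [_ _ -> E3] := expA _ a0; move/eqP: fv; rewrite branchK_val E3 subr_eq0 => /eqP ->.
  move: (v (inord 0) ^+ (n - 1 - m)) (v (inord 0) ^+ (n - 3)) (v (inord 0) ^+ e).
  by move=> q r ae; ring.
have VU p : V p -> U (psi p).
  move=> /VP[a0 s00 s10 /times_P1_C[]// w0 YE].
  have [va vb v1 v2 vw] := fromW_val (erefl (psi p)).
  apply/UP; rewrite branchK_val va vb v1 v2 vw; split; rewrite ?mulf_neq0 ?expf_neq0 //.
  have [E0 E1 E2 E3] := expA _ a0; rewrite E0 E3.
  move: YE; set A := p (lshift 2 (inord 0 : 'I_4)); set b0 := p (lshift 2 (inord 1 : 'I_4)).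
  set Y := p (lshift 2 (inord 2 : 'I_4)); set W := p (lshift 2 (inord 3 : 'I_4)).
  set q := A ^+ (n - 1 - m); set r := A ^+ (n - 3); set G := Gval _ _ _ _.
  set Q := Pval _ _ _ _ => YE.
  transitivity ((A ^+ 2 * r * q * W * p (rshift 4 (inord 0 : 'I_2)) ^+ 2 *
    p (rshift 4 (inord 1 : 'I_2)) ^+ 2) ^+ 2 * (Y ^+ 2 - W ^+ 2 * (b0 * (A ^+ e * Q)))).
    by move: (A ^+ e) q r => ae q r; ring.
  by rewrite YE subrr mulr0.
exists phi, psi; split.
- apply: morphism_poly V_stable UV; exact: toW_homog.
- apply: morphism_poly VU; first exact: fromW_homog.
  by move=> v [[]].
- move=> v /[dup] /UV /VP[_ _ _ _] /UP[fv a0 x0 w0].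
  have [pa pb py pw [ps0 ps1]] := toW_val (erefl (phi v)).
  have [va vb v1 v2 vw] := fromW_val (erefl (psi (phi v))).
  rewrite pa pb py pw ps0 ps1 in va vb v1 v2 vw.
  have [E0 E1 E2 E3] := expA _ a0; rewrite E0 E1 E2 in v1 v2 vw.
  set A := v (inord 0) in a0 va v1 v2 vw E0 E1 E2 E3 *.
  have q0 : A ^+ (n - 1 - m) != 0 by rewrite expf_neq0.
  have r0 : A ^+ (n - 3) != 0 by rewrite expf_neq0.
  set q := A ^+ (n - 1 - m) in q0 v1 v2 vw *; set r := A ^+ (n - 3) in r0 v1 v2 vw *.
  (* The base coordinates return unchanged, so the first torus component is 1; the second is read
     off from the w coordinate. *)
  pose t1 := (A ^+ 2 * q * r ^+ 2 * v (inord 4) ^+ 2 * v (inord 2))^-1.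
  exists (fun j : 'I_2 => [:: 1; t1]`_j); split.
    by move=> [[|[|//]] ?] /=; rewrite ?oner_neq0 // invr_eq0 !mulf_neq0 ?expf_neq0.
  have wE := wt_T.
  have prodE i x y : (forall j, wt (i : 'I_(ncoor T)) j = bideg x y j) ->
      \prod_(j < 2) [:: 1; t1]`_j ^+ wt (i : 'I_(ncoor T)) j = t1 ^+ y.
    move=> wi; rewrite (eq_bigr (fun j : 'I_2 => [:: 1; t1]`_j ^+ bideg x y j)).
      by rewrite prod_T expr1n mul1r.
    by move=> j _; rewrite wi.
  move=> i; case: (ord5P i) => [->|->|->|[->|->]].
  + by rewrite (prodE _ 1%N 0%N) ?mul1r // => j; case: (wE j).
  + by rewrite (prodE _ 1%N 0%N) ?mul1r // => j; case: (wE j).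
  + rewrite (prodE _ (n - 2)%N 1%N); last by move=> j; case: (wE j).
    by rewrite v1 expr1 /t1; field; rewrite a0 x0 w0 q0 r0.
  + rewrite (prodE _ (n - 2)%N 1%N); last by move=> j; case: (wE j).
    by rewrite v2 expr1 /t1; field; rewrite a0 x0 w0 q0 r0.
  + rewrite (prodE _ 0%N 1%N); last by move=> j; case: (wE j).
    by rewrite vw expr1 /t1; field; rewrite a0 x0 w0 q0 r0.
move=> p /VP[a0 s00 s10 /times_P1_C[]// w0 YE].
have [va vb v1 v2 vw] := fromW_val (erefl (psi p)).
have [pa pb py pw [ps0 ps1]] := toW_val (erefl (phi (psi p))).
rewrite va vb v1 v2 vw in pa pb py pw ps0 ps1.
have [E0 E1 E2 E3] := expA _ a0; rewrite E0 ?E1 ?E2 in pa pb py pw ps0 ps1.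
set A := p (lshift 2 (inord 0 : 'I_4)) in a0 pa pb py pw ps0 ps1 E0 E1 E2 E3 *.
have q0 : A ^+ (n - 1 - m) != 0 by rewrite expf_neq0.
have r0 : A ^+ (n - 3) != 0 by rewrite expf_neq0.
set q := A ^+ (n - 1 - m) in q0 py pw *; set r := A ^+ (n - 3) in r0 py pw ps0 ps1 *.
set W := p (lshift 2 (inord 3 : 'I_4)) in w0 py pw ps0 ps1 *.
set S0 := p (rshift 4 (inord 0 : 'I_2)) in s00 py pw ps0 ps1 *.
set S1 := p (rshift 4 (inord 1 : 'I_2)) in s10 py pw ps0 ps1 *.
(* Read off from the coordinate w of the curve; [t2] likewise comes from s0. *)
pose t1 := (A ^+ 2 * W * S0 ^+ 2 * S1 ^+ 2 * q * r)^-1.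
pose t2 := (A ^+ 2 * r * W * S0)^-1.
exists (fun j : 'I_3 => [:: 1; t1; t2]`_j); split.
  by move=> [[|[|[|//]]] ?] /=; rewrite ?oner_neq0 // invr_eq0 !mulf_neq0 ?expf_neq0.
have wE := wt_T'.
have prodE i x y z : (forall j, wt (i : 'I_(ncoor T')) j = tri x y z j) ->
    \prod_(j < 2 + 1) [:: 1; t1; t2]`_j ^+ wt (i : 'I_(ncoor T')) j = t1 ^+ y * t2 ^+ z.
  move=> wi; rewrite (eq_bigr (fun j : 'I_(2 + 1) => [:: 1; t1; t2]`_j ^+ tri x y z j)).
    by rewrite prod_T' expr1n mul1r.
  by move=> j _; rewrite wi.
move=> i; rewrite -(fintype.splitK (i : 'I_(4 + 2))); case: (fintype.split _) => k.
  rewrite [fintype.unsplit _]/=; case: (ord4P k) => ->.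
  + rewrite (prodE _ 1%N 0%N 0%N); last by move=> j; case: (wE j).
    by rewrite pa !expr0 !mul1r.
  + rewrite (prodE _ 1%N 0%N 0%N); last by move=> j; case: (wE j).
    by rewrite pb !expr0 !mul1r.
  + rewrite (prodE _ m 1%N 0%N); last by move=> j; case: (wE j).
    by rewrite py /t1; field; rewrite a0 w0 s00 s10 q0 r0.
  + rewrite (prodE _ 0%N 1%N 0%N); last by move=> j; case: (wE j).
    by rewrite pw -/W /t1; field; rewrite a0 w0 s00 s10 q0 r0.
rewrite [fintype.unsplit _]/= (prodE _ 0%N 0%N 1%N); last first.
  by move=> j; case: (wE j) => _ _ _ _ h; apply: h.
case: (ord2P k) => ->.
  by rewrite ps0 -/S0 /t2; field; rewrite a0 w0 s00 r0.
by rewrite ps1 -/S1 /t2; field; rewrite a0 w0 s00 r0.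
Qed.

End Birational.

Local Open Scope complex_scope.

Theorem proposition5p5 (R : realType) (n : nat) (lam : nat -> R)
    (g : {poly R}) (n_ge4 : (4 <= n)%N) (lam2 : lam 2%N = 0)
    (lam_inj : forall i j : nat, (2 <= i <= n.+1)%N -> (2 <= j <= n.+1)%N ->
       lam i = lam j -> i = j)
    (g_deg : (size g <= n)%N) :
  (irreducible_divisor (branch n lam g) /\
   exists (T : ambient) (W : pt _ T -> Prop),
     ruled_surface_of_genus W ((n - 1) %/ 2)%N /\
     birational (locus (branch n lam g)) W)
  /\
  ((forall a0 b0 : R[i], ~ (a0 = 0 /\ b0 = 0) ->
      (~ reduced_plane_curve (fibre n lam g a0 b0) <->
       (exists2 i : nat, (2 <= i <= n.+1)%N & b0 = (lam i)%:C * a0) \/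
       a0 = 0)) /\
   (forall x : 'I_3 -> R[i],
      (fibre n lam g 0 1).@[x] = 0 <-> x (inord 0) = 0 \/ x (inord 1) = 0) /\
   (forall p : 'rV[R[i]]_3,
      p 0 (inord 0) = 0 ->
      (branch_at_infty n lam g).@[fun i => p 0 i] = 0 ->
      ~ (p 0 (inord 1) = 0 /\ p 0 (inord 2) = 0) ->
      transversal_A (3 * n - 9) (branch_at_infty n lam g) p)).
Proof.
have l_inj i j : (3 <= i < n.+2)%N -> (3 <= j < n.+2)%N ->
    (lam i)%:C = (lam j)%:C -> i = j.
  by move=> i3 j3 /complexI; apply: lam_inj; lia.
have l_neq0 i : (3 <= i < n.+2)%N -> (lam i)%:C != 0.
  move=> i3; apply/eqP => /complexI; rewrite -lam2 => /lam_inj i2.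
  by have := i2 _ _; lia.
rewrite branch_branchK; split.
  split; first exact: branchK_irreducible n_ge4 l_neq0.
  have C_ruled := branch_ruled n_ge4 l_neq0 l_inj.
  eexists _, _; split; first exact: C_ruled.
  apply: birational_branch => //.
  apply/zclosed_locus/curve_homog; exact: branch_form_homog.
split; first by move=> a0 b0 _; apply: reduced_fibre.
by split; [exact: fibre_infty | exact: branch_at_infty_A].
Qed.
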